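(* Let $n\ge 2$ and let $\psi:\mathbb{R}_{>0}\to\mathbb{R}_{>0}$ be monotonic with $\psi(h)\to 0$ as $h\to\infty$. Then the Lebesgue measure of $W_n(\psi)$ satisfies \[ |W_n(\psi)|=\begin{cases}0, & \text{if } \sum_{h=1}^\infty h^{n-2}\psi(h)<\infty,\\[1ex] 1, & \text{if } \sum_{h=1}^\infty h^{n-2}\psi(h)=\infty.\end{cases} \]
   Context: $\mathbb{Z}_{\ge0}$ denotes the set of non-negative integers. For $\mathbf{a}=(a_1,\dots,a_n)\in\mathbb{Z}^n$ the height is $h_{\mathbf{a}}=\max(|a_1|,\dots,|a_n|)$, and $\mathbf{a}^2:=(a_1^2,\dots,a_n^2)$. For $\psi:\mathbb{R}_{>0}\to\mathbb{R}_{>0}$ with $\psi(h)\to0$, define \[ W_n(\psi)=\{\mathbf{x}\in[0,1]^n:\ |\mathbf{a}^2\cdot\mathbf{x}-b^2|<\psi(h_{\mathbf{a}})\ \text{for infinitely many } (\mathbf{a},b)\in\mathbb{Z}_{\ge0}^{n+1} \text{ with } \mathbf{a}\neq\mathbf{0}\}, \] where $\cdot$ is the standard inner product. $|A|$ denotes Lebesgue measure. *)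

(* Defs.v *)
From HB Require Import structures.
From mathcomp Require Import all_boot all_order all_algebra.
From mathcomp Require Import all_classical all_reals all_analysis.
Set Implicit Arguments. Unset Strict Implicit. Unset Printing Implicit Defensive.
Import Order.TTheory GRing.Theory Num.Theory.
Import numFieldNormedType.Exports.
Local Open Scope classical_set_scope.
Local Open Scope ring_scope.

Definition box (R : realType) (n : nat) (a b : 'I_n -> R) : set ('I_n -> R) :=
  [set x | forall i, a i <= x i <= b i].

Definition box_vol (R : realType) (n : nat) (a b : 'I_n -> R) : R :=
  \prod_(i < n) (b i - a i).

(* n-dimensional Lebesgue (outer) measure: infimum of the total volume of
   countable covers by closed boxes. On Lebesgue measurable sets it is the
   Lebesgue measure. *)
Definition lebesgue_outer (R : realType) (n : nat) (A : set ('I_n -> R)) : \bar R :=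
  ereal_inf [set s : \bar R | exists (a b : nat -> 'I_n -> R),
      [/\ (forall k i, a k i <= b k i),
          A `<=` \bigcup_k box (a k) (b k) &
          s = (\sum_(0 <= k <oo) (box_vol (a k) (b k))%:E)%E]].

Definition height (n : nat) (a : 'I_n -> nat) : nat := \max_(i < n) a i.

Definition W (R : realType) (n : nat) (psi : R -> R) : set ('I_n -> R) :=
  [set x | (forall i, 0 <= x i <= 1) /\
     infinite_set [set ab : ('I_n -> nat) * nat |
        ab.1 <> (fun=> 0%N) /\
        `| \sum_(i < n) ((ab.1 i) ^ 2)%:R * x i - (ab.2 ^ 2)%:R | < psi (height ab.1)%:R]].

(* Main.v *)
(* Consider the slabs {x : |a^2 . x - b^2| < psi(h_a)}; one of height h meets the
   unit cube in volume O(psi(h) / h^2), and there are O(h^n) of them with height h.  Convergence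
   of the sum therefore gives measure 0.

   For divergence, restrict to a with all entries of size about M = 16^k and a_1, a_2 coprime
   (a positive proportion of all vectors), and compare two such families in the mean, inside an
   arbitrary cube away from 0.  If M <= M'^O(1), two slab families with 2 x 2 minor D meet in
   parallelograms of area O(psi psi' / D); fixing b leaves O(1 + D / (M^2 M')) values b', and
   D >= |u v' - v u'| M M' / 128, so that averaging 1 / D over coprime pairs costs only a
   logarithm of M M'.  If M is much larger, the slabs of the larger family are equidistributed
   in those of the smaller one along a single coordinate.  The second moment method
   gives a proportion c > 0 of every cube, with c independent of the cube, that is covered by
   slabs of arbitrarily large height.

   All measures are replaced by proportions of the points of a fine grid, whose cells are small
   enough to lie inside a slab together with their corner.  Finally, if boxes of total volume less
   than 1 covered W, nested cells, each chosen inside a slab and where the remaining boxes have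
   small density, would shrink to a point of W outside of every box. *)
Require Import Defs.
From HB Require Import structures.
From mathcomp Require Import all_boot all_order all_algebra.
From mathcomp Require Import all_classical all_reals all_analysis.
From mathcomp Require Import ring lra zify.
Import Order.TTheory GRing.Theory Num.Theory.
Import numFieldNormedType.Exports.
Set Implicit Arguments.
Unset Strict Implicit.
Unset Printing Implicit Defensive.
Local Open Scope classical_set_scope.
Local Open Scope ring_scope.

(** * Counting in finite grids *)

(** Proportional vectors have parallel slabs, and no minor controls their overlap. Coprimality of
    the first two entries excludes them: two distinct vectors either have different slopes there, or
    agree there and differ later, so some 2 x 2 minor with the first coordinate is non-zero.
    Splitting pairs of levels into close and distant ones needs a lower bound for psi, so levels
    with psi(M) / 2 < M^-n are discarded; they only carry a convergent geometric series. On the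
    levels kept, M >= M'^(n+2) gives M psi(M') / 2 >= M'^2, which is what equidistribution requires;
    otherwise log(M M') is O(log M'), and M' absorbs it, together with the factor 1/r due to the
    side r of the cube, as soon as the heights are large. Hence c does not depend on the cube. This
    uniformity stands in for a zero-one law: wherever the remaining boxes have density below c, they
    cannot fill all the slab cells, so the choice of a smaller cell can be repeated for ever. *)

Lemma sum_card_diam (R : realType) (N : nat) (P : pred 'I_N) (L : R) :
  0 <= L ->
  (forall s t : 'I_N, P s -> P t -> (s <= t)%N -> t%:R - s%:R <= L) ->
  \sum_(t < N) (P t)%:R <= L + 1.
Proof.
move=> L0 H.
have [[t0 Pt0]|P0] := pselect (exists t, P t); last first.
  rewrite big1 ?addr_ge0// => t _.
  by case Pt: (P t) => //; case: P0; exists t.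
pose s := [arg min_(i < t0 | P i) (i : nat)].
pose t := [arg max_(i > t0 | P i) (i : nat)].
have [Ps smin] : P s /\ forall j, P j -> (s <= j)%N.
  by rewrite /s; case: arg_minnP.
have [Pt tmax] : P t /\ forall j, P j -> (j <= t)%N.
  by rewrite /t; case: arg_maxnP.
have st : (s <= t)%N by exact: smin.
rewrite -natr_sum.
have -> : (\sum_(i < N) P i)%N = #|P| by rewrite -sum1_card [RHS]big_mkcond.
have : (#|P| <= (t - s).+1)%N.
  rewrite cardE -(size_map val) -(size_iota s (t - s).+1).
  apply: uniq_leq_size; first by rewrite map_inj_uniq ?enum_uniq//; exact: val_inj.
  move=> x /mapP[y]; rewrite mem_enum => Py ->; rewrite mem_iota smin//=.
  by rewrite addnS ltnS subnKC// tmax.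
rewrite -(ler_nat R) => /le_trans; apply.
by rewrite -natr1 natrB// lerD2r; exact: H.
Qed.

(** Projection and fibres: only the rows that contain a pair are charged. It serves for pairs of
    squares as well as for pairs of grid coordinates. *)
Lemma sum_pair_le (R : realType) (T1 T2 : finType) (P : T1 -> T2 -> bool)
    (C1 C2 : R) : 0 <= C2 ->
  \sum_x ([exists y, P x y])%:R <= C1 ->
  (forall x, \sum_y (P x y)%:R <= C2) ->
  \sum_x \sum_y (P x y)%:R <= C1 * C2.
Proof.
move=> C20 H1 H2.
apply: (@le_trans _ _ (\sum_x ([exists y, P x y])%:R * C2)).
  apply: ler_sum => x _; case: (boolP [exists y, P x y]) => [_|/existsPn Px].
    by rewrite mul1r.
  by rewrite mul0r big1// => y _; rewrite (negbTE (Px y)).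
by rewrite -mulr_suml ler_wpM2r.
Qed.

Definition upd (I : finType) (T : Type) (g : {ffun I -> T}) (i : I) (t : T) :=
  [ffun j => if j == i then t else g j].

Lemma updE (I : finType) (T : Type) (g : {ffun I -> T}) (i : I) (t : T) :
  upd g i t i = t.
Proof. by rewrite ffunE eqxx. Qed.

Lemma updN (I : finType) (T : Type) (g : {ffun I -> T}) (i j : I) (t : T) :
  j != i -> upd g i t j = g j.
Proof. by rewrite ffunE => /negbTE ->. Qed.

Section fibre.
Variables (R : realType) (I T : finType).
Implicit Types f : {ffun I -> T} -> R.

(* [(g, t) |-> (upd g i t, g i)] is an involution. *)
Lemma sum_fibre f i :
  \sum_g \sum_t f (upd g i t) = #|T|%:R * \sum_g f g.
Proof.
rewrite pair_big/=.
pose h (p : {ffun I -> T} * T) := (upd p.1 i p.2, p.1 i).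
have hK : involutive h.
  case=> g t; rewrite /h/= updE; congr pair.
  by apply/ffunP => j; rewrite !ffunE; case: eqP => // ->.
rewrite (reindex_inj (inv_inj hK))/=.
under eq_bigr => p _.
  have -> : upd (upd p.1 i p.2) i (p.1 i) = p.1.
    by apply/ffunP => j; rewrite !ffunE; case: eqP => // ->.
  over.
rewrite -(pair_big xpredT xpredT (fun g _ => f g))/=.
under eq_bigr do rewrite sumr_const -mulr_natl.
by rewrite -mulr_sumr.
Qed.

Lemma sum_le_fibre f i (C : R) :
  (forall g, \sum_t f (upd g i t) <= C * #|T|%:R) -> (0 < #|T|)%N ->
  \sum_g f g <= C * (#|T| ^ #|I|)%:R.
Proof.
move=> H T0; rewrite -(ler_pM2l (x := #|T|%:R)) ?ltr0n//.
rewrite -(sum_fibre f i) (le_trans (ler_sum _ (fun g _ => H g)))//.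
by rewrite sumr_const card_ffun -[leLHS]mulr_natr mulrAC mulrC.
Qed.

Lemma sum_ge_fibre f i (C : R) :
  (forall g, C * #|T|%:R <= \sum_t f (upd g i t)) -> (0 < #|T|)%N ->
  C * (#|T| ^ #|I|)%:R <= \sum_g f g.
Proof.
move=> H T0; rewrite -[leRHS]opprK lerNr -sumrN -mulNr.
by apply: (sum_le_fibre (i := i)) => // g; rewrite sumrN mulNr lerN2.
Qed.

Lemma sum_le_fibre2 f i j (C : R) :
  (forall g, \sum_s \sum_t f (upd (upd g i s) j t) <= C * #|T|%:R ^+ 2) ->
  (0 < #|T|)%N ->
  \sum_g f g <= C * (#|T| ^ #|I|)%:R.
Proof.
move=> H T0; rewrite -(ler_pM2l (x := #|T|%:R)) ?ltr0n//.
rewrite -(sum_fibre f j) mulrA (mulrC _ C).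
by apply: (sum_le_fibre (i := i)) => // g; rewrite -mulrA -expr2.
Qed.

End fibre.

(** * Coprime pairs *)

(** Each dyadic block has [2 ^ K] terms, all at most the inverse of [2 ^ K], and so adds at most 1.
    This is the source of the logarithm. *)
Lemma harmonic_le (R : realType) K :
  \sum_(1 <= m < (2 ^ K).+1) (m%:R : R)^-1 <= K%:R + 1.
Proof.
elim: K => [|K IH]; first by rewrite big_nat1 invr1 add0r.
rewrite (@big_cat_nat _ _ _ (2 ^ K).+1)//=; last by rewrite ltnS leq_exp2l.
rewrite -natr1; apply: lerD => //.
apply: (@le_trans _ _ (\sum_((2 ^ K).+1 <= m < (2 ^ K.+1).+1) ((2 ^ K)%:R : R)^-1)).
  rewrite !big_nat; apply: ler_sum => m /andP[Km _].
  by rewrite lef_pV2 ?posrE ?ltr0n ?expn_gt0 ?ler_nat//; lia.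
rewrite sumr_const_nat subSS expnS mul2n -addnn addnK -[leLHS]mulr_natl divff//.
Qed.

(** Telescoping against [1 / (d * (d + 1))] starts after the exact term 1/4; bounding that term too
    would give the useless value 1. What [3 / 4] leaves still has to pay for the [1 / 8] of small
    entries in [coprime_pairs]. *)
Lemma sum_inv_sqr_le (R : realFieldType) M :
  \sum_(2 <= d < M.+1) ((d%:R : R) ^+ 2)^-1 <= 3 / 4.
Proof.
suff H N : \sum_(2 <= d < N.+3) ((d%:R : R) ^+ 2)^-1 <= 3 / 4 - N.+2%:R^-1.
  case: M => [|[|M]]; try by rewrite big_geq//; lra.
  by apply: (le_trans (H M)); rewrite lerBlDr lerDl invr_ge0.
elim: N => [|N IH]; first by rewrite big_nat1; lra.
rewrite big_nat_recr//=; apply: (le_trans (lerD IH (lexx _))).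
have x0 : 1 < N.+2%:R :> R by rewrite ltr1n.
rewrite -[N.+3%:R]natr1; move: (N.+2%:R : R) x0 => x x0.
have -> : 3 / 4 - (x + 1)^-1 = 3 / 4 - x^-1 + (x * (x + 1))^-1.
  by field; apply/andP; split; apply: lt0r_neq0; lra.
rewrite lerD2l lef_pV2 ?posrE ?mulr_gt0 ?exprn_gt0//; lra.
Qed.

Lemma count_le_nat c M : (c <= M)%N -> (\sum_(1 <= v < M.+1) (v <= c) = c)%N.
Proof.
move=> cM; transitivity (\sum_(1 <= v < M.+1 | (v < c.+1)%N) 1)%N.
  by rewrite [RHS]big_mkcond; apply: eq_bigr => i _; rewrite ltnS; case: leqP.
rewrite -(@big_nat_widen _ _ _ 1 c.+1 M.+1 xpredT)//.
by rewrite sum_nat_const_nat muln1 subn1.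
Qed.

(* Pairs with a common divisor [d >= 2] number at most [sum_d (M / d)^2 <= 3 M^2 / 4];
   pairs with an entry at most [M / 16] number at most [M^2 / 8]. *)
Lemma coprime_pairs M :
  (M ^ 2 <= 8 * \sum_(1 <= u < M.+1) \sum_(1 <= v < M.+1)
     [&& coprime u v, M < 16 * u & M < 16 * v])%N.
Proof.
set S := (\sum_(1 <= u < _) _)%N.
pose D := (\sum_(2 <= d < M.+1) (M %/ d) ^ 2)%N.
have Dle : (4 * D <= 3 * M ^ 2)%N.
  rewrite -(ler_nat rat) [leRHS]natrM [leLHS]natrM natr_sum natrX.
  have : \sum_(2 <= d < M.+1) (((M %/ d) ^ 2)%N%:R : rat) <=
      \sum_(2 <= d < M.+1) (M%:R ^+ 2 * ((d%:R : rat) ^+ 2)^-1).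
    rewrite !big_nat; apply: ler_sum => d /andP[d2 _].
    rewrite -expr_div_n natrX lerXn2r ?nnegrE ?divr_ge0//.
    by rewrite ler_pdivlMr ?ltr0n -?natrM ?ler_nat ?leq_divM//; lia.
  rewrite -mulr_sumr => /le_trans => /(_ (M%:R ^+ 2 * (3 / 4))).
  rewrite ler_wpM2l ?sum_inv_sqr_le ?exprn_ge0// => /(_ isT).
  lra.
have pt u v : (0 < u <= M)%N -> (0 < v <= M)%N ->
    (1 <= [&& coprime u v, M < 16 * u & M < 16 * v] +
      \sum_(2 <= d < M.+1) (d %| u) * (d %| v) +
      (u <= M %/ 16) + (v <= M %/ 16))%N.
  move=> uM vM; rewrite !leq_divRL//.
  case: (boolP (coprime u v)) => /= [_|ncop]; first lia.
  suff : (1 <= \sum_(2 <= d < M.+1) (d %| u) * (d %| v))%N by lia.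
  have g2 : (2 <= gcdn u v < M.+1)%N.
    have := gcdn_gt0 u v; have := dvdn_leq _ (dvdn_gcdl u v).
    by rewrite /coprime in ncop; lia.
  rewrite (big_rem (gcdn u v)) ?mem_index_iota//=.
  by rewrite dvdn_gcdl dvdn_gcdr.
have : (\sum_(1 <= u < M.+1) \sum_(1 <= v < M.+1) 1 <= S + D + M * (M %/ 16) + M * (M %/ 16))%N.
  have -> : (S + D + M * (M %/ 16) + M * (M %/ 16) =
    \sum_(1 <= u < M.+1) \sum_(1 <= v < M.+1)
     ([&& coprime u v, M < 16 * u & M < 16 * v] +
      \sum_(2 <= d < M.+1) (d %| u) * (d %| v) +
      (u <= M %/ 16) + (v <= M %/ 16)))%N.
    under [RHS]eq_bigr do rewrite !big_split/=.
    rewrite !big_split/= -/S; congr (_ + _ + _ + _)%N.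
    - under eq_bigr do rewrite exchange_big/=.
      rewrite exchange_big/=; apply: eq_bigr => d _.
      under eq_bigr do rewrite -big_distrr/=.
      by rewrite -big_distrl/= -divn_count_dvd.
    - under eq_bigr do rewrite sum_nat_const_nat subn1/=.
      by rewrite -big_distrr/= count_le_nat// leq_div.
    - under eq_bigr do rewrite count_le_nat ?leq_div//.
      by rewrite sum_nat_const_nat subn1.
  rewrite !big_nat; apply: leq_sum => u uM; rewrite !big_nat; apply: leq_sum => v vM.
  exact: pt.
under eq_bigr do rewrite sum_nat_const_nat subn1/= muln1.
rewrite sum_nat_const_nat subn1/=.
have := leq_divM M 16; move: (M %/ 16)%N => q qM.
rewrite !expnS expn0 muln1 in Dle *.
by nia.
Qed.

(** Within one residue class the quotient by [d] determines the element. *)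
Lemma count_congr d M Q (P : pred 'I_Q.+1) : (0 < d)%N ->
  (forall u : 'I_Q.+1, P u -> (u <= M)%N) ->
  (forall s t : 'I_Q.+1, P s -> P t -> s = t %[mod d]) ->
  (\sum_u P u <= (M %/ d).+1)%N.
Proof.
move=> d0 PM Pd.
have -> : (\sum_u P u)%N = #|P| by rewrite -sum1_card [RHS]big_mkcond.
rewrite -[leqRHS]card_ord.
rewrite -(@card_in_imset _ _ (fun u : 'I_Q.+1 => inord (u %/ d) : 'I_(M %/ d).+1) P).
  exact: max_card.
move=> s t Ps Pt /(congr1 val)/=.
rewrite !inordK ?ltnS ?leq_div2r ?PM// => q.
by apply/val_inj; rewrite /= (divn_eq s d) (divn_eq t d) q (Pd s t).
Qed.

(** The pairs are sorted by the value [m] and the sign of [u * v' - v * u']. For given [m] and sign,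
    [u * v'] is fixed modulo [u'], hence so is [u] by coprimality, and [u] determines [v]. Summing
    [1 / m] up to [2 ^ K] gives the factor [K + 1]. *)
Lemma sum_inv_cross_le (R : realType) (M Q K u' v' : nat) :
  (0 < u')%N -> coprime u' v' -> (M * u' <= 2 ^ K)%N -> (M * v' <= 2 ^ K)%N ->
  \sum_(u < Q.+1 | (u <= M)%N) \sum_(v < Q.+1 | (v <= M)%N && (u * v' != v * u')%N)
     (`| (u * v')%:R - (v * u')%:R | : R)^-1
  <= 2 * (M %/ u').+1%:R * (K%:R + 1).
Proof.
move=> u'0 cop Mu' Mv'.
pose N1 m (u v : 'I_Q.+1) := [&& (u <= M)%N, (v <= M)%N & (u * v' == v * u' + m)%N].
pose N2 m (u v : 'I_Q.+1) := [&& (u <= M)%N, (v <= M)%N & (v * u' == u * v' + m)%N].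
have dvd_sub (s t : nat) : (s * v' = t * v' %[mod u'])%N -> s = t %[mod u'].
  wlog st : s t / (s <= t)%N.
    by move=> W H; case: (leqP s t) => [/W|/ltnW /W/(_ (esym H))/esym]; exact.
  move/eqP; rewrite eq_sym eqn_mod_dvd ?leq_mul2r ?st ?orbT//.
  rewrite -mulnBl Gauss_dvdl// => D; apply/esym/eqP.
  by rewrite eqn_mod_dvd.
have bnd (Nm : 'I_Q.+1 -> 'I_Q.+1 -> bool) :
    (forall u v, Nm u v -> (u <= M)%N) ->
    (forall u v w, Nm u v -> Nm u w -> v = w) ->
    (forall s t v w, Nm s v -> Nm t w -> s * v' = t * v' %[mod u']) ->
    \sum_u \sum_v (Nm u v)%:R <= (M %/ u').+1%:R :> R.
  move=> NM Nf Nc; rewrite -[leRHS]mulr1; apply: sum_pair_le => //.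
    rewrite -natr_sum ler_nat; apply: count_congr => //.
      by move=> u /existsP[v /NM].
    by move=> s t /existsP[v sv] /existsP[w tw]; apply: dvd_sub; exact: Nc sv tw.
  move=> u; have [[v uv]|no] := pselect (exists v, Nm u v).
    rewrite (bigD1 v)//= uv big1 ?addr0// => w wv.
    by case uw: (Nm u w) => //; rewrite (Nf _ _ _ uw uv) eqxx in wv.
  rewrite big1// => v _; case uv: (Nm u v) => //; case: no; by exists v.
have le1 m : \sum_u \sum_v (N1 m u v)%:R <= (M %/ u').+1%:R :> R.
  apply: bnd => [u v /and3P[]//|u v w /and3P[_ _ /eqP a] /and3P[_ _ /eqP b]|].
    apply/val_inj => /=; apply/eqP; rewrite -(eqn_pmul2r u'0); apply/eqP; lia.
  move=> s t v w /and3P[_ _ /eqP ->] /and3P[_ _ /eqP ->].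
  by rewrite !modnMDl.
have le2 m : \sum_u \sum_v (N2 m u v)%:R <= (M %/ u').+1%:R :> R.
  apply: bnd => [u v /and3P[]//|u v w /and3P[_ _ /eqP a] /and3P[_ _ /eqP b]|].
    apply/val_inj => /=; apply/eqP; rewrite -(eqn_pmul2r u'0); apply/eqP; lia.
  move=> s t v w /and3P[_ _ /eqP a] /and3P[_ _ /eqP b].
  by apply/eqP; rewrite -(eqn_modDr m) -a -b !modnMl.
apply: (@le_trans _ _ (\sum_(1 <= m < (2 ^ K).+1) (m%:R : R)^-1 *
    (\sum_u \sum_v (N1 m u v)%:R + \sum_u \sum_v (N2 m u v)%:R))); last first.
  apply: (@le_trans _ _ (\sum_(1 <= m < (2 ^ K).+1) (m%:R : R)^-1 * (2 * (M %/ u').+1%:R))).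
    apply: ler_sum => m _; rewrite ler_wpM2l ?invr_ge0// mulr_natl mulr2n.
    exact: lerD.
  rewrite -mulr_suml mulrC.
  by rewrite ler_wpM2l ?mulr_ge0// harmonic_le.
under [leRHS]eq_bigr do rewrite -big_split/= mulr_sumr.
rewrite exchange_big/= big_mkcond; apply: ler_sum => u _.
case: ifP => uM; last first.
  apply: sumr_ge0 => m _; rewrite mulr_ge0 ?invr_ge0// -big_split.
  by apply: sumr_ge0 => v _; rewrite addr_ge0.
under [leRHS]eq_bigr do rewrite -big_split/= mulr_sumr.
rewrite exchange_big/= big_mkcond; apply: ler_sum => v _.
case: ifP => [/andP[vM ne]|_]; last first.
  by apply: sumr_ge0 => m _; rewrite mulr_ge0 ?invr_ge0// addr_ge0.
have uv'K : (u * v' <= 2 ^ K)%N by apply: leq_trans Mv'; rewrite leq_mul2r uM orbT.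
have vu'K : (v * u' <= 2 ^ K)%N by apply: leq_trans Mu'; rewrite leq_mul2r vM orbT.
(* Absolute difference: one of the two truncated subtractions vanishes. *)
pose m0 := ((u * v' - v * u') + (v * u' - u * v'))%N.
have m0r : (1 <= m0 < (2 ^ K).+1)%N by rewrite /m0; lia.
rewrite (big_rem m0) ?mem_index_iota//=.
rewrite ler_wpDr//.
  by apply: sumr_ge0 => m _; rewrite mulr_ge0 ?invr_ge0// addr_ge0.
have -> : `|(u * v')%:R - (v * u')%:R| = m0%:R :> R.
  rewrite /m0; case: (leqP (u * v') (v * u'))%N => h.
    rewrite distrC -natrB// ger0_norm//; congr (_%:R); lia.
  rewrite -natrB ?ger0_norm//; [congr (_%:R)|]; lia.
rewrite ler_peMr ?invr_ge0//.
rewrite -natrD ler1n /N1 /N2 uM vM/= /m0.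
case: (ltngtP (u * v') (v * u'))%N ne => //= h _.
  by rewrite addn_gt0 !lt0b; apply/orP; right; apply/eqP; lia.
by rewrite addn_gt0 !lt0b; apply/orP; left; apply/eqP; lia.
Qed.

(** * Squares near a linear form *)

(* The constants are locked: unification must never unfold their unary numerals. *)
Section constants.
Variable R : realType.

Definition ksmall : R := locked (1000^-1).
Definition kplane : R := locked 192.
Definition kplane' : R := locked (96 * 128).
Definition kline : R := locked (800 * 1000).
Definition klow : R := locked (64 * 128).
Definition kcross : R := locked 128.

Lemma ksmall_gt0 : 0 < ksmall. Proof. by rewrite /ksmall -lock invr_gt0 ltr0n. Qed.
Lemma kplane_ge0 : 0 <= kplane. Proof. by rewrite /kplane -lock ler0n. Qed.
Lemma kplane'_ge0 : 0 <= kplane'.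
Proof. by rewrite /kplane' -lock mulr_ge0 ?ler0n. Qed.
Lemma kline_ge0 : 0 <= kline.
Proof. by rewrite /kline -lock mulr_ge0 ?ler0n. Qed.
Lemma klow_gt0 : 0 < klow.
Proof. by rewrite /klow -lock mulr_gt0 ?ltr0n. Qed.
Lemma kcross_gt0 : 0 < kcross. Proof. by rewrite /kcross -lock ltr0n. Qed.

End constants.

Section squares.
Variable R : realType.
Implicit Types p y eta M rho : R.

Definition hit p y (b : nat) : bool := `|y - (b ^ 2)%:R| < p.

Definition hits (B : nat) p y : R := \sum_(b < B) (hit p y b)%:R.

Lemma hits_ge0 B p y : 0 <= hits B p y.
Proof. exact: sumr_ge0. Qed.

Lemma hitP p y b : hit p y b -> y - p < b%:R ^+ 2 /\ b%:R ^+ 2 < y + p.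
Proof. by rewrite /hit natrX ltr_norml => /andP[]; lra. Qed.

Lemma hits_le1 B p y : p <= 2^-1 -> hits B p y <= 1.
Proof.
move=> p2; rewrite -[leRHS]add0r; apply: sum_card_diam => // s t Ps Pt st.
rewrite subr_le0 ler_nat leqNgt; apply/negP => ts.
have [+ _] := hitP Ps; have [_] := hitP Pt.
have : (s%:R + 1) ^+ 2 <= t%:R ^+ 2 :> R by rewrite natr1 lerXn2r ?nnegrE// ler_nat.
have : 0 <= s%:R :> R by [].
rewrite sqrrD1; lra.
Qed.

(** Distinct squares are at least 1 apart, so [hits] is 0 or 1. This bounds the diagonal of the
    second moment by the first moment. *)
Lemma hits_sqr_le B p y : p <= 2^-1 -> hits B p y ^+ 2 <= hits B p y.
Proof. by move=> p2; rewrite expr2 ler_piMl ?hits_ge0// hits_le1. Qed.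

(** Away from 0 the form has size [M ^ 2], which forces [b] to have size [M]. The squares involved
    are then spaced by at least [2 * (eta * M)]. *)
Lemma hit_lb p y b eta M : 0 <= eta * M -> 2 * (eta * M) ^+ 2 <= y ->
  p <= (eta * M) ^+ 2 -> hit p y b -> eta * M <= b%:R.
Proof.
move=> e0 yM pM /hitP[h _]; rewrite leNgt; apply/negP => bM.
have : b%:R ^+ 2 <= (eta * M) ^+ 2 by rewrite lerXn2r ?nnegrE// ltW.
lra.
Qed.

(** [c ^ 2 - b ^ 2 = (c - b) * (c + b)] is at least [2 * e * (c - b)]. *)
Lemma count_squares B (P : pred 'I_B) (e L : R) : 0 < e -> 0 <= L ->
  (forall b, P b -> e <= b%:R) ->
  (forall b c : 'I_B, P b -> P c -> (c%:R : R) ^+ 2 - b%:R ^+ 2 <= L) ->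
  \sum_(b < B) (P b)%:R <= L / (2 * e) + 1.
Proof.
move=> e0 L0 Pe PL; apply: sum_card_diam.
  by rewrite divr_ge0// mulr_ge0// ltW.
move=> s t Ps Pt st; rewrite ler_pdivlMr ?mulr_gt0//.
apply: le_trans (PL _ _ Ps Pt); rewrite subr_sqr ler_wpM2l//.
  by rewrite subr_ge0 ler_nat.
by have := Pe _ Ps; have := Pe _ Pt; lra.
Qed.

(** The squares hit lie in a range of length [2 M ^ 2 r + 2 p <= 4 M ^ 2 r] with spacing [2 eta M];
    [1 <= M * r] absorbs the extra 1. *)
Lemma active_count B (T : finType) (F : T -> R) (p eta M r : R) :
  0 < eta -> eta <= 1 -> 0 < M -> 1 <= M * r -> p <= M ^+ 2 * r ->
  p <= (eta * M) ^+ 2 -> (forall s, 2 * (eta * M) ^+ 2 <= F s) ->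
  (forall s t, F t - F s <= 2 * M ^+ 2 * r) ->
  \sum_(b < B) ([exists s, hit p (F s) b])%:R <= 3 * M * r / eta.
Proof.
move=> e0 e1 M0 Mr pr pe Fe FF.
have eM : 0 < eta * M by rewrite mulr_gt0.
apply: (@le_trans _ _ (4 * M ^+ 2 * r / (2 * (eta * M)) + 1)).
  apply: count_squares => //.
  - by rewrite !mulr_ge0 ?exprn_ge0 ?ltW// -(pmulr_rgt0 _ M0); lra.
  - by move=> b /existsP[s]; apply: hit_lb => //; exact: ltW.
  - move=> b c /existsP[s /hitP[h1 h2]] /existsP[t /hitP[h3 h4]].
    by have := FF s t; lra.
have -> : 4 * M ^+ 2 * r / (2 * (eta * M)) = 2 * (M * r) / eta.
  by field; rewrite !lt0r_neq0.
have -> : 3 * M * r / eta = 2 * (M * r) / eta + M * r / eta by ring.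
by rewrite lerD2l ler_pdivlMr// mul1r; lra.
Qed.

(** * Common hits of two families on a grid plane or a grid line *)

Section joint.
Variables (N B : nat) (p p' eta M M' r rho al be al' be' : R).
Hypotheses (p0 : 0 < p) (p'0 : 0 < p') (eta0 : 0 < eta) (eta1 : eta <= 1).
Hypotheses (N0 : (0 < N)%N) (r0 : 0 < r).
Hypotheses (psmall : p <= 1000^-1) (psmall' : p' <= 1000^-1).
Hypotheses (M'1 : 1 <= M') (M'M : M' <= M) (M'r : 1 <= M' * r).
Hypotheses (eM' : 1 <= 2 * eta * M').
Hypotheses (peta : p <= (eta * M) ^+ 2) (peta' : p' <= (eta * M') ^+ 2).
Hypotheses (al_le : al <= M ^+ 2) (al_ge : M ^+ 2 <= 256 * al).
Hypotheses (al'_le : al' <= M' ^+ 2) (al'_ge : M' ^+ 2 <= 256 * al').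
Hypothesis rhoE : rho = r / N%:R.
Hypotheses (Nal : al * rho <= 2 * p) (Nal' : al' * rho <= 2 * p').

Let M0 : 0 < M. Proof. by move: M'1 M'M; lra. Qed.
Let M'0 : 0 < M'. Proof. by move: M'1; lra. Qed.
Let Mr : 1 <= M * r. Proof. by apply: le_trans M'r _; rewrite ler_pM2r. Qed.
Let al0 : 0 < al.
Proof. by have := exprn_gt0 2 M0; move: al_ge; lra. Qed.
Let al'0 : 0 < al'.
Proof. by have := exprn_gt0 2 M'0; move: al'_ge; lra. Qed.
Let NR0 : 0 < N%:R :> R. Proof. by rewrite ltr0n. Qed.
Let rho0 : 0 < rho. Proof. by rewrite rhoE divr_gt0. Qed.
Let eM0 : 0 < eta * M. Proof. by rewrite mulr_gt0. Qed.
Let eM'0 : 0 < eta * M'. Proof. by rewrite mulr_gt0. Qed.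
Let prM : p <= M ^+ 2 * r.
Proof. by move: psmall M'1 M'M Mr; rewrite expr2 -mulrA; nra. Qed.
Let prM' : p' <= M' ^+ 2 * r.
Proof. by move: psmall' M'1 M'r; rewrite expr2 -mulrA; nra. Qed.

Let ord_diff (s t : 'I_N) : rho * (t%:R - s%:R) <= r.
Proof.
have -> : r = rho * N%:R by rewrite rhoE divfK// lt0r_neq0.
rewrite ler_pM2l// lerBlDr (le_trans (y := N%:R))// ?lerDl// ler_nat.
exact: ltnW.
Qed.

Let ord_norm (s t : 'I_N) : `|rho * (t%:R - s%:R)| <= r.
Proof. by rewrite ler_norml ord_diff lerNl -mulrN opprB ord_diff. Qed.

Section plane.
Variables F F' : 'I_N -> 'I_N -> R.
Hypothesis be_le : 0 <= be <= M ^+ 2.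
Hypothesis be'_le : 0 <= be' <= M' ^+ 2.
Variable D : R.
Hypothesis DE : D = `|al * be' - be * al'|.
Hypothesis D0 : 0 < D.
Hypothesis ND : D * rho <= 2 * (al' * p + al * p').
Hypothesis FE : forall s t s1 t1,
  F s t - F s1 t1 = al * (rho * (s%:R - s1%:R)) + be * (rho * (t%:R - t1%:R)).
Hypothesis F'E : forall s t s1 t1,
  F' s t - F' s1 t1 = al' * (rho * (s%:R - s1%:R)) + be' * (rho * (t%:R - t1%:R)).
Hypothesis F_ge : forall s t, 2 * (eta * M) ^+ 2 <= F s t.
Hypothesis F'_ge : forall s t, 2 * (eta * M') ^+ 2 <= F' s t.

(* The points of a single intersection lie in a parallelogram of area [4 p p' / D]. *)
Lemma joint_cell b b' :
  \sum_t \sum_s (hit p (F s t) b && hit p' (F' s t) b')%:R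
    <= 32 * p * p' / (D * rho ^+ 2).
Proof.
(* [L1] bounds the variation of [s] for fixed [t], by either slab; [L2] bounds that of [t], after
   elimination of [s]. The mesh is so fine that both are at least 1, hence
   [(L2 + 1) * (L1 + 1) <= 4 * (L1 * L2)]. *)
pose L1 := Num.min (2 * p / (al * rho)) (2 * p' / (al' * rho)).
pose L2 := 2 * (al' * p + al * p') / (D * rho).
have L11 : 1 <= L1.
  by rewrite /L1 le_min; apply/andP; split; rewrite ler_pdivlMr ?mul1r// mulr_gt0.
have L21 : 1 <= L2.
  by rewrite /L2 ler_pdivlMr ?mul1r// mulr_gt0.
have H : \sum_t \sum_s (hit p (F s t) b && hit p' (F' s t) b')%:R <= (L2 + 1) * (L1 + 1).
  apply: (@sum_pair_le _ _ _ (fun t s => hit p (F s t) b && hit p' (F' s t) b')).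
  - lra.
  - apply: sum_card_diam; first lra.
    move=> t1 t2 /existsP[s1 /andP[/hitP[h1 h2] /hitP[h3 h4]]].
    move=> /existsP[s2 /andP[/hitP[h5 h6] /hitP[h7 h8]]] _.
    rewrite ler_pdivlMr ?mulr_gt0//.
    have e1 := FE s2 t2 s1 t1; have e2 := F'E s2 t2 s1 t1.
    have i1 : `|F s2 t2 - F s1 t1| <= 2 * p by rewrite ler_norml; lra.
    have i2 : `|F' s2 t2 - F' s1 t1| <= 2 * p' by rewrite ler_norml; lra.
    apply: (le_trans (ler_norm _)).
    rewrite !normrM DE normr_id (gtr0_norm rho0) mulrA -[X in _ * X](gtr0_norm rho0).
    rewrite -!normrM.
    have -> : (t2%:R - t1%:R) * (al * be' - be * al') * rho =
        al * (F' s2 t2 - F' s1 t1) - al' * (F s2 t2 - F s1 t1).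
      by rewrite e1 e2; ring.
    apply: (le_trans (ler_normB _ _)); rewrite !normrM (gtr0_norm al0) (gtr0_norm al'0).
    have := ler_wpM2l (ltW al0) i2; have := ler_wpM2l (ltW al'0) i1; lra.
  - move=> t; apply: sum_card_diam; first lra.
    move=> s1 s2 /andP[/hitP[h1 h2] /hitP[h3 h4]] /andP[/hitP[h5 h6] /hitP[h7 h8]] _.
    have := FE s2 t s1 t; have := F'E s2 t s1 t.
    rewrite !subrr !mulr0 !addr0 => e2 e1.
    by rewrite le_min !ler_pdivlMr ?mulr_gt0// ; apply/andP; split; lra.
apply: (le_trans H).
(* The larger summand of [L2] cancels against the smaller quotient in [L1]. *)
have L12 : L1 * L2 <= 8 * p * p' / (D * rho ^+ 2).
  case: (leP (al' * p) (al * p')) => c.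
    have a : L1 <= 2 * p / (al * rho) by rewrite ge_min lexx.
    have b1 : L2 <= 4 * (al * p') / (D * rho).
      by rewrite ler_pM2r ?invr_gt0 ?mulr_gt0//; lra.
    apply: (le_trans (ler_pM _ _ a b1)); try lra.
    by rewrite le_eqVlt; apply/orP; left; apply/eqP; field; rewrite !lt0r_neq0.
  have a : L1 <= 2 * p' / (al' * rho) by rewrite ge_min lexx orbT.
  have b1 : L2 <= 4 * (al' * p) / (D * rho).
    by rewrite ler_pM2r ?invr_gt0 ?mulr_gt0//; lra.
  apply: (le_trans (ler_pM _ _ a b1)); try lra.
  by rewrite le_eqVlt; apply/orP; left; apply/eqP; field; rewrite !lt0r_neq0.
apply: (@le_trans _ _ (4 * (L1 * L2))); first nra.
by have -> : 32 * p * p' / (D * rho ^+ 2) = 4 * (8 * p * p' / (D * rho ^+ 2));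
  [ring | rewrite ler_pM2l].
Qed.

(** In the number of [b'] for fixed [b], the constant term leaves a factor [1 / D], still to be
    averaged over the vectors, and the term proportional to [D] cancels it. The two constants are
    [32 * 3 * 2] and [32 * 3 * 128]. *)
Lemma joint_plane :
  \sum_s \sum_t hits B p (F s t) * hits B p' (F' s t) <=
  p * p' * (kplane R * M / (eta * r * D) + kplane' R / (eta ^+ 2 * M * M')) * N%:R ^+ 2.
Proof.
rewrite /kplane /kplane' -!lock.
pose Q (b b' : 'I_B) := [exists t, exists s, hit p (F s t) b && hit p' (F' s t) b'].
have -> : \sum_s \sum_t hits B p (F s t) * hits B p' (F' s t) =
    \sum_(b < B) \sum_(b' < B) \sum_t \sum_s (hit p (F s t) b && hit p' (F' s t) b')%:R.
  under [RHS]eq_bigr do rewrite exchange_big/=.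
  rewrite [RHS]exchange_big/= [LHS]exchange_big/=; apply: eq_bigr => t _.
  under [RHS]eq_bigr do rewrite exchange_big/=.
  rewrite [RHS]exchange_big/=; apply: eq_bigr => s _.
  rewrite /hits mulr_suml; apply: eq_bigr => b _.
  by rewrite mulr_sumr; apply: eq_bigr => b' _; rewrite -natrM mulnb.
pose c := 32 * p * p' / (D * rho ^+ 2).
have c0 : 0 <= c by rewrite divr_ge0 ?mulr_ge0 ?exprn_ge0// ltW.
pose C2 := 2 + 128 * (D * r / (eta * M ^+ 2 * M')).
have C20 : 0 <= C2.
  have : 0 <= D * r / (eta * M ^+ 2 * M').
    by apply: divr_ge0; rewrite !mulr_ge0 ?exprn_ge0 ?ltW.
  by rewrite /C2; lra.
apply: (@le_trans _ _ (\sum_(b < B) \sum_(b' < B) c * (Q b b')%:R)).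
  apply: ler_sum => b _; apply: ler_sum => b' _.
  case: (boolP (Q b b')) => [_|nQ]; first by rewrite mulr1; exact: joint_cell.
  rewrite mulr0 big1// => t _; rewrite big1// => s _.
  case h: (_ && _) => //; case/negP: nQ; apply/existsP; exists t.
  by apply/existsP; exists s.
under eq_bigr do rewrite -mulr_sumr.
rewrite -mulr_sumr.
have H : \sum_(b < B) \sum_(b' < B) (Q b b')%:R <= (3 * M * r / eta) * C2.
  apply: sum_pair_le => //.
    apply: le_trans (@active_count B ('I_N * 'I_N)%type (fun st => F st.1 st.2)
        p eta M r eta0 eta1 M0 Mr prM peta _ _) => //.
    - apply: ler_sum => b _; rewrite ler_nat.
      case: (boolP [exists b', Q b b']) => // /existsP[b' /existsP[t /existsP[s /andP[h _]]]].
      by rewrite (_ : [exists s, _])//; apply/existsP; exists (s, t).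
    - move=> [s t] [s1 t1]/=; rewrite FE; case/andP: be_le => be0 be1.
      have := ler_pM; have := ord_norm s s1; have := ord_norm t t1.
      rewrite !ler_norml => /andP[_ a] /andP[_ a'] _.
      have := ler_wpM2l (ltW al0) a'; have := ler_wpM2l be0 a.
      have := ler_wpM2r (ltW r0) al_le; have := ler_wpM2r (ltW r0) be1; lra.
  (* Range of [F'] over the slab of [b]: the widths contribute [512 p + 2 p'], at most 1 because [p]
     and [p'] are at most [1000^-1]; the rest comes from the minor. *)
  move=> b; pose L := 1 + 256 * (D * r / M ^+ 2).
  have L0 : 0 <= L.
    have : 0 <= D * r / M ^+ 2 by apply: divr_ge0; rewrite ?mulr_ge0 ?exprn_ge0 ?ltW.
    by rewrite /L; lra.
  apply: (@le_trans _ _ (L / (2 * (eta * M')) + 1)).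
    apply: count_squares => //.
      move=> b' /existsP[t /existsP[s /andP[_ h]]].
      by apply: hit_lb h; rewrite // ltW.
    move=> b1 b2 /existsP[t1 /existsP[s1 /andP[/hitP[h1 h2] /hitP[h3 h4]]]].
    move=> /existsP[t2 /existsP[s2 /andP[/hitP[h5 h6] /hitP[h7 h8]]]].
    have e1 := FE s2 t2 s1 t1; have e2 := F'E s2 t2 s1 t1.
    suff : F' s2 t2 - F' s1 t1 <= 512 * p + 256 * (D * r / M ^+ 2).
      by rewrite /L; move: psmall psmall'; lra.
    (* The first coordinate is eliminated: [F] changes by at most [2 p] within the slab, and what
       remains depends on [t] through the minor alone. *)
    have e : al * (F' s2 t2 - F' s1 t1) = al' * (F s2 t2 - F s1 t1) +
        (al * be' - be * al') * (rho * (t2%:R - t1%:R)).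
      by rewrite e1 e2; ring.
    rewrite -(ler_pM2l al0) e [leRHS]mulrDr.
    apply: lerD.
      apply: (@le_trans _ _ (al' * (2 * p))); first by rewrite ler_pM2l//; lra.
      have MM : M' ^+ 2 <= M ^+ 2 by rewrite lerXn2r ?nnegrE// ltW.
      have a : al' <= 256 * al by move: al'_le al_ge; lra.
      by have := ler_wpM2r (ltW p0) a; lra.
    apply: (le_trans (ler_norm _)); rewrite normrM -DE.
    apply: (@le_trans _ _ (D * r)); first by rewrite ler_pM2l// ord_norm.
    rewrite !mulrA ler_pdivlMr ?exprn_gt0//.
    have Dr : 0 <= D * r by rewrite mulr_ge0 ?ltW.
    have := ler_wpM2l Dr al_ge; lra.
  have -> : L / (2 * (eta * M')) = (2 * eta * M')^-1 + 128 * (D * r / (eta * M ^+ 2 * M')).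
    by rewrite /L; field; rewrite !lt0r_neq0.
  have : (2 * eta * M')^-1 <= 1 by rewrite invf_le1// (lt_le_trans ltr01).
  by rewrite /C2; lra.
apply: (le_trans (ler_wpM2l c0 H)).
rewrite le_eqVlt; apply/orP; left; apply/eqP; rewrite /c /C2 rhoE; field.
by rewrite !lt0r_neq0.
Qed.

End plane.

Section line.
Variables F F' : 'I_N -> R.
Hypothesis FE : forall s s1, F s - F s1 = al * (rho * (s%:R - s1%:R)).
Hypothesis F'E : forall s s1, F' s - F' s1 = al' * (rho * (s%:R - s1%:R)).
Hypothesis F_ge : forall s, 2 * (eta * M) ^+ 2 <= F s.
Hypothesis F'_ge : forall s, 2 * (eta * M') ^+ 2 <= F' s.
Hypothesis M'p : M' ^+ 2 <= M * p'.

(** Up to constants, a slab of the second family has length [p' / M' ^ 2] along the line, while the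
    slabs of the first are [1 / M] apart. By [M'p] the former dominates, so rounding up the number
    of [b] for a given [b'] costs only a constant factor. *)
Lemma joint_line :
  \sum_s hits B p (F s) * hits B p' (F' s) <=
  p * p' * (kline R / (eta ^+ 2 * M * M')) * N%:R.
Proof.
rewrite /kline -lock.
pose Q (b' b : 'I_B) := [exists s, hit p (F s) b && hit p' (F' s) b'].
have -> : \sum_s hits B p (F s) * hits B p' (F' s) =
    \sum_(b' < B) \sum_(b < B) \sum_s (hit p (F s) b && hit p' (F' s) b')%:R.
  under [RHS]eq_bigr do rewrite exchange_big/=.
  rewrite [RHS]exchange_big/=; apply: eq_bigr => s _.
  rewrite /hits mulr_sumr; apply: eq_bigr => b _.
  by rewrite mulr_suml; apply: eq_bigr => b' _; rewrite -natrM mulnb.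
pose c := 4 * p / (al * rho).
have c0 : 0 <= c by rewrite divr_ge0 ?mulr_ge0// ltW.
pose z := p' * M / (eta * M' ^+ 2).
have z0 : 0 <= z by apply: divr_ge0; rewrite ?mulr_ge0 ?exprn_ge0 ?ltW.
(* [256 z] from the slab of [b'], one unit for the width [p] and one for counting; [M'p] gives
   [1 <= z], which absorbs both units. *)
pose C2 := 258 * z.
have C20 : 0 <= C2 by rewrite /C2; lra.
apply: (@le_trans _ _ (\sum_(b' < B) \sum_(b < B) c * (Q b' b)%:R)).
  apply: ler_sum => b' _; apply: ler_sum => b _.
  case: (boolP (Q b' b)) => [_|nQ]; last first.
    rewrite mulr0 big1// => s _.
    by case h: (_ && _) => //; case/negP: nQ; apply/existsP; exists s.
  rewrite mulr1; apply: (@le_trans _ _ (2 * p / (al * rho) + 1)).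
    apply: sum_card_diam; first by rewrite divr_ge0 ?mulr_ge0// ltW.
    move=> s1 s2 /andP[/hitP[h1 h2] _] /andP[/hitP[h3 h4] _] _.
    have e := FE s2 s1.
    by rewrite ler_pdivlMr ?mulr_gt0//; lra.
  have -> : c = 2 * p / (al * rho) + 2 * p / (al * rho) by rewrite /c; ring.
  by rewrite lerD2l ler_pdivlMr ?mulr_gt0// mul1r.
under eq_bigr do rewrite -mulr_sumr.
rewrite -mulr_sumr.
have H : \sum_(b' < B) \sum_(b < B) (Q b' b)%:R <= (3 * M' * r / eta) * C2.
  apply: sum_pair_le => //.
    apply: le_trans (@active_count B 'I_N F' p' eta M' r eta0 eta1 M'0 M'r prM' peta' _ _) => //.
    - apply: ler_sum => b' _; rewrite ler_nat.
      case: (boolP [exists b, Q b' b]) => // /existsP[b /existsP[s /andP[_ h]]].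
      by rewrite (_ : [exists s, _])//; apply/existsP; exists s.
    - move=> s s1; rewrite F'E.
      have a := ord_diff s s1.
      have := ler_wpM2l (ltW al'0) a.
      have := ler_wpM2r (ltW r0) al'_le.
      have : 0 <= M' ^+ 2 * r by rewrite mulr_ge0 ?exprn_ge0// ltW.
      lra.
  move=> b'; pose L := 2 * p + 512 * (p' * M ^+ 2 / M' ^+ 2).
  have pM0 : 0 <= p' * M ^+ 2 / M' ^+ 2.
    by apply: divr_ge0; rewrite ?mulr_ge0 ?exprn_ge0 ?ltW.
  have L0 : 0 <= L by have := p0; rewrite /L; lra.
  apply: (@le_trans _ _ (L / (2 * (eta * M)) + 1)).
    apply: count_squares => //.
      move=> b /existsP[s /andP[h _]].
      by apply: hit_lb h; rewrite // ltW.
    move=> b1 b2 /existsP[s1 /andP[/hitP[h1 h2] /hitP[h3 h4]]].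
    move=> /existsP[s2 /andP[/hitP[h5 h6] /hitP[h7 h8]]].
    have e1 := FE s2 s1; have e2 := F'E s2 s1.
    suff : F s2 - F s1 <= 512 * (p' * M ^+ 2 / M' ^+ 2) by rewrite /L; lra.
    rewrite e1; set d := rho * _ in e1 e2 *.
    have d1 : al' * d <= 2 * p' by lra.
    clearbody d => {e1 e2}.
    case: (leP d 0) => d0; first by have := mulr_ge0_le0 (ltW al0) d0; lra.
    rewrite !mulrA ler_pdivlMr ?exprn_gt0//.
    have := ler_wpM2l (ltW (mulr_gt0 al0 d0)) al'_ge.
    have := ler_wpM2l (ltW al0) d1.
    have := ler_wpM2r (ltW p'0) al_le.
    lra.
  have M2 : 0 < M' ^+ 2 by rewrite exprn_gt0.
  have eM : 1 <= 2 * (eta * M).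
    by apply: (le_trans eM'); rewrite -mulrA ler_pM2l// ler_pM2l.
  have -> : L / (2 * (eta * M)) = p / (eta * M) + 256 * z.
    by rewrite /L /z; field; rewrite !lt0r_neq0.
  have : 1 <= z.
    rewrite ler_pdivlMr ?mul1r; last exact: mulr_gt0.
    apply: (@le_trans _ _ (M' ^+ 2)); first by rewrite ler_piMl// ltW.
    by rewrite mulrC.
  have : p / (eta * M) <= 1.
    by rewrite ler_pdivrMr// mul1r; move: psmall; lra.
  by rewrite /C2; lra.
apply: (le_trans (ler_wpM2l c0 H)).
(* [3096 = 4 * 3 * 258], and [256 * 3096 <= 800 * 1000]. *)
pose X := p * p' / (eta ^+ 2 * M * M') * N%:R.
have -> : c * (3 * M' * r / eta * C2) = (al^-1 * M ^+ 2) * (3096 * X).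
  by rewrite /c /C2 /z /X rhoE; field; rewrite !lt0r_neq0.
have -> : p * p' * (800 * 1000 / (eta ^+ 2 * M * M')) * N%:R = 800 * 1000 * X.
  by rewrite /X; ring.
have X0 : 0 <= X.
  by rewrite /X mulr_ge0// divr_ge0 ?mulr_ge0 ?exprn_ge0 ?ltW.
have a256 : al^-1 * M ^+ 2 <= 256 by rewrite ler_pdivrMl// mulrC.
by have := ler_wpM2r X0 a256; lra.
Qed.

End line.
End joint.

Lemma sum_sub_ge (G : nat -> R) (C : R) (a j B : nat) : (forall b, 0 <= G b) ->
  (a + j <= B)%N -> (forall b, (a <= b < a + j)%N -> C <= G b) ->
  C * j%:R <= \sum_(b < B) G b.
Proof.
move=> G0 ajB H.
rewrite -(big_mkord xpredT G) (@big_cat_nat _ _ _ a)//=; last first.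
  by apply: leq_trans ajB; exact: leq_addr.
rewrite (@big_cat_nat _ _ _ (a + j) a)//= ?leq_addr// addrCA.
rewrite ler_wpDr ?addr_ge0 ?sumr_ge0//.
rewrite mulr_natr -[X in _ *+ X](addKn a) -sumr_const_nat !big_nat.
exact: ler_sum.
Qed.

Lemma half_truncn (x : R) : 1 <= x -> x / 2 <= (Num.truncn x)%:R.
Proof.
move=> x1; have x0 : 0 <= x by lra.
have := truncn_itv x0; have : (1 <= Num.truncn x)%N by rewrite truncn_gt0.
rewrite -(ler_nat R) -[(_.+1)%:R]natr1 => a /andP[_]; lra.
Qed.

(** Only squares just above [T0] are used. The form runs over an interval of length at least
    [M ^ 2 * r / 256], where consecutive squares are of order at most [n * M] apart, and each square
    is hit by at least half of [p / (al * rho)] grid points. *)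
Lemma hits_line_ge (N B n : nat) (p M r al T0 : R) :
  (0 < N)%N -> (0 < n)%N -> 0 < p -> 0 < r -> r <= 1 -> 0 < M ->
  al <= M ^+ 2 -> M ^+ 2 <= 256 * al -> 0 <= T0 ->
  T0 + al * r <= n%:R * M ^+ 2 -> n%:R * M < B%:R ->
  al * (r / N%:R) <= p -> p <= M ^+ 2 * r / (32 * 32) -> 32 * 64 * n%:R <= M * r ->
  p / (klow R * n%:R * M) * N%:R <=
    \sum_(s < N) hits B p (T0 + al * (r / N%:R) * s%:R).
Proof.
rewrite /klow -lock.
move=> N0 n0 p0 r0 r1 M0 alM Mal T00 T1 nMB Np pM Mr.
have NR0 : 0 < N%:R :> R by rewrite ltr0n.
have nR1 : 1 <= n%:R :> R by rewrite ler1n.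
have M20 : 0 < M ^+ 2 by rewrite exprn_gt0.
have al0 : 0 < al by lra.
set rho := r / N%:R in Np *.
have rho0 : 0 < rho by rewrite divr_gt0.
have rN : r = rho * N%:R by rewrite divfK// lt0r_neq0.
(* For [j <= c], [(q + j) ^ 2 + p] exceeds [T0] by at most [2 n M c + c ^ 2 + p <= 2.5 M ^ 2 r /
   1024], which is below [al * r] because [M ^ 2 <= 256 al]. *)
pose c := M * r / (32 * 64 * n%:R).
have n640 : 0 < 32 * 64 * n%:R :> R by rewrite pmulr_rgt0 ?mulr_gt0//; lra.
have c1 : 1 <= c by rewrite ler_pdivlMr ?mul1r.
pose j := Num.truncn c.
have jc : j%:R <= c by rewrite truncn_le; lra.
have cj : c / 2 <= j%:R by exact: half_truncn.
pose q := Num.truncn (Num.sqrt T0).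
have /andP[qs sq] := truncn_itv (sqrtr_ge0 T0).
have q2 : (q%:R : R) ^+ 2 <= T0.
  by rewrite -(sqr_sqrtr T00) lerXn2r ?nnegrE ?sqrtr_ge0.
have q2' : T0 <= (q%:R + 1) ^+ 2 :> R.
  by rewrite natr1 -(sqr_sqrtr T00) lerXn2r ?nnegrE ?sqrtr_ge0// ltW.
have qnM : q%:R <= n%:R * M :> R.
  rewrite -(@ler_pXn2r _ 2%N)// ?nnegrE ?mulr_ge0//; last lra.
  rewrite exprMn; apply: (le_trans q2).
  have : 0 <= al * r by rewrite mulr_ge0 ?ltW.
  have : n%:R * M ^+ 2 <= n%:R ^+ 2 * M ^+ 2.
    by rewrite ler_pM2r// expr2; nra.
  lra.
have cE : c * (32 * 64 * n%:R) = M * r by rewrite divfK// lt0r_neq0.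
have bup b : (q.+1 <= b < q.+1 + j)%N -> T0 <= b%:R ^+ 2 /\ b%:R ^+ 2 + p <= T0 + al * r :> R.
  move=> /andP[qb bj]; split.
    apply: (le_trans q2'); rewrite natr1 lerXn2r ?nnegrE// ler_nat//.
  have bqj : b%:R <= q%:R + j%:R :> R by rewrite -natrD ler_nat -ltnS -addSn.
  have : b%:R ^+ 2 <= (q%:R + j%:R) ^+ 2 :> R by rewrite lerXn2r ?nnegrE// addr_ge0.
  have : q%:R * j%:R <= n%:R * M * c by rewrite ler_pM.
  have : j%:R ^+ 2 <= c ^+ 2 by rewrite lerXn2r ?nnegrE//; lra.
  have : c ^+ 2 * (32 * 64) <= M ^+ 2 * r.
    have cMr : c * (32 * 64) <= M * r by rewrite -cE; nra.
    have : c <= M.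
      have : M * r <= M by rewrite ler_piMr// ltW.
      lra.
    by move=> cM; nra.
  have : n%:R * M * c * (32 * 64) = M ^+ 2 * r by rewrite expr2 -[RHS]mulrA -cE; ring.
  have : M ^+ 2 * r <= 256 * al * r by rewrite ler_wpM2r// ltW.
  rewrite sqrrD -mulr_natr.
  lra.
have jB : (q.+1 + j <= B)%N.
  case: j => [|j'] in jc cj bup *; first by move: cj; rewrite -[0%:R]/(0 : R); lra.
  rewrite addnS -(ltr_nat R).
  have [|_ h] := bup (q.+1 + j')%N; first by rewrite leq_addr addnS ltnS leqnn.
  apply: le_lt_trans nMB.
  rewrite -(@ler_pXn2r _ 2%N)// ?nnegrE ?mulr_ge0//; last lra.
  rewrite exprMn.
  have : n%:R * M ^+ 2 <= n%:R ^+ 2 * M ^+ 2.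
    by rewrite ler_pM2r// expr2; nra.
  lra.
rewrite /hits exchange_big/=.
pose G b := \sum_(s < N) (hit p (T0 + al * rho * s%:R) b)%:R : R.
have H : p / (al * rho) / 2 * j%:R <= \sum_(b < B) G b.
  apply: (@sum_sub_ge _ _ q.+1) => // [b|b hb]; first exact: sumr_ge0.
  have [b1 b2] := bup _ hb.
  pose L := p / (al * rho).
  have alrho : 0 < al * rho by exact: mulr_gt0.
  have L1 : 1 <= L by rewrite /L ler_pdivlMr ?mul1r.
  pose y := (b%:R ^+ 2 - T0) / (al * rho).
  have y0 : 0 <= y by rewrite divr_ge0 ?subr_ge0// ltW.
  have yL : y + L <= N%:R.
    rewrite -mulrDl ler_pdivrMr//.
    have -> : N%:R * (al * rho) = al * r by rewrite rN; ring.
    lra.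
  have yE : T0 + al * rho * y = b%:R ^+ 2.
    by rewrite /y [al * rho * _]mulrC divfK ?lt0r_neq0//; ring.
  have LE : p = al * rho * L by rewrite /L mulrC divfK// lt0r_neq0.
  pose t0 := Num.truncn y.
  have /andP[ty yt] := truncn_itv y0; rewrite -/t0 -natr1 in ty yt.
  apply: (le_trans (half_truncn L1)).
  rewrite -[leLHS]mul1r.
  have jL : (Num.truncn L)%:R <= L by rewrite truncn_le; lra.
  apply: (@sum_sub_ge (fun s => (hit p (T0 + al * rho * s%:R) b)%:R) 1 t0) => //.
    rewrite -(ler_nat R) natrD; apply: le_trans yL; exact: lerD.
  move=> s /andP[ts sj]; rewrite ler1n lt0b /hit natrX -yE.
  have -> : T0 + al * rho * s%:R - (T0 + al * rho * y) = al * rho * (s%:R - y) by ring.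
  rewrite normrM gtr0_norm// [ltRHS]LE ltr_pM2l//.
  have : t0%:R <= s%:R :> R by rewrite ler_nat.
  have : s%:R + 1 <= t0%:R + (Num.truncn L)%:R :> R by rewrite natr1 -natrD ler_nat.
  by rewrite ltr_norml; lra.
apply: le_trans H.
apply: (@le_trans _ _ (p / (al * rho) / 2 * (c / 2))); last first.
  by rewrite ler_wpM2l// !mulr_ge0 ?invr_ge0 ?mulr_ge0// ltW.
have -> : p / (al * rho) / 2 * (c / 2) = (al^-1 * M ^+ 2) * (p / (64 * 128 * n%:R * M) * N%:R).
  by rewrite /c /rho; field; rewrite !lt0r_neq0//; lra.
rewrite ler_peMl//.
  by rewrite mulr_ge0// divr_ge0 ?mulr_ge0// ltW.
by rewrite ler_pdivlMl// mulr1.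
Qed.

End squares.

(** * Dyadic blocks of coefficient vectors *)

Section blocks.
Variables (m Q : nat).
Local Notation idx := (('I_Q.+1 * 'I_Q.+1) * {ffun 'I_m -> 'I_Q.+1})%type.

(* [((u, v), w) : idx] encodes the vector [(u, v, w_0, w_1, ...)]. *)
Definition vec (a : idx) : 'I_m.+2 -> nat := fun i =>
  if unlift ord0 i is Some j then
    if unlift ord0 j is Some w then a.2 w else a.1.2
  else a.1.1.

Lemma vec0 a : vec a ord0 = a.1.1.
Proof. by rewrite /vec unlift_none. Qed.

Lemma vec1 a : vec a (lift ord0 ord0) = a.1.2.
Proof. by rewrite /vec liftK unlift_none. Qed.

Lemma vecS a w : vec a (lift ord0 (lift ord0 w)) = a.2 w.
Proof. by rewrite /vec !liftK. Qed.

(** These ranges are disjoint for distinct powers [M] of 16, and the squares of their elements agree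
    with [M ^ 2] up to a factor 256. *)
Definition inblk (M c : nat) : bool := (M < 16 * c)%N && (c <= M)%N.

Definition blk (M : nat) (a : idx) : bool :=
  [&& coprime a.1.1 a.1.2, inblk M a.1.1, inblk M a.1.2 &
      [forall i, inblk M (a.2 i)]].

Lemma blk_vec M a i : blk M a -> inblk M (vec a i).
Proof.
case/and4P => _ h1 h2 /forallP h3; rewrite /vec.
by case: unliftP => // j _; case: unliftP.
Qed.

Lemma sum_ord_nat (V : nmodType) (F : nat -> V) M : (M <= Q)%N ->
  \sum_(c < Q.+1 | (0 < c <= M)%N) F c = \sum_(1 <= c < M.+1) F c.
Proof.
move=> MQ; rewrite (@big_nat_widen _ _ _ 1 M.+1 Q.+1 xpredT)//.
by rewrite big_geq_mkord; apply: eq_bigl => c; rewrite /= andbC ltnS.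
Qed.

Lemma card_ord_le (P : pred nat) M : (M <= Q)%N ->
  (forall c, P c -> 0 < c <= M)%N ->
  #|[pred c : 'I_Q.+1 | P c]| = (\sum_(1 <= c < M.+1) P c)%N.
Proof.
move=> MQ PM; rewrite -(sum_ord_nat (fun c => P c : nat) MQ) -sum1_card.
rewrite [LHS]big_mkcond [RHS]big_mkcond; apply: eq_bigr => c _ /=.
by rewrite inE; case: ifP => [/PM -> //|]; case: ifP.
Qed.

Lemma inblk_le M c : inblk M c -> (0 < c <= M)%N.
Proof. by rewrite /inblk; lia. Qed.

Lemma card_inblk_ge M : (M <= Q)%N ->
  (M <= 2 * #|[pred c : 'I_Q.+1 | inblk M c]|)%N.
Proof.
move=> MQ; rewrite (card_ord_le MQ (@inblk_le M)).
have : (\sum_(1 <= c < M.+1) 1 =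
    \sum_(1 <= c < M.+1) inblk M c + \sum_(1 <= c < M.+1) (c <= M %/ 16))%N.
  rewrite -big_split !big_nat; apply: eq_bigr => c /andP[c0 cM].
  by rewrite /= /inblk leq_divRL//; lia.
rewrite count_le_nat ?leq_div// sum_nat_const_nat subn1/= muln1.
by have := leq_divM M 16; lia.
Qed.

Lemma card_inblk_le M : (M <= Q)%N -> (#|[pred c : 'I_Q.+1 | inblk M c]| <= M)%N.
Proof.
move=> MQ; rewrite (card_ord_le MQ (@inblk_le M)).
apply: (@leq_trans (\sum_(1 <= c < M.+1) 1)%N).
  by apply: leq_sum => c _; case: inblk.
by rewrite sum_nat_const_nat subn1 muln1.
Qed.

Lemma card_tail M :
  #|[pred w : {ffun 'I_m -> 'I_Q.+1} | [forall i, inblk M (w i)]]| =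
  (#|[pred c : 'I_Q.+1 | inblk M c]| ^ m)%N.
Proof.
rewrite -[in RHS](card_ord m) -card_ffun_on; apply: eq_card => w.
rewrite [LHS]inE; apply/forallP/ffun_onP => h i; first by rewrite inE; exact: h.
by have := h i; rewrite inE.
Qed.

Lemma sum_blk (V : nmodType) M (F : idx -> V) :
  \sum_(a | blk M a) F a =
  \sum_(u < Q.+1) \sum_(v < Q.+1 | [&& coprime u v, inblk M u & inblk M v])
    \sum_(w : {ffun 'I_m -> 'I_Q.+1} | [forall i, inblk M (w i)]) F (u, v, w).
Proof.
rewrite pair_big_dep/= pair_big_dep/=.
by apply: eq_big => [[[u v] w]|[[u v] w] _]//=; rewrite /blk/= !andbA.
Qed.

(** At least [M ^ 2 / 8] coprime pairs, and at least [M / 2] choices for each of the other [m]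
    entries. *)
Lemma card_blk_ge M : (M <= Q)%N -> (M ^ m.+2 <= 8 * 2 ^ m * #|blk M|)%N.
Proof.
move=> MQ.
have -> : #|blk M| = ((\sum_(1 <= u < M.+1) \sum_(1 <= v < M.+1)
     [&& coprime u v, M < 16 * u & M < 16 * v]) *
   #|[pred c : 'I_Q.+1 | inblk M c]| ^ m)%N.
  rewrite -sum1_card.
  have -> : (\sum_(a in blk M) 1 = \sum_(a | blk M a) 1)%N by apply: eq_bigl.
  rewrite (@sum_blk nat).
  rewrite -card_tail -(sum_ord_nat _ MQ) big_distrl/= [RHS]big_mkcond/=.
  apply: eq_bigr => u _; rewrite -(sum_ord_nat _ MQ).
  under eq_bigr do rewrite sum1_card.
  rewrite sum_nat_const; case: ifP => uM; last first.
    rewrite (_ : #|_| = 0%N)//; apply: eq_card0 => v; rewrite inE.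
    by apply/negP => /and3P[_ /inblk_le]; rewrite uM.
  congr (_ * _)%N; rewrite -sum1_card [LHS]big_mkcond [RHS]big_mkcond/=.
  apply: eq_bigr => v _; rewrite unfold_in /inblk.
  case: (coprime u v) => /=; last by case: ifP.
  by do 2?[case: ifP]; move: uM; lia.
have h1 := coprime_pairs M; have h2 := card_inblk_ge MQ.
rewrite -addn2 addnC expnD mulnACA leq_mul// -expnMn.
by case: (posnP m) => [->//|m0]; rewrite leq_exp2r.
Qed.

Lemma sum_blk_le (R : realType) M (G : 'I_Q.+1 -> 'I_Q.+1 -> R) : (M <= Q)%N ->
  (forall u v, 0 <= G u v) ->
  \sum_(a | blk M a) G a.1.1 a.1.2 <=
  M%:R ^+ m * \sum_(u < Q.+1 | inblk M u) \sum_(v < Q.+1 | inblk M v) G u v.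
Proof.
move=> MQ G0; rewrite sum_blk mulr_sumr [leRHS]big_mkcond; apply: ler_sum => u _.
case: ifP => uM; last first.
  by rewrite big_pred0// => v /=; rewrite andbF.
rewrite mulr_sumr [leLHS]big_mkcond [leRHS]big_mkcond; apply: ler_sum => v _.
rewrite /=; case: ifP => [/andP[_ ->]|_]; last first.
  by case: ifP => // _; rewrite mulr_ge0.
rewrite sumr_const -[leLHS]mulr_natl; apply: ler_wpM2r => //.
have -> : #|[pred w : {ffun 'I_m -> 'I_Q.+1} | [forall i, inblk M (w i)]]| =
  (#|[pred c : 'I_Q.+1 | inblk M c]| ^ m)%N by exact: card_tail.
by rewrite natrX lerXn2r ?nnegrE// ler_nat card_inblk_le.
Qed.

Lemma sum_inblk_le (R : realType) M (C : R) : (M <= Q)%N -> 0 <= C ->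
  \sum_(u < Q.+1 | inblk M u) C <= M%:R * C.
Proof.
move=> MQ C0; rewrite sumr_const -[leLHS]mulr_natl ler_wpM2r// ler_nat.
exact: card_inblk_le.
Qed.

Lemma sum_blk_const_le (R : realType) M (C : R) : (M <= Q)%N -> 0 <= C ->
  \sum_(a | blk M a) C <= M%:R ^+ m.+2 * C.
Proof.
move=> MQ C0; apply: (le_trans (@sum_blk_le R M (fun _ _ => C) MQ _)) => //.
rewrite !exprSr -!mulrA ler_wpM2l ?exprn_ge0//.
apply: (@le_trans _ _ (\sum_(u < Q.+1 | inblk M u) M%:R * C)).
  by apply: ler_sum => u _; exact: sum_inblk_le.
by apply: sum_inblk_le => //; rewrite mulr_ge0.
Qed.

Lemma same_slope_sum_le (R : realType) M (C : R) : (M <= Q)%N -> 0 <= C ->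
  \sum_(a | blk M a) \sum_(a' | blk M a' && (a'.1 == a.1)) C
  <= #|blk M|%:R * (M%:R ^+ m * C).
Proof.
move=> MQ C0; rewrite mulr_natl -sumr_const; apply: ler_sum => -[[u0 v0] w0] _.
rewrite big_mkcondr/=.
apply: (le_trans (@sum_blk_le R M (fun u v => if (u, v) == (u0, v0) then C else 0) MQ _)).
  by move=> u v; case: ifP.
rewrite ler_wpM2l ?exprn_ge0//.
apply: (@le_trans _ _ (\sum_(u < Q.+1) \sum_(v < Q.+1)
    if (u, v) == (u0, v0) then C else 0)).
  rewrite big_mkcond; apply: ler_sum => u _; case: ifP => _; last first.
    by apply: sumr_ge0 => v _; case: ifP.
  by rewrite big_mkcond; apply: ler_sum => v _; case: ifP => _ //; case: ifP.
rewrite pair_big/= -big_mkcond/=.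
by rewrite (eq_bigl (pred1 (u0, v0))) ?big_pred1_eq// => -[].
Qed.

(** For fixed [a'] the pair [(u, v)] is summed by [sum_inv_cross_le], and the tail of [a]
    contributes [M ^ m]. Since [M' < 16 u'], the residue count [M / u' + 1] is at most [17 M / M'],
    whence [34 = 2 * 17]. *)
Lemma cross_sum_le (R : realType) (M M' K : nat) :
  (0 < M')%N -> (M' <= M)%N -> (M <= Q)%N -> (M * M' <= 2 ^ K)%N ->
  \sum_(a | blk M a) \sum_(a' | blk M' a' && (a.1.1 * a'.1.2 != a.1.2 * a'.1.1)%N)
    (`| (a.1.1 * a'.1.2)%:R - (a.1.2 * a'.1.1)%:R | : R)^-1
  <= 34 * (K%:R + 1) * (M%:R * M'%:R) ^+ m.+1.
Proof.
move=> M'0 M'M MQ MK.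
have M'Q : (M' <= Q)%N by exact: leq_trans MQ.
have M'R : 0 < M'%:R :> R by rewrite ltr0n.
pose f (u v u' v' : nat) : R := (`| (u * v')%:R - (v * u')%:R |)^-1.
have f0 u v u' v' : 0 <= f u v u' v' by rewrite invr_ge0.
have inner (a' : idx) : blk M' a' ->
    \sum_(a | blk M a && (a.1.1 * a'.1.2 != a.1.2 * a'.1.1)%N)
       f a.1.1 a.1.2 a'.1.1 a'.1.2 <= 34 * (K%:R + 1) * M%:R ^+ m.+1 / M'%:R.
  case/and4P => cop /andP[u1 u2] /andP[v1 v2] _.
  rewrite big_mkcondr/=.
  apply: (le_trans (@sum_blk_le R M (fun u v => if (u * a'.1.2 != v * a'.1.1)%N
    then f u v a'.1.1 a'.1.2 else 0) MQ _)); first by move=> u v; case: ifP.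
  have u'0 : (0 < a'.1.1)%N by lia.
  have Mu : (M * a'.1.1 <= 2 ^ K)%N by apply: leq_trans MK; rewrite leq_mul2l u2 orbT.
  have Mv : (M * a'.1.2 <= 2 ^ K)%N by apply: leq_trans MK; rewrite leq_mul2l v2 orbT.
  have := @sum_inv_cross_le R M Q K _ _ u'0 cop Mu Mv.
  set S := \sum_(u | _) _ => HS.
  apply: (@le_trans _ _ (M%:R ^+ m * S)).
    rewrite ler_wpM2l ?exprn_ge0// /S [leLHS]big_mkcond [leRHS]big_mkcond.
    apply: ler_sum => u _.
    have [uM|/negP uM] := boolP (inblk M u); last first.
      by case: ifP => // _; apply: sumr_ge0 => v _.
    have -> : (u <= M)%N by case/andP: uM.
    rewrite [leRHS]big_mkcondr/= [leLHS]big_mkcond [leRHS]big_mkcond/=.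
    apply: ler_sum => v _.
    have [vM|/negP vM] := boolP (inblk M v); last by case: ifP => //; case: ifP.
    by have -> : (v <= M)%N by case/andP: vM.
  rewrite exprS ler_pdivlMr//.
  have : (M %/ a'.1.1).+1%:R * M'%:R <= 17 * M%:R :> R.
    rewrite -natrM -natrM ler_nat.
    have := leq_divM M a'.1.1; move: (M %/ a'.1.1)%N => q; nia.
  have := ler_wpM2r (ltW M'R) HS.
  have : 0 <= M%:R ^+ m :> R by rewrite exprn_ge0.
  have : 0 <= K%:R + 1 :> R by rewrite addr_ge0.
  move: (M%:R ^+ m : R) ((M %/ a'.1.1).+1%:R : R) (K%:R + 1 : R) => X Y Z Z0 X0 h1 h2.
  have h3 := ler_wpM2l Z0 h2.
  have h4 : S * M'%:R <= 34 * Z * M%:R by lra.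
  by have := ler_wpM2l X0 h4; lra.
rewrite (exchange_big_dep (blk M'))/=; last by move=> a a' _ /andP[].
apply: (@le_trans _ _ (\sum_(a' | blk M' a') 34 * (K%:R + 1) * M%:R ^+ m.+1 / M'%:R)).
  apply: ler_sum => a' a'M; apply: le_trans (inner _ a'M).
  by rewrite le_eqVlt; apply/orP; left; apply/eqP; apply: eq_bigl => a; rewrite a'M.
have C0 : 0 <= 34 * (K%:R + 1) * M%:R ^+ m.+1 / M'%:R :> R.
  by rewrite divr_ge0// mulr_ge0 ?exprn_ge0// mulr_ge0// addr_ge0.
apply: (le_trans (sum_blk_const_le M'Q C0)).
rewrite le_eqVlt; apply/orP; left; apply/eqP.
rewrite exprMn (exprS M'%:R m.+1); field.
by rewrite lt0r_neq0.
Qed.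

End blocks.

(** * Pairs of slab families on a grid *)

Definition sdot (R : realType) (n : nat) (a : 'I_n -> nat) (x : 'I_n -> R) : R :=
  \sum_(i < n) ((a i) ^ 2)%:R * x i.

Definition gpt (R : realType) (n N : nat) (l : 'I_n -> R) (r : R)
  (g : {ffun 'I_n -> 'I_N}) : 'I_n -> R :=
  fun i => l i + r / N%:R * (g i)%:R.

Lemma sdot_upd (R : realType) n N (l : 'I_n -> R) r (a : 'I_n -> nat)
    (g : {ffun 'I_n -> 'I_N}) i s :
  sdot a (gpt l r (upd g i s)) =
  ((a i) ^ 2)%:R * l i + \sum_(k | k != i) ((a k) ^ 2)%:R * gpt l r g k +
  ((a i) ^ 2)%:R * (r / N%:R * s%:R).
Proof.
rewrite /sdot (bigD1 i)//= /gpt updE mulrDr addrAC; congr (_ + _ + _).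
by apply: eq_bigr => k ki; rewrite updN.
Qed.

Lemma sdot_upd2 (R : realType) n N (l : 'I_n -> R) r (a : 'I_n -> nat)
    (g : {ffun 'I_n -> 'I_N}) i j : i != j ->
  exists C, forall s t, sdot a (gpt l r (upd (upd g i s) j t)) =
    C + ((a i) ^ 2)%:R * (r / N%:R * s%:R) + ((a j) ^ 2)%:R * (r / N%:R * t%:R).
Proof.
move=> ij; exists (((a j) ^ 2)%:R * l j + (((a i) ^ 2)%:R * l i +
   \sum_(k | (k != j) && (k != i)) ((a k) ^ 2)%:R * gpt l r g k)) => s t.
rewrite sdot_upd; congr (_ + _); rewrite -addrA; congr (_ + _).
rewrite (bigD1 i)//= /gpt updE mulrDr addrAC; congr (_ + _ + _).
by apply: eq_bigr => k /andP[kj ki]; rewrite updN.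
Qed.

Section pairs.
Variables (R : realType) (m N B : nat) (l : 'I_m.+2 -> R) (r delta eta : R).
Hypotheses (N0 : (0 < N)%N) (r0 : 0 < r) (delta0 : 0 < delta).
Hypotheses (ld : forall i, delta <= l i) (lr : forall i, l i + r <= 1).
Hypotheses (eta0 : 0 < eta) (eta1 : eta <= 1) (etad : 2 * 256 * eta ^+ 2 <= delta).
Implicit Types (a : 'I_m.+2 -> nat) (M : nat) (p : R).

Let ksmallE : ksmall R = 1000^-1. Proof. by rewrite /ksmall -lock. Qed.

Let r1 : r <= 1.
Proof. by have := ld ord0; have := lr ord0; have := delta0; lra. Qed.

Lemma gpt_bounds (g : {ffun 'I_m.+2 -> 'I_N}) i : l i <= gpt l r g i <= 1.
Proof.
have h : r / N%:R * (g i)%:R <= r.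
  rewrite mulrAC ler_pdivrMr ?ltr0n// ler_pM2l// ler_nat.
  exact: ltnW.
rewrite /gpt lerDl mulr_ge0 ?divr_ge0//=; last exact: ltW.
by have := lr i; lra.
Qed.

Lemma inblk_sqr M c : inblk M c ->
  (c ^ 2)%:R <= M%:R ^+ 2 :> R /\ M%:R ^+ 2 <= 256 * (c ^ 2)%:R :> R.
Proof.
move=> /andP[h1 h2]; rewrite natrX; split.
  by rewrite lerXn2r ?nnegrE// ler_nat.
have -> : 256 * c%:R ^+ 2 = (16 * c%:R) ^+ 2 :> R by ring.
by rewrite lerXn2r ?nnegrE// -natrM ler_nat ltnW.
Qed.

Lemma sdot_ge a M (x : 'I_m.+2 -> R) : (forall i, inblk M (a i)) ->
  (forall i, delta <= x i) -> 2 * (eta * M%:R) ^+ 2 <= sdot a x.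
Proof.
move=> aM dx; have [_ h] := inblk_sqr (aM ord0).
rewrite /sdot (bigD1 ord0)//=; apply: ler_wpDr.
  by apply: sumr_ge0 => i _; rewrite mulr_ge0// (le_trans _ (dx i))// ltW.
have := dx ord0.
have := ler_wpM2r (ltW delta0) h.
have := ler_wpM2r (sqr_ge0 (M%:R : R)) etad.
move: ((a ord0 ^ 2)%:R : R) (ler0n R (a ord0 ^ 2)) => A A0 h1 h2 h3.
have := ler_wpM2l A0 h3; rewrite exprMn; lra.
Qed.

Lemma sdot_le a M (x : 'I_m.+2 -> R) : (forall i, inblk M (a i)) ->
  (forall i, x i <= 1) -> sdot a x <= m.+2%:R * M%:R ^+ 2.
Proof.
move=> aM x1; rewrite mulr_natl -[X in _ *+ X]card_ord -sumr_const.
apply: ler_sum => i _; have [h _] := inblk_sqr (aM i).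
by apply: le_trans h; rewrite ler_piMr.
Qed.

(** [M ^ 4] bounds the squared entries and also the minors for blocks up to [M]; the last condition
    keeps these times the mesh [r / N] below [p]. *)
Definition level_ok M p : Prop :=
  [/\ 0 < p, p <= ksmall R, 1 <= M%:R * r, 1 <= 2 * eta * M%:R
    & M%:R ^+ 4 <= N%:R * p].

Let level_M1 M p : level_ok M p -> 1 <= M%:R :> R.
Proof. by case=> _ _ h _ _; apply: (le_trans h); rewrite ler_piMr. Qed.

Let level_eta M p : level_ok M p -> p <= (eta * M%:R) ^+ 2.
Proof.
rewrite /level_ok ksmallE; case=> _ h _ e _; have e2 : 2^-1 <= eta * M%:R by lra.
have : 2^-1 ^+ 2 <= (eta * M%:R) ^+ 2.
  by rewrite lerXn2r ?nnegrE ?invr_ge0// (le_trans _ e2)// invr_ge0.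
rewrite expr2; lra.
Qed.

Let level_N M p c : level_ok M p -> c <= M%:R ^+ 4 -> c * (r / N%:R) <= p.
Proof.
move=> ok cM; have M1 := level_M1 ok; case: ok => p0 _ _ _ h.
have NR0 : 0 < N%:R :> R by rewrite ltr0n.
rewrite mulrA ler_pdivrMr//.
apply: (@le_trans _ _ (M%:R ^+ 4 * r)); first by rewrite ler_pM2r.
apply: (@le_trans _ _ (M%:R ^+ 4)); first by rewrite ler_piMr ?exprn_ge0.
by rewrite mulrC.
Qed.

Let level_N2 M p c : level_ok M p -> c <= M%:R ^+ 4 -> c * (r / N%:R) <= 2 * p.
Proof. by move=> ok /(level_N ok); case: ok; lra. Qed.

Let sqr_le4 M p (c : R) : level_ok M p -> c <= M%:R ^+ 2 -> c <= M%:R ^+ 4.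
Proof.
move=> /level_M1 M1 /le_trans; apply.
by rewrite ler_weXn2l.
Qed.

Lemma pair_plane a a' M M' p p' j : (M' <= M)%N ->
  (forall i, inblk M (a i)) -> (forall i, inblk M' (a' i)) -> j != ord0 ->
  level_ok M p -> level_ok M' p' -> M%:R ^+ 4 <= N%:R * p' ->
  let D := `| ((a ord0) ^ 2)%:R * ((a' j) ^ 2)%:R -
              ((a j) ^ 2)%:R * ((a' ord0) ^ 2)%:R | : R in
  0 < D ->
  \sum_(g : {ffun 'I_m.+2 -> 'I_N})
     hits B p (sdot a (gpt l r g)) * hits B p' (sdot a' (gpt l r g))
  <= p * p' * (kplane R * M%:R / (eta * r * D) + kplane' R / (eta ^+ 2 * M%:R * M'%:R))
     * (N ^ m.+2)%:R.
Proof.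
move=> MM aM aM' j0 ok ok' Np' D D0.
have [a1 a2] := inblk_sqr (aM ord0); have [a3 a4] := inblk_sqr (aM' ord0).
have [b1 b2] := inblk_sqr (aM j); have [b3 b4] := inblk_sqr (aM' j).
have M1 := level_M1 ok; have M1' := level_M1 ok'.
have MMR : M'%:R <= M%:R :> R by rewrite ler_nat.
have M2 : M'%:R ^+ 2 <= M%:R ^+ 2 :> R by rewrite lerXn2r ?nnegrE.
have NR0 : 0 < N%:R :> R by rewrite ltr0n.
have h := @sum_le_fibre2 R 'I_m.+2 'I_N
  (fun g => hits B p (sdot a (gpt l r g)) * hits B p' (sdot a' (gpt l r g))) ord0 j.
rewrite !card_ord in h; apply: h => // g.
have j0' : ord0 != j by rewrite eq_sym.
have [C CE] := sdot_upd2 l r a g j0'.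
have [C' CE'] := sdot_upd2 l r a' g j0'.
have [p0 p1 p2 p3 p4] := ok; have [p0' p1' p2' p3' p4'] := ok'.
rewrite ksmallE in p1 p1'.
apply: (@joint_plane R N B p p' eta M%:R M'%:R r (r / N%:R)
  ((a ord0) ^ 2)%:R ((a j) ^ 2)%:R ((a' ord0) ^ 2)%:R ((a' j) ^ 2)%:R) => //.
- exact: (level_eta ok).
- exact: (level_eta ok').
- exact: (level_N2 ok (sqr_le4 ok a1)).
- exact: (level_N2 ok' (sqr_le4 ok' a3)).
- by apply/andP; split.
- have a'1 : 1 <= ((a' ord0) ^ 2)%:R :> R.
    rewrite ler1n expn_gt0; have /andP[] := aM' ord0.
    by case: (a' ord0) => //; rewrite muln0.
  have D4 : D <= M%:R ^+ 4.
    have x1 : ((a ord0) ^ 2)%:R * ((a' j) ^ 2)%:R <= M%:R ^+ 4 :> R.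
      by rewrite (exprD _ 2 2) ler_pM// (le_trans b3).
    have x2 : ((a j) ^ 2)%:R * ((a' ord0) ^ 2)%:R <= M%:R ^+ 4 :> R.
      by rewrite (exprD _ 2 2) ler_pM// (le_trans a3).
    have x3 : 0 <= ((a ord0) ^ 2)%:R * ((a' j) ^ 2)%:R :> R by rewrite mulr_ge0.
    have x4 : 0 <= ((a j) ^ 2)%:R * ((a' ord0) ^ 2)%:R :> R by rewrite mulr_ge0.
    by rewrite ler_norml; apply/andP; split; lra.
  apply: (le_trans (level_N ok D4)).
  have := ler_wpM2r (ltW p0) a'1.
  have : 0 <= ((a ord0) ^ 2)%:R * p' by rewrite mulr_ge0// ltW.
  by rewrite mul1r; lra.
- by move=> s t s1 t1; rewrite !CE; ring.
- by move=> s t s1 t1; rewrite !CE'; ring.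
- move=> s t; apply: sdot_ge => // i.
  by have /andP[+ _] := gpt_bounds (upd (upd g ord0 s) j t) i; apply: le_trans.
- move=> s t; apply: sdot_ge => // i.
  by have /andP[+ _] := gpt_bounds (upd (upd g ord0 s) j t) i; apply: le_trans.
Qed.

Lemma pair_line a a' M M' p p' : (M' <= M)%N ->
  (forall i, inblk M (a i)) -> (forall i, inblk M' (a' i)) ->
  level_ok M p -> level_ok M' p' -> M'%:R ^+ 2 <= M%:R * p' ->
  \sum_(g : {ffun 'I_m.+2 -> 'I_N})
     hits B p (sdot a (gpt l r g)) * hits B p' (sdot a' (gpt l r g))
  <= p * p' * (kline R / (eta ^+ 2 * M%:R * M'%:R)) * (N ^ m.+2)%:R.
Proof.
move=> MM aM aM' ok ok' M'p.
have [a1 a2] := inblk_sqr (aM ord0); have [a3 a4] := inblk_sqr (aM' ord0).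
have M1 := level_M1 ok; have M1' := level_M1 ok'.
have MMR : M'%:R <= M%:R :> R by rewrite ler_nat.
have h := @sum_le_fibre R 'I_m.+2 'I_N
  (fun g => hits B p (sdot a (gpt l r g)) * hits B p' (sdot a' (gpt l r g))) ord0.
rewrite !card_ord in h; apply: h => // g.
have [p0 p1 p2 p3 p4] := ok; have [p0' p1' p2' p3' p4'] := ok'.
rewrite ksmallE in p1 p1'.
apply: (@joint_line R N B p p' eta M%:R M'%:R r (r / N%:R)
  ((a ord0) ^ 2)%:R ((a' ord0) ^ 2)%:R) => //.
- exact: (level_eta ok).
- exact: (level_eta ok').
- exact: (level_N2 ok (sqr_le4 ok a1)).
- by move=> s s1; rewrite !sdot_upd; ring.
- by move=> s s1; rewrite !sdot_upd; ring.
- move=> s; apply: sdot_ge => // i.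
  by have /andP[+ _] := gpt_bounds (upd g ord0 s) i; apply: le_trans.
- move=> s; apply: sdot_ge => // i.
  by have /andP[+ _] := gpt_bounds (upd g ord0 s) i; apply: le_trans.
Qed.

Lemma single_ge a M p : (forall i, inblk M (a i)) -> level_ok M p ->
  32 * 64 * m.+2%:R <= M%:R * r -> p <= M%:R ^+ 2 * r / (32 * 32) ->
  (m.+2 * M < B)%N ->
  p / (klow R * m.+2%:R * M%:R) * (N ^ m.+2)%:R <=
  \sum_(g : {ffun 'I_m.+2 -> 'I_N}) hits B p (sdot a (gpt l r g)).
Proof.
move=> aM ok Mr pM MB; have [a1 a2] := inblk_sqr (aM ord0).
have M1 := level_M1 ok.
have h := @sum_ge_fibre R 'I_m.+2 'I_N (fun g => hits B p (sdot a (gpt l r g))) ord0.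
rewrite !card_ord in h; apply: h => // g.
have [p0 p1 p2 p3 p4] := ok.
under eq_bigr do rewrite sdot_upd mulrA.
apply: hits_line_ge => //.
- by lra.
- rewrite addr_ge0 ?mulr_ge0//; first by have := ld ord0; have := delta0; lra.
  apply: sumr_ge0 => k _; rewrite mulr_ge0//.
  by have /andP[+ _] := gpt_bounds g k; apply: le_trans; have := ld k; have := delta0; lra.
(* [T0 + al * r] is the value of the form at the right end of the grid line, a point whose
   coordinates are at most 1. *)
- have : sdot a (fun k => if k == ord0 then l ord0 + r else gpt l r g k) <= m.+2%:R * M%:R ^+ 2.
    apply: sdot_le => // i; case: ifP => _; first exact: lr.
    by have /andP[] := gpt_bounds g i.
  apply: le_trans; rewrite /sdot [leRHS](bigD1 ord0)//= mulrDr addrAC lerD2l.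
  by apply: ler_sum => k /negbTE ->.
- by rewrite -natrM ltr_nat.
- exact: (level_N ok (sqr_le4 ok a1)).
Qed.

End pairs.

(** * Sums over pairs of blocks *)

(** Equal fractions in lowest terms have the same numerator and denominator. *)
Lemma coprime_cross_eq (u v u' v' : nat) : (0 < u)%N -> (0 < u')%N ->
  coprime u v -> coprime u' v' -> (u * v' = v * u')%N -> u = u' /\ v = v'.
Proof.
move=> u0 u'0 cuv cuv' e.
have uu' : u = u'.
  apply/eqP; rewrite eqn_dvd; apply/andP; split.
    by rewrite -(Gauss_dvdr _ cuv) -e dvdn_mulr.
  by rewrite -(Gauss_dvdl _ cuv') e dvdn_mull.
split => //; move: e; rewrite -uu' mulnC => /eqP.
by rewrite eqn_pmul2r// => /eqP.
Qed.

Section block_pairs.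
Variables (R : realType) (m N B Q : nat) (l : 'I_m.+2 -> R) (r delta eta : R).
Hypotheses (N0 : (0 < N)%N) (r0 : 0 < r) (delta0 : 0 < delta).
Hypotheses (ld : forall i, delta <= l i) (lr : forall i, l i + r <= 1).
Hypotheses (eta0 : 0 < eta) (eta1 : eta <= 1) (etad : 2 * 256 * eta ^+ 2 <= delta).
Implicit Types (M : nat) (p : R).
Local Notation level_ok := (level_ok N r eta).
Local Notation idx := (('I_Q.+1 * 'I_Q.+1) * {ffun 'I_m -> 'I_Q.+1})%type.

Definition vhits p (a : idx) (g : {ffun 'I_m.+2 -> 'I_N}) : R :=
  hits B p (sdot (vec a) (gpt l r g)).

Definition bhits M p (g : {ffun 'I_m.+2 -> 'I_N}) : R :=
  \sum_(a : idx | blk M a) vhits p a g.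

(** The expected value of [bhits], up to constants: one vector has about [M] slabs of volume
    [p / M ^ 2]. Both moments are measured against it. *)
Definition weight M p : R := p / M%:R * (#|@blk m Q M|)%:R.

Definition cblk : R := (8 * 2 ^ m)%:R.

Definition cpair : R :=
  kplane R * kcross R / eta * (cblk ^+ 2 + cblk) + kplane' R / eta ^+ 2 +
  kline R / eta ^+ 2.

Let cblk0 : 0 < cblk. Proof. by rewrite ltr0n muln_gt0 expn_gt0. Qed.

(** The minor of squares factors as a difference of squares, and [u * v' + v * u'] is at least
    [2 * M * M' / 256]. *)
Let cross_pos (u v u' v' : nat) M M' : (0 < M)%N -> (0 < M')%N ->
  inblk M u -> inblk M v -> inblk M' u' -> inblk M' v' ->
  (u * v' != v * u')%N ->
  (`| (u ^ 2)%:R * (v' ^ 2)%:R - (v ^ 2)%:R * (u' ^ 2)%:R | : R)^-1 <=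
  kcross R / (M%:R * M'%:R) * (`| (u * v')%:R - (v * u')%:R |)^-1.
Proof.
rewrite /kcross -lock; move=> M0 M'0 /andP[u1 _] /andP[v1 _] /andP[u1' _] /andP[v1' _] ne.
have MR0 : 0 < M%:R :> R by rewrite ltr0n.
have MR0' : 0 < M'%:R :> R by rewrite ltr0n.
have d0 : 0 < `| (u * v')%:R - (v * u')%:R | :> R.
  by rewrite normr_gt0 subr_eq0 eqr_nat.
have s0 : 0 < (u * v')%:R + (v * u')%:R :> R.
  rewrite -natrD ltr0n; move: ne.
  by move: (u * v')%N (v * u')%N => x y; clear; lia.
have -> : (u ^ 2)%:R * (v' ^ 2)%:R - (v ^ 2)%:R * (u' ^ 2)%:R =
    ((u * v')%:R - (v * u')%:R) * ((u * v')%:R + (v * u')%:R) :> R.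
  by rewrite !natrX !natrM; ring.
rewrite normrM (gtr0_norm s0) invfM mulrC ler_wpM2r ?invr_ge0//.
rewrite ler_pdivlMr ?mulr_gt0// mulrC ler_pdivrMr//.
rewrite -natrM -natrD -natrM ler_nat.
have := leq_mul (ltnW u1) (ltnW v1'); have := leq_mul (ltnW v1) (ltnW u1').
rewrite (mulnACA 16 u) (mulnACA 16 v); move: (u * v')%N (v * u')%N (M * M')%N => x y z; clear; lia.
Qed.

(** What remains of [1 / D] besides [kcross / (M * M')]. When the first two coordinates give no
    minor, a later one is used and the factor 1 suffices. *)
Let phi (a a' : idx) : R :=
  if (a.1.1 * a'.1.2 != a.1.2 * a'.1.1)%N
  then (`| (a.1.1 * a'.1.2)%:R - (a.1.2 * a'.1.1)%:R |)^-1 else 1.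

Let inblk_pos M u : inblk M u -> (0 < u)%N.
Proof. by case/inblk_le/andP. Qed.

Let vhits_pair_le (a a' : idx) M M' p p' : (M' <= M)%N -> (16 <= M)%N -> (16 <= M')%N ->
  blk M a -> blk M' a' -> a' != a ->
  level_ok M p -> level_ok M' p' -> M%:R ^+ 4 <= N%:R * p' ->
  \sum_g vhits p a g * vhits p' a' g <=
  p * p' * (kplane R * kcross R / (eta * r * M'%:R) * phi a a' +
    kplane' R / (eta ^+ 2 * M%:R * M'%:R)) * (N ^ m.+2)%:R.
Proof.
move=> MM M16 M16' aM aM' ne ok ok' Np'.
have M0 : 0 < M%:R :> R by rewrite ltr0n (leq_trans _ M16).
have M0' : 0 < M'%:R :> R by rewrite ltr0n (leq_trans _ M16').
have [p0 _ _ _ _] := ok; have [p0' _ _ _ _] := ok'.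
have bM i := blk_vec i aM; have bM' i := blk_vec i aM'.
suff [j [j0 D0 Dphi]] : exists j, let D := `| ((vec a ord0) ^ 2)%:R * ((vec a' j) ^ 2)%:R -
              ((vec a j) ^ 2)%:R * ((vec a' ord0) ^ 2)%:R | : R in
    [/\ j != ord0, 0 < D & D^-1 <= kcross R / (M%:R * M'%:R) * phi a a'].
  apply: (le_trans (pair_plane B N0 r0 delta0 ld lr eta0 eta1 etad MM bM bM' j0 ok ok' Np' D0)).
  rewrite ler_wpM2r//; apply: ler_wpM2l; first by rewrite mulr_ge0 ?ltW.
  rewrite lerD2r; set D := `|_| in D0 Dphi *.
  have -> : kplane R * M%:R / (eta * r * D) = kplane R * M%:R / (eta * r) * D^-1.
    by field; rewrite !lt0r_neq0.
  have c0 : 0 <= kplane R * M%:R / (eta * r).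
    by rewrite divr_ge0 ?mulr_ge0 ?kplane_ge0// ltW.
  apply: (le_trans (ler_wpM2l c0 Dphi)).
  by rewrite le_eqVlt; apply/orP; left; apply/eqP; field; rewrite !lt0r_neq0.
case/and4P: (aM) => cop ub vb /forallP wb.
case/and4P: (aM') => cop' ub' vb' /forallP wb'.
rewrite /phi; case: ifP => [cr|/negbFE/eqP e].
  exists (lift ord0 ord0); rewrite /= !vec0 !vec1; split => //.
    rewrite normr_gt0 subr_eq0 -!natrM eqr_nat -!expnMn eqn_exp2r//.
  have M0n : (0 < M)%N by exact: leq_trans M16.
  have M0n' : (0 < M')%N by exact: leq_trans M16'.
  exact: cross_pos.
(* Equal slopes mean equal first pairs, so [a' != a] provides a tail entry that differs, and with it
   a non-zero minor. *)
have [uu vv] := coprime_cross_eq (inblk_pos ub) (inblk_pos ub') cop cop' e.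
have [w ww] : exists w, a.2 w != a'.2 w.
  apply/existsP; rewrite -negb_forall; apply: contra ne => /forallP h.
  case: a a' {aM aM' bM bM' cop ub vb wb cop' ub' vb' wb' e} uu vv h =>
    [[u v] w] [[u' v'] w']/= uu vv h; apply/eqP; congr (_, _, _).
  - exact/esym/val_inj.
  - exact/esym/val_inj.
  - by apply/ffunP => i; apply/esym/eqP.
exists (lift ord0 (lift ord0 w)); rewrite /= !vec0 !vecS -uu; split => //.
  rewrite normr_gt0 subr_eq0 -!natrM eqr_nat mulnC eqn_pmul2r ?expn_gt0 ?(inblk_pos ub)//.
  by rewrite eqn_exp2r// eq_sym.
rewrite mulr1 /kcross -lock -invf_div lef_pV2 ?posrE ?divr_gt0 ?mulr_gt0//; last first.
  rewrite normr_gt0 subr_eq0 -!natrM eqr_nat mulnC eqn_pmul2r ?expn_gt0 ?(inblk_pos ub)//.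
  by rewrite eqn_exp2r// eq_sym.
rewrite ler_pdivrMr//.
have -> : (a.1.1 ^ 2)%:R * (a'.2 w ^ 2)%:R - (a.2 w ^ 2)%:R * (a.1.1 ^ 2)%:R =
  (a.1.1 ^ 2)%:R * ((a'.2 w)%:R + (a.2 w)%:R) * ((a'.2 w)%:R - (a.2 w)%:R) :> R.
  by rewrite !natrX; ring.
rewrite normrM ger0_norm ?mulr_ge0 ?addr_ge0//.
have d1 : 1 <= `|(a'.2 w)%:R - (a.2 w)%:R| :> R.
  move: ww; rewrite -val_eqE/= neq_ltn => /orP[h|h].
    by rewrite ger0_norm ?subr_ge0 ?ler_nat ?(ltnW h)// lerBrDl natr1 ler_nat.
  by rewrite distrC ger0_norm ?subr_ge0 ?ler_nat ?(ltnW h)// lerBrDl natr1 ler_nat.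
have [_ h1] := inblk_sqr R ub.
have h2 : 2 * M'%:R <= 16 * ((a'.2 w)%:R + (a.2 w)%:R) :> R.
  rewrite -natrD -!natrM ler_nat.
  have /andP[x _] := wb w; have /andP[y _] := wb' w.
  move: (a.2 w : nat) (a'.2 w : nat) x y => x y; move: MM; clear; lia.
have M16R : 16 <= M%:R :> R by rewrite (ler_nat R 16).
move: ((a.1.1 ^ 2)%:R : R) ((a'.2 w)%:R + (a.2 w)%:R : R)
  (`|_ - _|) h1 h2 d1 => A S d h1 h2 d1.
(* Since [M >= 16], one factor [M] can be given up: [A >= M / 16] and [S >= M' / 8] already yield
   [M * M' / 128]. *)
have k1 : 16 * M%:R <= 256 * A by rewrite expr2 in h1; nra.
have A0 : 0 <= A by lra.
have k2 := ler_wpM2r (ltW M0') k1.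
have k3 := ler_wpM2l A0 h2.
have S0 : 0 <= A * S by rewrite mulr_ge0//; lra.
have := ler_wpM2l S0 d1; lra.
Qed.

Lemma weight_ge0 M p : 0 <= p -> 0 <= weight M p.
Proof. by move=> p0; rewrite !mulr_ge0 ?invr_ge0. Qed.

Lemma offdiag_far M M' p p' : (M' <= M)%N -> (16 <= M')%N ->
  level_ok M p -> level_ok M' p' -> M'%:R ^+ 2 <= M%:R * p' ->
  \sum_(a : idx | blk M a) \sum_(a' : idx | blk M' a' && (a' != a))
    \sum_g vhits p a g * vhits p' a' g <=
  cpair * (weight M p * weight M' p') * (N ^ m.+2)%:R.
Proof.
move=> MM M16' ok ok' far.
have M0 : 0 < M%:R :> R by rewrite ltr0n (leq_trans _ MM)// (leq_trans _ M16').
have M0' : 0 < M'%:R :> R by rewrite ltr0n (leq_trans _ M16').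
have [p0 _ _ _ _] := ok; have [p0' _ _ _ _] := ok'.
pose c := p * p' * (kline R / (eta ^+ 2 * M%:R * M'%:R)) * (N ^ m.+2)%:R.
have c0 : 0 <= c.
  by rewrite /c !mulr_ge0 ?invr_ge0 ?mulr_ge0 ?exprn_ge0 ?kline_ge0// ltW.
apply: (@le_trans _ _ (\sum_(a : idx | blk M a) \sum_(a' : idx | blk M' a') c)).
  apply: ler_sum => a aM; rewrite big_mkcondr; apply: ler_sum => a' aM'.
  case: ifP => // _.
  apply: (pair_line B N0 r0 delta0 ld lr eta0 eta1 etad MM _ _ ok ok' far).
    by move=> i; exact: blk_vec.
  by move=> i; exact: blk_vec.
rewrite !sumr_const -mulrnA -[leLHS]mulr_natl natrM.
have -> : (#|@blk m Q M'|)%:R * (#|@blk m Q M|)%:R * c =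
    kline R / eta ^+ 2 * (weight M p * weight M' p') * (N ^ m.+2)%:R.
  by rewrite /c /weight; field; rewrite !lt0r_neq0.
rewrite ler_wpM2r//; apply: ler_wpM2r; first by rewrite mulr_ge0 ?weight_ge0 ?ltW.
by rewrite lerDr addr_ge0 ?mulr_ge0 ?invr_ge0 ?addr_ge0 ?exprn_ge0 ?kplane_ge0
  ?kplane'_ge0 ?(ltW (kcross_gt0 R)) ?(ltW eta0) ?(ltW cblk0).
Qed.

(** The plane estimate carries [1 / (r * M')] and the sum of [phi] a logarithm [K]. The hypothesis
    [34 * (K + 1) <= r * M'] lets them cancel, so that [cpair] involves neither [r] nor the
    level. *)
Lemma offdiag_near M M' p p' K : (M' <= M)%N -> (16 <= M')%N -> (M <= Q)%N ->
  level_ok M p -> level_ok M' p' -> M%:R ^+ 4 <= N%:R * p' ->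
  (M * M' <= 2 ^ K)%N -> 34 * (K%:R + 1) <= r * M'%:R ->
  (forall u, inblk M u -> inblk M' u -> M = M') ->
  \sum_(a : idx | blk M a) \sum_(a' : idx | blk M' a' && (a' != a))
    \sum_g vhits p a g * vhits p' a' g <=
  cpair * (weight M p * weight M' p') * (N ^ m.+2)%:R.
Proof.
move=> MM M16' MQ ok ok' Np' MK Kr dis.
have M16 : (16 <= M)%N by exact: leq_trans MM.
have M'Q : (M' <= Q)%N by exact: leq_trans MQ.
have M0 : 0 < M%:R :> R by rewrite ltr0n (leq_trans _ M16).
have M0' : 0 < M'%:R :> R by rewrite ltr0n (leq_trans _ M16').
have [p0 _ Mr _ _] := ok; have [p0' _ _ _ _] := ok'.
set b : R := (#|@blk m Q M|)%:R; set b' : R := (#|@blk m Q M'|)%:R.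
have b0 : 0 <= b by []. have b0' : 0 <= b' by [].
have Mb : M%:R ^+ m.+2 <= cblk * b by rewrite -natrX -natrM ler_nat card_blk_ge.
have Mb' : M'%:R ^+ m.+2 <= cblk * b' by rewrite -natrX -natrM ler_nat card_blk_ge.
pose Phi : R := \sum_(a : idx | blk M a) \sum_(a' : idx | blk M' a' && (a' != a)) phi a a'.
have PhiE : Phi <= (r * M'%:R) * ((cblk ^+ 2 + cblk) * (b * b' / (M%:R * M'%:R))).
  have : Phi <= \sum_(a : idx | blk M a)
        \sum_(a' : idx | blk M' a' && (a.1.1 * a'.1.2 != a.1.2 * a'.1.1)%N)
      (`| (a.1.1 * a'.1.2)%:R - (a.1.2 * a'.1.1)%:R | : R)^-1 +
      \sum_(a : idx | blk M a) \sum_(a' : idx | blk M' a' && (a'.1 == a.1)) (1 : R).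
    rewrite -big_split; apply: ler_sum => a aM /=.
    rewrite [leLHS]big_mkcondr [X in X + _]big_mkcondr [X in _ + X]big_mkcondr.
    rewrite -big_split; apply: ler_sum => a' aM' /=; rewrite /phi.
    have [_|_] := boolP (a' != a); last by rewrite addr_ge0//; case: ifP.
    case: ifP => [_|/negbFE/eqP e]; first by rewrite lerDl; case: ifP.
    case/and4P: aM => cop ub vb _; case/and4P: aM' => cop' ub' vb' _.
    have [uu vv] := coprime_cross_eq (inblk_pos ub) (inblk_pos ub') cop cop' e.
    rewrite add0r (_ : a'.1 == a.1)//; apply/eqP.
    case: a a' {e cop ub vb cop' ub' vb'} uu vv => [[u v] w] [[u' v'] w']/= uu vv.
    by congr pair; apply/esym/val_inj.
  move/le_trans; apply; rewrite mulrDl mulrDr; apply: lerD.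
    apply: (le_trans (@cross_sum_le m Q R M M' K _ MM MQ MK)); first exact: leq_trans M16'.
    apply: (@le_trans _ _ (r * M'%:R * (M%:R * M'%:R) ^+ m.+1)).
      by rewrite ler_wpM2r ?exprn_ge0 ?mulr_ge0.
    rewrite ler_wpM2l ?mulr_ge0 ?(ltW r0)// mulrA ler_pdivlMr ?mulr_gt0//.
    rewrite -exprSr exprMn.
    have -> : cblk ^+ 2 * (b * b') = (cblk * b) * (cblk * b') by ring.
    by rewrite ler_pM ?exprn_ge0.
  (* Equal first entries lie in both blocks, so this part is empty when [M != M']. When [M = M'],
     only the [m] tail entries of [a'] are free, and [1 <= M * r] suffices. *)
  have [eM|neM] := eqVneq M M'.
    rewrite /b' -eM -/b in Mb' *.
    apply: (le_trans (@same_slope_sum_le m Q R M 1 MQ _)) => //.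
    rewrite -/b mulr1.
    have -> : r * M%:R * (cblk * (b * b / (M%:R * M%:R))) =
       b * ((M%:R * r) * (cblk * b) / M%:R ^+ 2).
      by field; rewrite !lt0r_neq0.
    rewrite ler_wpM2l// ler_pdivlMr ?exprn_gt0// -exprD addn2.
    by apply: (le_trans Mb); rewrite ler_peMl// mulr_ge0// ltW.
  rewrite big1.
    rewrite !mulr_ge0 ?invr_ge0 ?mulr_ge0 ?(ltW r0) ?(ltW cblk0)//.
  move=> a aM; rewrite big1// => a' /andP[aM' /eqP e].
  case/and4P: aM => _ ub _ _; case/and4P: aM' => _ ub' _ _.
  by rewrite e in ub'; rewrite (dis _ ub ub') eqxx in neM.
pose c1 := kplane R * kcross R / (eta * r * M'%:R) : R.
pose c2 := kplane' R / (eta ^+ 2 * M%:R * M'%:R) : R.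
have c20 : 0 <= c2.
  by rewrite divr_ge0 ?kplane'_ge0 ?mulr_ge0 ?exprn_ge0 ?(ltW eta0)// ltW.
have pp0 : 0 <= p * p' by rewrite mulr_ge0 ?ltW.
have H : \sum_(a : idx | blk M a) \sum_(a' : idx | blk M' a' && (a' != a))
    \sum_g vhits p a g * vhits p' a' g <=
    p * p' * (c1 * Phi + c2 * (b * b')) * (N ^ m.+2)%:R.
  apply: (@le_trans _ _ (\sum_(a : idx | blk M a) \sum_(a' : idx | blk M' a' && (a' != a))
     p * p' * (c1 * phi a a' + c2) * (N ^ m.+2)%:R)).
    apply: ler_sum => a aM; apply: ler_sum => a' /andP[aM' ne].
    exact: vhits_pair_le.
  under eq_bigr do rewrite -mulr_suml -mulr_sumr.
  rewrite -mulr_suml -mulr_sumr ler_wpM2r// ler_wpM2l//.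
  under eq_bigr do rewrite big_split/= -mulr_sumr.
  rewrite big_split/= -mulr_sumr -/Phi lerD2l.
  apply: (@le_trans _ _ (\sum_(a : idx | blk M a) \sum_(a' : idx | blk M' a') c2)).
    by apply: ler_sum => a aM; rewrite big_mkcondr; apply: ler_sum => a' _; case: ifP.
  by rewrite !sumr_const -mulrnA -[leLHS]mulr_natl natrM mulrC [b * b']mulrC.
apply: (le_trans H); rewrite ler_wpM2r//.
have c10 : 0 <= c1.
  by rewrite divr_ge0 ?mulr_ge0 ?kplane_ge0 ?(ltW (kcross_gt0 R)) ?(ltW eta0) ?(ltW r0)// ltW.
have H1 := ler_wpM2l c10 PhiE.
have -> : cpair * (weight M p * weight M' p') = p * p' * (cpair * (b * b' / (M%:R * M'%:R))).
  by rewrite /weight -/b -/b'; field; rewrite !lt0r_neq0.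
rewrite ler_wpM2l// /cpair.
set z := b * b' / (M%:R * M'%:R) in H1 *.
have z0 : 0 <= z by rewrite /z !mulr_ge0 ?invr_ge0 ?mulr_ge0.
have -> : c2 * (b * b') = kplane' R / eta ^+ 2 * z.
  by rewrite /c2 /z; field; rewrite !lt0r_neq0.
have e1 : c1 * (r * M'%:R * ((cblk ^+ 2 + cblk) * z)) =
    kplane R * kcross R / eta * (cblk ^+ 2 + cblk) * z.
  by rewrite /c1; field; rewrite !lt0r_neq0.
have z1 : 0 <= kline R / eta ^+ 2 * z.
  by rewrite mulr_ge0// divr_ge0 ?kline_ge0// exprn_ge0// ltW.
by rewrite e1 in H1; rewrite !mulrDl; lra.
Qed.

End block_pairs.

(** * Second moment *)

(* Cauchy-Schwarz, through [2 Z <= la Z^2 + [0 < Z] / la] with the optimal [la]. *)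
Lemma second_moment (R : realType) (G I : finType) (P : pred I)
    (X : I -> G -> R) (W : I -> R) (c C T : R) :
  0 < c -> 0 <= C -> 0 < T -> (forall k g, 0 <= X k g) ->
  (forall k, P k -> c * W k * T <= \sum_g X k g) ->
  (forall k k', P k -> P k' -> \sum_g X k g * X k' g <=
     C * (W k * W k') * T + (if k == k' then \sum_g X k g else 0)) ->
  1 <= c * \sum_(k | P k) W k ->
  T <= (C / c ^+ 2 + 1) * #|[pred g | 0 < \sum_(k | P k) X k g]|%:R.
Proof.
move=> c0 C0 T0 X0 XW XX S1.
set S := \sum_(k | P k) W k in S1.
pose Z g := \sum_(k | P k) X k g.
pose Y := \sum_g Z g.
have Z0 g : 0 <= Z g by exact: sumr_ge0.
have SY : c * S * T <= Y.
  rewrite /Y exchange_big/= /S mulr_sumr mulr_suml.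
  exact: ler_sum.
have TY : T <= Y by apply: le_trans SY; rewrite ler_peMl// ltW.
have Y0 : 0 < Y by exact: lt_le_trans TY.
have S0 : 0 < S by rewrite -(pmulr_rgt0 _ c0) (lt_le_trans ltr01).
set K := C / c ^+ 2 + 1.
have K0 : 0 < K by rewrite ltr_wpDl// divr_ge0// exprn_ge0// ltW.
(* Everything is charged to [Y ^ 2 / T]: the off-diagonal part through [c * S * T <= Y], the
   diagonal through [T <= Y]. *)
have Z2 : \sum_g Z g ^+ 2 <= K * Y ^+ 2 / T.
  have h1 : \sum_g Z g ^+ 2 <= C * S ^+ 2 * T + Y.
    have -> : \sum_g Z g ^+ 2 = \sum_(k | P k) \sum_(k' | P k') \sum_g X k g * X k' g.
      under [RHS]eq_bigr do rewrite exchange_big/=.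
      rewrite [RHS]exchange_big/=; apply: eq_bigr => g _.
      rewrite expr2 /Z mulr_suml; apply: eq_bigr => k _.
      by rewrite mulr_sumr.
    apply: (@le_trans _ _ (\sum_(k | P k) \sum_(k' | P k')
        (C * (W k * W k') * T + (if k == k' then \sum_g X k g else 0)))).
      by apply: ler_sum => k Pk; apply: ler_sum => k' Pk'; exact: XX.
    rewrite (eq_bigr (fun k => C * W k * S * T + \sum_g X k g)); last first.
      move=> k Pk; rewrite big_split/=; congr (_ + _).
        by rewrite /S mulr_sumr mulr_suml; apply: eq_bigr => k' _; rewrite mulrA.
      rewrite (bigD1 k)//= eqxx [X in _ + X]big1 ?addr0// => k' /andP[_ /negbTE].
      by rewrite eq_sym => ->.
    rewrite big_split/= /Y /Z exchange_big/= lerD2r.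
    by rewrite -!mulr_suml -mulr_sumr -/S expr2 mulrA.
  apply: (le_trans h1); rewrite ler_pdivlMr//.
  have h2 : (c * S * T) ^+ 2 <= Y ^+ 2.
    by rewrite lerXn2r// nnegrE ?mulr_ge0// ltW.
  have Cc : 0 <= C / c ^+ 2 by rewrite divr_ge0// exprn_ge0// ltW.
  have h3 := ler_wpM2l Cc h2.
  have -> : (C * S ^+ 2 * T + Y) * T = C / c ^+ 2 * (c * S * T) ^+ 2 + Y * T.
    by field; rewrite lt0r_neq0.
  have : Y * T <= Y ^+ 2 by rewrite expr2 ler_wpM2l// ltW.
  rewrite /K mulrDl mul1r; lra.
pose la := T / (K * Y).
have la0 : 0 < la by rewrite divr_gt0// mulr_gt0.
set s := #|_|%:R.
have sE : s = \sum_g (0 < Z g)%R%:R :> R.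
  rewrite /s -sum1_card natr_sum [LHS]big_mkcond.
  by apply: eq_bigr => g _; rewrite inE -/(Z g); case: (0 < Z g)%R.
have main : 2 * Y <= la * (K * Y ^+ 2 / T) + s / la.
  apply: (@le_trans _ _ (la * (\sum_g Z g ^+ 2) + s / la)); last first.
    by rewrite lerD2r ler_wpM2l// ltW.
  rewrite sE /Y !mulr_sumr mulr_suml -big_split/=; apply: ler_sum => g _.
  have := Z0 g; rewrite le_eqVlt => /orP[/eqP <-|Zg].
    by rewrite mulr0 expr0n mulr0 ltxx mul0r addr0.
  rewrite Zg mul1r -subr_ge0.
  have -> : la * Z g ^+ 2 + la^-1 - 2 * Z g = (la * Z g - 1) ^+ 2 / la.
    by field; rewrite lt0r_neq0.
  by rewrite divr_ge0 ?sqr_ge0// ltW.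
have e1 : la * (K * Y ^+ 2 / T) = Y by rewrite /la; field; rewrite !lt0r_neq0.
have e2 : s / la = s * K * Y / T by rewrite /la; field; rewrite !lt0r_neq0.
have h : Y <= s * K * Y / T by move: main; rewrite e1 e2; lra.
move: h; rewrite ler_pdivlMr// [leLHS]mulrC => h.
by rewrite mulrC -(ler_pM2r Y0).
Qed.

Lemma bhits_ge0 (R : realType) m N B Q l (r : R) M p g : 0 <= @bhits R m N B Q l r M p g.
Proof. by apply: sumr_ge0 => a _; exact: hits_ge0. Qed.

Section block_moment.
Variables (R : realType) (m N B Q : nat) (l : 'I_m.+2 -> R) (r delta eta : R).
Hypotheses (N0 : (0 < N)%N) (r0 : 0 < r) (delta0 : 0 < delta).
Hypotheses (ld : forall i, delta <= l i) (lr : forall i, l i + r <= 1).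
Hypotheses (eta0 : 0 < eta) (eta1 : eta <= 1) (etad : 2 * 256 * eta ^+ 2 <= delta).
Variables (p : nat -> R) (P : pred nat).
Hypothesis Pk : forall k, P k ->
  [/\ (0 < k)%N, (16 ^ k <= Q)%N, level_ok N r eta (16 ^ k) (p k),
      (Q%:R) ^+ 4 <= N%:R * p k & 1 <= p k * (16 ^ k)%:R ^+ m.+2].
Hypothesis PK : forall k, P k -> 34 * ((4 * (m + 5) * k)%:R + 1) <= r * (16 ^ k)%:R.
Local Notation X := (fun k => @bhits R m N B Q l r (16 ^ k) (p k)).
Local Notation W := (fun k => @weight R m Q (16 ^ k) (p k)).

(** Write [M] and [M'] for the two powers of 16. If [k >= (m + 4) * k'], then
    [M * p' >= M' ^ (m + 4) * p' >= M' ^ 2], as [p' * M' ^ (m + 2) >= 1]. Otherwise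
    [M * M' <= 2 ^ (4 * (m + 5) * k')], so the logarithm is linear in [k']. *)
Let offdiag k k' : P k -> P k' -> (k' <= k)%N ->
  \sum_(a | @blk m Q (16 ^ k) a) \sum_(a' | @blk m Q (16 ^ k') a' && (a' != a))
    \sum_g vhits B l r (p k) a g * @vhits R m N B Q l r (p k') a' g <=
  cpair m eta * (W k * W k') * (N ^ m.+2)%:R.
Proof.
move=> Hk Hk' kk'.
have [k0 kQ ok NQ _] := Pk Hk; have [k0' k'Q ok' NQ' p'e] := Pk Hk'.
have [p0' p'1 _ _ _] := ok'.
have MM : (16 ^ k' <= 16 ^ k)%N by rewrite leq_exp2l.
have M16' : (16 <= 16 ^ k')%N by rewrite -[leqLHS]expn1 leq_exp2l.
have [far|near] := leqP ((m + 4) * k') k.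
  apply: (offdiag_far _ _ N0 r0 delta0 ld lr eta0 eta1 etad MM M16' ok ok').
  have h : (16 ^ ((m + 4) * k'))%:R <= (16 ^ k)%:R :> R by rewrite ler_nat leq_exp2l.
  apply: le_trans (ler_wpM2r (ltW p0') h).
  have -> : (16 ^ ((m + 4) * k'))%N = ((16 ^ k') ^ (m.+2 + 2))%N.
    by rewrite -expnM; congr (_ ^ _)%N; rewrite [RHS]mulnC !addnS !addSn.
  move: p'e; move: (16 ^ k')%N => M' p'e.
  by rewrite natrX exprD [leRHS]mulrC mulrA ler_peMl// exprn_ge0.
have K1 : (16 ^ k * 16 ^ k' <= 2 ^ (4 * (m + 5) * k'))%N.
  rewrite -expnD (_ : 16 = 2 ^ 4)%N// -expnM leq_exp2l//.
  by move: near; clear; nia.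
apply: (offdiag_near _ N0 r0 delta0 ld lr eta0 eta1 etad MM M16' kQ ok ok' _ K1 (PK Hk')).
  apply: le_trans NQ'; rewrite lerXn2r ?nnegrE// ler_nat//.
move=> u /andP[u1 u2] /andP[u3 u4]; congr (16 ^ _)%N; apply/eqP; rewrite eqn_leq kk' andbT.
rewrite -ltnS -(@ltn_exp2l 16)// expnS; apply: (leq_trans u1).
by rewrite leq_mul2l.
Qed.

(** Blocks of different levels are disjoint, so the terms [a' = a] occur only for [k' = k], where
    [hits_sqr_le] reduces them to the first moment. *)
Lemma block_moment k k' : P k -> P k' ->
  \sum_g X k g * X k' g <=
  cpair m eta * (W k * W k') * (N ^ m.+2)%:R + (if k == k' then \sum_g X k g else 0).
Proof.
move=> Hk Hk'; wlog kk' : k k' Hk Hk' / (k' <= k)%N.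
  move=> H; case: (leqP k' k) => [|/ltnW] h; first exact: H.
  have := H _ _ Hk' Hk h; rewrite eq_sym [W k' * W k]mulrC.
  under eq_bigr do rewrite mulrC.
  by case: eqP => // ->.
have := offdiag Hk Hk' kk'.
set lhs := \sum_(a | _) _ => H.
have [p0' p'1 _ _ _] : level_ok N r eta (16 ^ k') (p k') by case: (Pk Hk').
have p2 : p k' <= 2^-1.
  by apply: (le_trans p'1); rewrite /ksmall -lock; lra.
suff : \sum_g X k g * X k' g <= lhs + (if k == k' then \sum_g X k g else 0) by lra.
have -> : \sum_g X k g * X k' g = lhs +
    \sum_(a | @blk m Q (16 ^ k) a) \sum_(a' | @blk m Q (16 ^ k') a' && (a' == a))
      \sum_g vhits B l r (p k) a g * @vhits R m N B Q l r (p k') a' g.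
  rewrite -big_split/=.
  under [RHS]eq_bigr => a _ do
    rewrite addrC -(@bigID _ _ _ _ _ (fun a' => a' == a)) exchange_big/=.
  rewrite [RHS]exchange_big/=; apply: eq_bigr => g _.
  rewrite /bhits mulr_suml; apply: eq_bigr => a _.
  by rewrite mulr_sumr.
rewrite lerD2l; have [e|nek] := eqVneq k k'.
  subst k'; rewrite [leRHS]exchange_big/=; apply: ler_sum => a aM.
  rewrite (big_pred1 a)/=; last first.
    by move=> a' /=; rewrite andbC; have [->|] := eqVneq a' a; rewrite ?aM.
  by apply: ler_sum => g _; rewrite -expr2; exact: hits_sqr_le.
rewrite big1// => a aM; rewrite big1// => a' /andP[aM' /eqP e]; exfalso.
rewrite e in aM'; case/and4P: aM => _ /andP[u1 u2] _ _; case/and4P: aM' => _ /andP[u3 u4] _ _.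
have : (16 ^ k < 16 ^ k'.+1)%N by rewrite expnS (leq_trans u1)// leq_mul2l.
by rewrite ltn_exp2l// ltnS leqNgt ltn_neqAle eq_sym nek kk'.
Qed.

Lemma bhits_lower k : P k -> 32 * 64 * m.+2%:R <= (16 ^ k)%:R * r ->
  p k <= (16 ^ k)%:R ^+ 2 * r / (32 * 32) -> (m.+2 * 16 ^ k < B)%N ->
  (klow R * m.+2%:R)^-1 * W k * (N ^ m.+2)%:R <= \sum_g X k g.
Proof.
move=> Hk h1 h2 h3; have [k0 kQ ok _ _] := Pk Hk.
rewrite [leRHS]exchange_big/=.
apply: (@le_trans _ _ (\sum_(a | @blk m Q (16 ^ k) a)
   p k / (klow R * m.+2%:R * (16 ^ k)%:R) * (N ^ m.+2)%:R)).
  rewrite sumr_const -[leRHS]mulr_natl /weight.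
  rewrite le_eqVlt; apply/orP; left; apply/eqP; field.
  by rewrite !lt0r_neq0 ?klow_gt0 ?ltr0n ?expn_gt0.
apply: ler_sum => a aM.
by apply: (single_ge (eta := eta) N0 r0 delta0 ld lr) => // i; exact: blk_vec.
Qed.

End block_moment.

(** * Divergence along powers of 16 *)

Lemma nneseries_unbounded (R : realType) (u : nat -> R) (n0 : nat) :
  (forall h, (n0 <= h)%N -> 0 <= u h) -> (\sum_(n0 <= h <oo) (u h)%:E = +oo)%E ->
  forall A : R, exists H, A <= \sum_(n0 <= h < H) u h.
Proof.
move=> u0 uoo A; have [//|no] := pselect (exists H, A <= \sum_(n0 <= h < H) u h).
have : (\sum_(n0 <= h <oo) (u h)%:E <= A%:E)%E.
  apply: lime_le; first by apply: is_cvg_nneseries => n nn _; rewrite lee_fin u0.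
  apply: nearW => H; rewrite sumEFin lee_fin leNgt; apply/negP => h.
  by case: no; exists H; exact: ltW.
by rewrite uoo leye_eq.
Qed.

Section divergence.
Variables (R : realType) (m : nat) (psi : R -> R).
Hypothesis psi0 : forall h, 0 < h -> 0 < psi h.
Hypothesis psi_dec : forall x y, 0 < x -> x <= y -> psi y <= psi x.
Hypothesis psi_cvg : psi x @[x --> +oo] --> 0.
Hypothesis psi_div : (\sum_(1 <= h <oo) ((h%:R ^+ m * psi h%:R)%:E) = +oo)%E.

(* The factor 1/2 leaves room for a whole grid cell around a point hit at level [lvl k]. *)
Definition lvl (k : nat) : R := psi (16 ^ k)%:R / 2.

Let pow0 k : 0 < (16 ^ k)%:R :> R. Proof. by rewrite ltr0n expn_gt0. Qed.

Lemma lvl_gt0 k : 0 < lvl k.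
Proof. by rewrite divr_gt0// psi0. Qed.

(** Cauchy condensation in base 16: at most [16 ^ K.+1] terms, each bounded by the power at the
    right end times [psi] at the left end. The 2 undoes the halving in [lvl]. *)
Lemma condensation K :
  \sum_(1 <= h < 16 ^ K) (h%:R ^+ m * psi h%:R) <=
  2 * 16 ^+ m.+1 * \sum_(k < K) lvl k * (16 ^ k)%:R ^+ m.+1.
Proof.
elim: K => [|K IH]; first by rewrite big_geq// big_ord0 mulr0.
rewrite (@big_cat_nat _ _ _ (16 ^ K)) ?expn_gt0 ?leq_exp2l//=.
rewrite big_ord_recr/= mulrDr lerD//.
apply: (@le_trans _ _ (\sum_(16 ^ K <= h < 16 ^ K.+1)
    (16 ^ K.+1)%:R ^+ m * psi (16 ^ K)%:R)).
  rewrite !big_nat; apply: ler_sum => h /andP[h1 h2].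
  apply: ler_pM.
  - by rewrite exprn_ge0.
  - by rewrite ltW// psi0// ltr0n (leq_trans _ h1)// expn_gt0.
  - by rewrite lerXn2r ?nnegrE// ler_nat ltnW.
  - by apply: psi_dec => //; rewrite ler_nat.
rewrite sumr_const_nat -[leLHS]mulr_natl.
have -> : 2 * 16 ^+ m.+1 * (lvl K * (16 ^ K)%:R ^+ m.+1) =
    (16 ^ K.+1)%:R * ((16 ^ K.+1)%:R ^+ m * psi (16 ^ K)%:R).
  by rewrite /lvl expnS natrM !exprS !exprMn; field.
rewrite ler_wpM2r ?mulr_ge0 ?exprn_ge0//; first by rewrite ltW// psi0.
by rewrite ler_nat leq_subr.
Qed.

(** The second condition is the lower bound on the width by which distant levels can be compared. *)
Definition active (k0 k : nat) : bool :=
  (k0 <= k)%N && (1 <= lvl k * (16 ^ k)%:R ^+ m.+2).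

(* The levels with [lvl k < 16 ^ (- k (m + 2))] contribute a convergent series. *)
Lemma active_unbounded k0 (A : R) : exists K,
  A <= \sum_(k < K | active k0 k) lvl k * (16 ^ k)%:R ^+ m.+1.
Proof.
pose T k := lvl k * (16 ^ k)%:R ^+ m.+1.
have T0 k : 0 <= T k by rewrite mulr_ge0 ?exprn_ge0// ltW// lvl_gt0.
pose S0 := \sum_(k < k0) T k.
have u0 h : (1 <= h)%N -> 0 <= h%:R ^+ m * psi h%:R.
  by move=> h1; rewrite mulr_ge0 ?exprn_ge0// ltW// psi0// ltr0n.
have [H HA] := nneseries_unbounded u0 psi_div (2 * 16 ^+ m.+1 * (A + 2 + S0)).
exists H.
have h2 : 2 * 16 ^+ m.+1 * (A + 2 + S0) <= 2 * 16 ^+ m.+1 * \sum_(k < H) T k.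
  apply: le_trans (condensation H); apply: (le_trans HA).
  have HH : (H <= 16 ^ H)%N by rewrite ltnW// ltn_expl.
  have [H0|H0] := posnP H.
    by rewrite H0 big_geq// big_geq.
  rewrite (@big_cat_nat _ _ _ H 1 (16 ^ H))//=.
  rewrite ler_wpDr//.
  by rewrite big_nat; apply: sumr_ge0 => h /andP[h1 _]; rewrite u0// (leq_trans H0).
move: h2; rewrite ler_pM2l ?mulr_gt0 ?exprn_gt0// => h2.
have inact : \sum_(k < H) ((16 ^ k)%:R : R)^-1 <= 2.
  suff : \sum_(k < H) ((16 ^ k)%:R : R)^-1 <= 2 - 2 * (16 ^ H)%:R^-1.
    by move/le_trans; apply; rewrite gerBl mulr_ge0 ?invr_ge0.
  elim: (H) => [|j IH]; first by rewrite big_ord0 expn0 invr1; lra.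
  rewrite big_ord_recr/= expnS natrM invfM; have := pow0 j; rewrite -invr_gt0.
  move: IH; lra.
have : \sum_(k < H) T k <= S0 + \sum_(k < H) ((16 ^ k)%:R : R)^-1 +
    \sum_(k < H | active k0 k) T k.
  have -> : S0 + \sum_(k < H) ((16 ^ k)%:R : R)^-1 + \sum_(k < H | active k0 k) T k =
    S0 + \sum_(k < H) (((16 ^ k)%:R : R)^-1 + if active k0 k then T k else 0).
    by rewrite big_split/= -big_mkcond/= addrA.
  have : \sum_(k < H) T k <= \sum_(k < H) (if (k < k0)%N then T k else 0) +
     \sum_(k < H) (((16 ^ k)%:R : R)^-1 + if active k0 k then T k else 0).
    rewrite -big_split/=; apply: ler_sum => k _.
    have i0 : 0 <= ((16 ^ k)%:R : R)^-1 by rewrite invr_ge0.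
    rewrite /active; case: ltnP => /= k0k; first by rewrite lerDl addr_ge0.
    rewrite add0r; case: ifP => [_|]; first by rewrite lerDr.
    move/negbT; rewrite -ltNge => /ltW h; rewrite addr0.
    by rewrite -[leRHS]mul1r ler_pdivlMr// -mulrA -exprSr.
  move/le_trans; apply; rewrite lerD2r -big_mkcond/=.
  have [Hk|kH] := leqP H k0.
    apply: (@le_trans _ _ (\sum_(k < H) T k)).
      by rewrite big_mkcond; apply: ler_sum => k _; case: ifP.
    by rewrite /S0 (big_ord_widen _ T Hk) big_mkcond; apply: ler_sum => k _; case: ifP.
  by rewrite /S0 (big_ord_widen _ T (ltnW kH)).
lra.
Qed.

Lemma growth (A : R) : exists k0, forall k, (k0 <= k)%N -> A * k.+1%:R <= (16 ^ k)%:R.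
Proof.
exists (Num.truncn A).+1 => k Ak.
have {}Ak : A <= k%:R by apply: (le_trans (ltW (truncnS_gt A))); rewrite ler_nat.
rewrite (_ : 16 = 8 * 2)%N// expnMn natrM.
case: (leP 0 A) => A0; last first.
  by apply: (@le_trans _ _ 0); rewrite ?mulr_ge0// mulr_le0_ge0// ltW.
rewrite ler_pM//; last by rewrite ler_nat ltn_expl.
by apply: (le_trans Ak); rewrite ler_nat ltnW// ltn_expl.
Qed.

Lemma lvl_small (e : R) : 0 < e -> exists k0, forall k, (k0 <= k)%N -> lvl k <= e.
Proof.
move=> e0.
have /cvgrPdist_le/(_ e e0) := psi_cvg.
case=> A [_ HA]; exists (Num.truncn A).+1 => k kA.
have Ak : A < (16 ^ k)%:R.
  apply: (lt_le_trans (truncnS_gt A)); rewrite ler_nat (leq_trans kA)//.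
  by rewrite ltnW// ltn_expl.
have := HA _ Ak; have := psi0 (pow0 k) => p0; rewrite /= sub0r normrN gtr0_norm// /lvl; lra.
Qed.

End divergence.

(** * Local density of the slabs *)

Definition in_slab (R : realType) (n : nat) (psi : R -> R) (h0 : nat)
    (l : 'I_n -> R) (r : R) : Prop :=
  exists (a : 'I_n -> nat) (b : nat), (h0 <= height a)%N /\
    forall x : 'I_n -> R, (forall i, l i <= x i <= l i + r) ->
      `|sdot a x - (b ^ 2)%:R| < psi (height a)%:R.

Lemma sdot_cell (R : realType) n (a : 'I_n -> nat) M (l x : 'I_n -> R) (s : R) :
  (forall i, (a i <= M)%N) -> (forall i, l i <= x i <= l i + s) ->
  `|sdot a x - sdot a l| <= n%:R * M%:R ^+ 2 * s.
Proof.
move=> aM lx; rewrite /sdot -sumrB; apply: (le_trans (ler_norm_sum _ _ _)).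
rewrite -mulrA mulr_natl -[X in _ *+ X]card_ord -sumr_const.
apply: ler_sum => i _; have /andP[x1 x2] := lx i.
rewrite -mulrBr normrM ger0_norm// ler_pM//.
  by rewrite -natrX ler_nat leq_exp2r.
by rewrite ger0_norm ?subr_ge0// lerBlDl.
Qed.

Section slab_density.
Variables (R : realType) (m : nat) (psi : R -> R).
Hypothesis psi0 : forall h, 0 < h -> 0 < psi h.
Hypothesis psi_dec : forall x y, 0 < x -> x <= y -> psi y <= psi x.
Hypothesis psi_cvg : psi x @[x --> +oo] --> 0.
Hypothesis psi_div : (\sum_(1 <= h <oo) ((h%:R ^+ m * psi h%:R)%:E) = +oo)%E.
Local Notation lvl := (lvl psi).

(** The corner is within [lvl k] of a square and the form varies by at most [lvl k] over the cell;
    the total stays below [psi] at [16 ^ k], hence below [psi] at the height, which is at most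
    [16 ^ k] and more than [16 ^ k / 16]. *)
Lemma hit_in_slab N Q (l : 'I_m.+2 -> R) r (g : {ffun 'I_m.+2 -> 'I_N}) k h0
    (a : ('I_Q.+1 * 'I_Q.+1) * {ffun 'I_m -> 'I_Q.+1}) b : blk (16 ^ k) a ->
  (h0 < k)%N -> m.+2%:R * (16 ^ k)%:R ^+ 2 * (r / N%:R) <= lvl k ->
  hit (lvl k) (sdot (vec a) (gpt l r g)) b ->
  in_slab psi h0 (gpt l r g) (r / N%:R).
Proof.
move=> aM h0k small; rewrite /hit => hb.
have bM i := blk_vec i aM.
have hM : (height (vec a) <= 16 ^ k)%N.
  by apply/bigmax_leqP => i _; case/andP: (bM i).
have ha : (16 ^ k < 16 * height (vec a))%N.
  have /andP[h _] := bM ord0; apply: (leq_trans h).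
  by rewrite leq_mul2l (leq_bigmax ord0).
exists (vec a), b; split.
  rewrite -(prednK (leq_ltn_trans (leq0n _) h0k)) expnS ltn_mul2l/= in ha.
  apply: leq_trans (ltnW ha); apply: leq_trans (ltnW (ltn_expl _ _)) => //.
  by rewrite -ltnS prednK// (leq_ltn_trans (leq0n _) h0k).
move=> x xg.
have lx : 2 * lvl k <= psi (height (vec a))%:R.
  rewrite /lvl mulrC divfK// psi_dec ?ler_nat//.
  rewrite ltr0n lt0n; apply: contraTneq ha => ->.
  by rewrite muln0.
apply: lt_le_trans lx.
have aM' i : (vec a i <= 16 ^ k)%N by case/andP: (bM i).
have := sdot_cell aM' xg.
have -> : sdot (vec a) x - (b ^ 2)%:R = (sdot (vec a) x - sdot (vec a) (gpt l r g)) +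
   (sdot (vec a) (gpt l r g) - (b ^ 2)%:R) by ring.
move=> h; apply: (le_lt_trans (ler_normD _ _)); lra.
Qed.

(** [c] is fixed before the cube and [h0], from [m] and [delta] alone; the levels, the mesh [N] and
    the range [B] of squares are chosen afterwards. *)
Lemma local_density (delta : R) : 0 < delta -> delta <= 1 ->
  exists2 c : R, 0 < c & forall (l : 'I_m.+2 -> R) r h0, 0 < r ->
    (forall i, delta <= l i) -> (forall i, l i + r <= 1) ->
    exists2 N, (0 < N)%N & c * (N ^ m.+2)%:R <=
      #|[pred g : {ffun 'I_m.+2 -> 'I_N} |
          `[< in_slab psi h0 (gpt l r g) (r / N%:R) >] ]|%:R.
Proof.
(* [512 * eta ^ 2 = delta ^ 2 / 2 <= delta]. *)
move=> delta0 delta1; pose eta := delta / 32.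
have eta0 : 0 < eta by rewrite divr_gt0.
have eta1 : eta <= 1 by rewrite /eta; lra.
have etad : 2 * 256 * eta ^+ 2 <= delta.
  have -> : 2 * 256 * eta ^+ 2 = delta ^+ 2 / 2 by rewrite /eta; field.
  by rewrite ler_pdivrMr// expr2 ler_wpM2l//; lra.
pose c := (klow R * m.+2%:R)^-1.
have c0 : 0 < c by rewrite invr_gt0 mulr_gt0// klow_gt0.
pose C := cpair m eta.
have C0 : 0 <= C.
  by rewrite /C /cpair !addr_ge0 ?mulr_ge0 ?invr_ge0 ?exprn_ge0 ?addr_ge0 ?exprn_ge0
    ?kplane_ge0 ?kplane'_ge0 ?kline_ge0 ?(ltW (kcross_gt0 R)) ?(ltW eta0).
have K0 : 0 < C / c ^+ 2 + 1 by rewrite ltr_wpDl// divr_ge0// exprn_ge0// ltW.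
exists (C / c ^+ 2 + 1)^-1; first by rewrite invr_gt0.
move=> l r h0 r0 ld lr.
have r1 : r <= 1 by have := ld ord0; have := lr ord0; lra.
have [k1 Hk1] := lvl_small psi0 psi_cvg (ksmall_gt0 R).
have [k2 Hk2] := growth (34 * (4 * (m + 5) + 1)%:R / r).
have [k3 Hk3] := growth (1 / r).
have [k4 Hk4] := growth (1 / (2 * eta)).
have [k5 Hk5] := growth (32 * 64 * m.+2%:R / r).
(* [k1] makes the widths small, [k2] absorbs the logarithm and [1 / r], [k3] and [k4] give the size
   conditions of [level_ok], and [k5] guarantees a square on every grid line. *)
pose k0 := maxn h0.+1 (maxn k1 (maxn k2 (maxn k3 (maxn k4 k5)))).
have k0P k : (k0 <= k)%N ->
    [&& (h0 < k)%N, (k1 <= k)%N, (k2 <= k)%N, (k3 <= k)%N, (k4 <= k)%N & (k5 <= k)%N].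
  by rewrite !geq_max.
have weaken (x : R) k : 0 <= x -> x * k.+1%:R <= (16 ^ k)%:R -> x <= (16 ^ k)%:R.
  by move=> x0; apply: le_trans; rewrite ler_peMr// ler1n.
have [K HK] := active_unbounded psi0 psi_dec psi_div k0 (cblk R m / c).
pose Q := (16 ^ K)%N; pose B := (m.+2 * Q).+1.
have lvl0 := lvl_gt0 psi0.
(* [lvl] is nonincreasing, so a mesh fitted to [lvl K] serves all levels below [K]. *)
pose N := (Num.truncn (m.+2%:R * Q%:R ^+ 4 / lvl K : R)).+1.
have NQ : m.+2%:R * Q%:R ^+ 4 <= N%:R * lvl K.
  by rewrite -ler_pdivrMr// ltW// truncnS_gt.
exists N => //.
have NR0 : 0 < N%:R :> R by rewrite ltr0n.
have lvlK k : (k < K)%N -> lvl K <= lvl k.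
  move=> kK; rewrite /lvl ler_pM2r ?invr_gt0// psi_dec ?ltr0n ?expn_gt0//.
  by rewrite ler_nat leq_exp2l// ltnW.
have NQk k : (k < K)%N -> m.+2%:R * Q%:R ^+ 4 <= N%:R * lvl k.
  by move=> /lvlK h; apply: (le_trans NQ); rewrite ler_pM2l.
have Q1 : 1 <= Q%:R :> R by rewrite ler1n expn_gt0.
have kQ k : (k < K)%N -> (16 ^ k <= Q)%N by move=> kK; rewrite leq_exp2l// ltnW.
have Q4 : Q%:R ^+ 4 <= m.+2%:R * Q%:R ^+ 4 :> R.
  by rewrite ler_peMl ?exprn_ge0// ler1n.
pose P k := (k < K)%N && active m psi k0 k.
have Pk0 k : P k -> (k0 <= k)%N by case/andP => _ /andP[].
have PkK k : P k -> (k < K)%N by case/andP.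
have levels k : P k ->
  [/\ (0 < k)%N, (16 ^ k <= Q)%N, level_ok N r eta (16 ^ k) (lvl k),
      Q%:R ^+ 4 <= N%:R * lvl k & 1 <= lvl k * (16 ^ k)%:R ^+ m.+2].
  move=> Hk; have kk := Pk0 _ Hk; have kK := PkK _ Hk.
  have /and5P[kh kk1 kk2 kk3 /andP[kk4 kk5]] := k0P _ kk.
  have NQ' : Q%:R ^+ 4 <= N%:R * lvl k by exact: le_trans (NQk _ kK).
  split=> //.
  - exact: leq_ltn_trans kh.
  - exact: kQ.
  - split=> //.
    + exact: Hk1.
    + rewrite -ler_pdivrMr//; apply: weaken (Hk3 _ kk3).
      by rewrite divr_ge0// ltW.
    + rewrite mulrC -ler_pdivrMr ?mulr_gt0//; apply: weaken (Hk4 _ kk4).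
      by rewrite divr_ge0// mulr_ge0// ltW.
    + by apply: le_trans NQ'; rewrite lerXn2r ?nnegrE// ler_nat kQ.
  - by case/andP: Hk => _ /andP[].
have levelsK k : P k -> 34 * ((4 * (m + 5) * k)%:R + 1) <= r * (16 ^ k)%:R.
  move=> /Pk0/k0P/and5P[_ _ kk _ _]; have := Hk2 _ kk.
  rewrite mulrAC ler_pdivrMr// [leRHS]mulrC; apply: le_trans.
  rewrite -mulrA ler_wpM2l ?ler0n// natr1 -natrM ler_nat.
  by clear; nia.
have large k : P k -> 32 * 64 * m.+2%:R <= (16 ^ k)%:R * r.
  move=> /Pk0/k0P/and5P[_ _ _ _ /andP[_ kk]]; rewrite -ler_pdivrMr//; apply: weaken (Hk5 _ kk).
  by rewrite divr_ge0 ?(ltW r0)// !mulr_ge0 ?ler0n.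
have H := @second_moment R {ffun 'I_m.+2 -> 'I_N} 'I_K (fun k => P k)
  (fun k g => @bhits R m N B Q l r (16 ^ k) (lvl k) g)
  (fun k => weight m Q (16 ^ k) (lvl k)) c C (N ^ m.+2)%:R c0 C0.
rewrite -(ler_pM2l K0) mulrA divff ?lt0r_neq0// mul1r.
apply: (le_trans (H _ _ _ _ _)).
- by rewrite ltr0n expn_gt0.
- by move=> k g; exact: bhits_ge0.
- move=> k Hk; apply: (bhits_lower _ r0 delta0 ld lr levels) => //.
  + exact: large.
  + have [_ _ [_ p1 _ _ _] _ _] := levels _ Hk.
    have p2 : lvl k <= 1 by apply: (le_trans p1); rewrite /ksmall -lock; lra.
    apply: (le_trans p2); rewrite ler_pdivlMr ?mul1r; last by rewrite mulr_gt0 ?ltr0n.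
    rewrite expr2 -mulrA.
    have h1 := large _ Hk.
    have h2 : 1 <= (16 ^ k)%:R :> R by rewrite ler1n expn_gt0.
    have h3 : 1 <= m.+2%:R :> R by rewrite ler1n.
    by move: ((16 ^ k)%:R : R) (m.+2%:R : R) h1 h2 h3 => x y h1 h2 h3; clear -h1 h2 h3; nra.
  + by rewrite /B ltnS leq_mul2l kQ ?orbT// PkK.
- move=> k k' Hk Hk'.
  rewrite -val_eqE; exact: (block_moment B _ r0 delta0 ld lr eta0 eta1 etad levels levelsK).
(* A block has at least [M ^ m.+2 / cblk] vectors, so its weight is at least
   [lvl k * M ^ m.+1 / cblk]; [K] was chosen to make these sum to at least [1 / c]. *)
- have -> : 1 = c * (cblk R m)^-1 * (cblk R m / c).
    by rewrite /cblk; field; rewrite !lt0r_neq0 ?ltr0n ?muln_gt0 ?expn_gt0.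
  have cb0 : 0 < cblk R m by rewrite ltr0n muln_gt0 expn_gt0.
  rewrite -mulrA ler_pM2l// mulrC ler_pdivrMr//; apply: (le_trans HK).
  rewrite [leLHS](eq_bigl (fun k : 'I_K => P k)); last by move=> k; rewrite /P ltn_ord.
  rewrite mulr_suml; apply: ler_sum => k Hk.
  have [_ kQ' _ _ _] := levels _ Hk.
  have h := card_blk_ge m kQ'; rewrite -(ler_nat R) natrX natrM -/(cblk R m) in h.
  have M0 : 0 < (16 ^ k)%:R :> R by rewrite ltr0n expn_gt0.
  have -> : weight m Q (16 ^ k) (lvl k) * cblk R m =
      lvl k * ((16 ^ k)%:R^-1 * (cblk R m * #|@blk m Q (16 ^ k)|%:R)).
    by rewrite /weight; ring.
  by rewrite ler_pM2l// ler_pdivlMl// -exprS.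
- rewrite ler_pM2l// ler_nat; apply: subset_leq_card; apply/fintype.subsetP => g.
  rewrite !inE => Zg; apply/asboolP.
  have [k Hk] : exists2 k : 'I_K, P k & 0 < @bhits R m N B Q l r (16 ^ k) (lvl k) g.
    apply/exists_inP; apply: contraLR Zg => /exists_inPn no.
    rewrite -leNgt; apply: sumr_le0 => k Hk; rewrite leNgt; exact: no.
  move=> bk.
  have [a aM ha] : exists2 a, @blk m Q (16 ^ k) a & 0 < vhits B l r (lvl k) a g.
    apply/exists_inP; apply: contraLR bk => /exists_inPn no.
    rewrite -leNgt; apply: sumr_le0 => a aM; rewrite leNgt; exact: no.
  have [b hb] : exists b : 'I_B, hit (lvl k) (sdot (vec a) (gpt l r g)) b.
    apply/existsP; apply: contraLR ha => /existsPn no.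
    by rewrite -leNgt /vhits /hits big1// => b _; rewrite (negbTE (no b)).
  apply/asboolP; apply: (hit_in_slab aM _ _ hb).
    by case/and5P: (k0P _ (Pk0 _ Hk)).
  rewrite mulrA ler_pdivrMr// [leRHS]mulrC.
  apply: le_trans (NQk _ (PkK _ Hk)).
  apply: (@le_trans _ _ (m.+2%:R * (16 ^ k)%:R ^+ 2)).
    by rewrite ler_piMr// mulr_ge0 ?exprn_ge0.
  rewrite ler_pM2l ?ltr0n//; apply: (@le_trans _ _ (Q%:R ^+ 2)).
    by rewrite lerXn2r ?nnegrE// ler_nat kQ// PkK.
  by rewrite ler_weXn2l.
Qed.

End slab_density.

(** * Tails of series and overlaps of boxes *)

Section tails.
Variables (R : realType) (v : nat -> R).
Hypothesis v0 : forall k, 0 <= v k.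
Hypothesis voo : (\sum_(0 <= k <oo) (v k)%:E < +oo)%E.

(** [fine] sends an infinite sum to 0; for sequences [dominated] by the summable [v] the sum is
    finite. *)
Definition tail (u : nat -> R) (K : nat) : R := fine (\sum_(K <= k <oo) (u k)%:E).

Definition dominated (u : nat -> R) : Prop := forall k, 0 <= u k <= v k.

Let ge0 u k : dominated u -> (0 <= (u k)%:E)%E.
Proof. by move=> /(_ k)/andP[u0 _]; rewrite lee_fin. Qed.

Lemma tail_fin u K : dominated u -> (\sum_(K <= k <oo) (u k)%:E)%E \is a fin_num.
Proof.
move=> uv; rewrite ge0_fin_numE; last by apply: nneseries_ge0 => k _ _; exact: ge0.
apply: le_lt_trans voo.
rewrite (@nneseries_split _ _ 0 K) ?add0n; last by move=> k _; rewrite lee_fin.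
rewrite -[leLHS]add0e leeD//; first by apply: sume_ge0 => k _; rewrite lee_fin.
by apply: lee_nneseries => k *; [exact: ge0 | rewrite lee_fin; case/andP: (uv k)].
Qed.

Lemma tail_ge0 u K : dominated u -> 0 <= tail u K.
Proof.
by move=> uv; apply: fine_ge0; apply: nneseries_ge0 => k _ _; exact: ge0.
Qed.

Lemma tail_le u K : dominated u -> tail u K <= tail v K.
Proof.
have vv : dominated v by move=> k; rewrite v0 lexx.
move=> uv; rewrite fine_le ?tail_fin//.
by apply: lee_nneseries => k *; [exact: ge0 | rewrite lee_fin; case/andP: (uv k)].
Qed.

Lemma tail_split u K K1 : dominated u -> (K <= K1)%N ->
  tail u K = \sum_(K <= k < K1) u k + tail u K1.
Proof.
move=> uv KK; rewrite /tail (@nneseries_split _ _ K (K1 - K)); last first.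
  by move=> k _; exact: ge0.
by rewrite subnKC// sumEFin fineD ?tail_fin.
Qed.

Lemma tail_sum (I : finType) (P : pred I) (u : I -> nat -> R) K :
  (forall i, P i -> dominated (u i)) ->
  dominated (fun k => \sum_(i | P i) u i k) ->
  \sum_(i | P i) tail (u i) K = tail (fun k => \sum_(i | P i) u i k) K.
Proof.
move=> ui us; apply: EFin_inj; rewrite [RHS]fineK ?tail_fin// -sumEFin.
under [RHS]eq_eseriesr do rewrite -sumEFin.
rewrite nneseries_sum; last by move=> i k Pi; apply: ge0; exact: ui.
by apply: eq_bigr => i Pi; rewrite fineK// tail_fin//; exact: ui.
Qed.

Lemma tail_small (e : R) : 0 < e -> exists K0, forall u K, dominated u ->
  (K0 <= K)%N -> tail u K <= e.
Proof.
move=> e0.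
have vv : dominated v by move=> k; rewrite v0 lexx.
have H : (\sum_(K <= k <oo) (v k)%:E @[K --> \oo] --> 0)%E.
  by apply: nneseries_tail_cvg => // k _; rewrite lee_fin.
have /cvgrPdist_le/(_ e e0)[K0 _ HK] : tail v K @[K --> \oo] --> (0 : R).
  by apply: fine_cvg; exact: H.
exists K0 => u K uv KK; apply: (le_trans (tail_le K uv)).
by have := HK K KK; rewrite /= sub0r normrN ger0_norm// tail_ge0.
Qed.

End tails.

Section overlap.
Variable R : realType.
Implicit Types p q l s y : R.

(** As an increment of [clamp], the overlap telescopes over consecutive intervals. *)
Definition clamp p q y : R := Num.max p (Num.min q y).

(* The length of [[p, q]] intersected with [[l, l + s]], for [p <= q]. *)
Definition ov1 p q l s : R := clamp p q (l + s) - clamp p q l.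

Lemma clamp_mono p q y y' : y <= y' -> clamp p q y <= clamp p q y'.
Proof.
move=> yy; rewrite /clamp; case: (leP q y) => ?; case: (leP q y') => ?;
  case: (leP p q) => ?; case: (leP p y) => ?; case: (leP p y') => ?; lra.
Qed.

Lemma ov1_ge0 p q l s : 0 <= s -> 0 <= ov1 p q l s.
Proof. by move=> s0; rewrite subr_ge0 clamp_mono// lerDl. Qed.

Lemma ov1_le p q l s : p <= q -> ov1 p q l s <= q - p.
Proof.
move=> pq; rewrite /ov1 /clamp; case: (leP q l) => ?; case: (leP q (l + s)) => ?;
  case: (leP p q) => ?; case: (leP p l) => ?; case: (leP p (l + s)) => ?; lra.
Qed.

Lemma ov1_full p q l s : 0 <= s -> p <= l -> l + s <= q -> ov1 p q l s = s.
Proof.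
move=> s0 pl lq; rewrite /ov1 /clamp; case: (leP q l) => ?; case: (leP q (l + s)) => ?;
  case: (leP p q) => ?; case: (leP p l) => ?; case: (leP p (l + s)) => ?; lra.
Qed.

Lemma ov1_sum p q l s N :
  \sum_(t < N) ov1 p q (l + s * t%:R) s = ov1 p q l (s * N%:R).
Proof.
elim: N => [|N IH]; first by rewrite big_ord0 mulr0 /ov1 addr0 subrr.
rewrite big_ord_recr/= IH /ov1.
have -> : l + s * N%:R + s = l + s * N.+1%:R by rewrite -natr1; ring.
by ring.
Qed.

Definition ov n (p q l : 'I_n -> R) (s : R) : R :=
  \prod_(i < n) ov1 (p i) (q i) (l i) s.

Lemma ov_ge0 n (p q l : 'I_n -> R) (s : R) : 0 <= s -> 0 <= ov p q l s.
Proof. by move=> s0; apply: prodr_ge0 => i _; exact: ov1_ge0. Qed.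

Lemma ov_le n (p q l : 'I_n -> R) (s : R) : 0 <= s -> (forall i, p i <= q i) ->
  ov p q l s <= box_vol p q.
Proof. by move=> s0 pq; apply: ler_prod => i _; rewrite ov1_ge0// ov1_le. Qed.

Lemma ov_full n (p q l : 'I_n -> R) (s : R) : 0 <= s -> (forall i, p i <= l i) ->
  (forall i, l i + s <= q i) -> ov p q l s = s ^+ n.
Proof.
move=> s0 pl lq; rewrite /ov (eq_bigr (fun=> s)) ?prodr_const ?card_ord// => i _.
exact: ov1_full.
Qed.

Lemma ov_sum n N (p q l : 'I_n -> R) (s : R) : (0 < N)%N ->
  \sum_(g : {ffun 'I_n -> 'I_N}) ov p q (gpt l s g) (s / N%:R) = ov p q l s.
Proof.
move=> N0; rewrite /ov.
transitivity (\prod_(i < n) \sum_(t < N) ov1 (p i) (q i) (l i + s / N%:R * t%:R) (s / N%:R)).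
  by rewrite bigA_distr_bigA.
by apply: eq_bigr => i _; rewrite ov1_sum divfK// pnatr_eq0 -lt0n.
Qed.

(** The inflated volume is a polynomial in [t], hence continuous at 0. *)
Lemma box_vol_inflate n (p q : 'I_n -> R) (e : R) : 0 < e ->
  exists2 t, 0 < t &
    box_vol (fun i => p i - t) (fun i => q i + t) <= box_vol p q + e.
Proof.
move=> e0.
pose P : {poly R} := \prod_(i < n) ((q i - p i)%:P + 2%:P * 'X).
have PE t : P.[t] = box_vol (fun i => p i - t) (fun i => q i + t).
  rewrite /P horner_prod /box_vol; apply: eq_bigr => i _.
  by rewrite !hornerE; ring.
have P0 : P.[0] = box_vol p q.
  by rewrite PE /box_vol; apply: eq_bigr => i _; rewrite subr0 addr0.
have /cvgrPdist_le/(_ e e0)/nbhs_ballP[d /= d0 Hd] := @continuous_horner R P 0.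
exists (d / 2); first by rewrite divr_gt0.
have := Hd (d / 2); rewrite /ball/= sub0r normrN gtr0_norm ?divr_gt0//.
rewrite ltr_pdivrMr// mulr_natr mulr2n ltrDl => /(_ d0).
rewrite P0 -PE ler_norml => /andP[h _]; lra.
Qed.

End overlap.

(** * Nested cubes avoiding a cover *)

Lemma gpt_cell (R : realType) n N (l : 'I_n -> R) (r : R) (g : {ffun 'I_n -> 'I_N}) i :
  (0 < N)%N -> 0 < r ->
  l i <= gpt l r g i /\ gpt l r g i + r / N%:R <= l i + r.
Proof.
move=> N0 r0; have NR0 : 0 < N%:R :> R by rewrite ltr0n.
rewrite /gpt lerDl mulr_ge0 ?divr_ge0 ?(ltW r0)//; split => //.
rewrite -addrA lerD2l -{2}[r / _]mulr1 -mulrDr natr1 mulrAC ler_pdivrMr//.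
by rewrite ler_pM2l// ler_nat.
Qed.

Lemma sum_lt_exists (R : realType) (I : finType) (f h : I -> R) :
  \sum_i f i < \sum_i h i -> exists i, f i < h i.
Proof.
move=> fh; apply/existsP; apply: contraLR fh => /existsPn no.
by rewrite -leNgt; apply: ler_sum => i _; rewrite leNgt no.
Qed.

Section nested.
Variables (R : realType) (n : nat) (psi : R -> R) (c delta : R).
Variables (p q : nat -> 'I_n -> R) (e v : nat -> R).
Hypotheses (c0 : 0 < c) (e0 : forall k, 0 < e k) (delta1 : delta < 1).
Hypothesis pq : forall k i, p k i <= q k i.
Hypothesis voo : (\sum_(0 <= k <oo) (v k)%:E < +oo)%E.
Hypothesis density : forall (l : 'I_n -> R) r h0, 0 < r ->
    (forall i, delta <= l i) -> (forall i, l i + r <= 1) ->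
    exists2 N, (0 < N)%N & c * (N ^ n)%:R <=
      #|[pred g : {ffun 'I_n -> 'I_N} |
          `[< in_slab psi h0 (gpt l r g) (r / N%:R) >] ]|%:R.

Let ovk (l : 'I_n -> R) (r : R) (k : nat) : R :=
  ov (fun i => p k i - e k) (fun i => q k i + e k) l r.

Hypothesis volE : forall k, box_vol (fun i => p k i - e k) (fun i => q k i + e k) <= v k.

Let cell_vol_sum (N : nat) (r : R) : (0 < N)%N ->
  \sum_(g : {ffun 'I_n -> 'I_N}) (r / N%:R) ^+ n = r ^+ n.
Proof.
move=> N0; rewrite sumr_const card_ffun !card_ord -[LHS]mulr_natl natrX -exprMn.
by rewrite mulrC divfK// pnatr_eq0 -lt0n.
Qed.

Let ovk_dom l r : 0 < r -> dominated v (ovk l r).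
Proof.
move=> r0 k; rewrite ov_ge0 ?(ltW r0)//=; apply: le_trans (volE k).
apply: ov_le; first exact: ltW.
by move=> i; have := e0 k; have := pq k i; lra.
Qed.

Let v0 k : 0 <= v k.
Proof. by have /andP[h1 h2] := @ovk_dom (fun=> 0) 1 ltr01 k; exact: le_trans h2. Qed.

Let ovk_cells N l r : (0 < N)%N ->
  (fun k => \sum_(g : {ffun 'I_n -> 'I_N}) ovk (gpt l r g) (r / N%:R) k) = ovk l r.
Proof. by move=> N0; apply/funext => k; exact: ov_sum. Qed.

Let tail_cells N l r K : (0 < N)%N -> 0 < r ->
  \sum_(g : {ffun 'I_n -> 'I_N}) tail (ovk (gpt l r g) (r / N%:R)) K = tail (ovk l r) K.
Proof.
move=> N0 r0; rewrite -(ovk_cells l r N0).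
apply: (tail_sum v0 voo) => [g _|].
  by apply: ovk_dom; rewrite divr_gt0// ltr0n.
by rewrite ovk_cells//; exact: ovk_dom.
Qed.

Record cube := Cube { lo : 'I_n -> R; side : R; idx : nat }.

(** The boxes of index at least [idx s] leave room in the cube; those of smaller index have already
    been avoided. *)
Definition admissible (s : cube) : Prop :=
  [/\ 0 < side s, (forall i, delta <= lo s i), (forall i, lo s i + side s <= 1)
    & tail (ovk (lo s) (side s)) (idx s) < side s ^+ n].

Definition refines (h0 : nat) (s t : cube) : Prop :=
  [/\ (idx s < idx t)%N, (forall i, lo s i <= lo t i),
      (forall i, lo t i + side t <= lo s i + side s),
      in_slab psi h0 (lo t) (side t)
    & forall k x, (idx s <= k < idx t)%N ->
        (forall i, lo t i <= x i <= lo t i + side t) -> ~ box (p k) (q k) x].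

(** Two subdivisions. The cells of the first have side at most [e k] for all relevant [k]: one that
    meets box [k] lies in its inflation, so an overlap smaller than the cell means that the box is
    missed. The second uses [density] inside a cell whose tail is below [c] times its volume. *)
Lemma refine h0 s : admissible s -> exists2 t, admissible t & refines h0 s t.
Proof.
case: s => l r K [/= r0 ld lr dlt].
set d := tail _ K in dlt.
have gap : 0 < c / 2 * (r ^+ n - d) by rewrite mulr_gt0 ?divr_gt0 ?subr_gt0.
have [K2 HK2] := tail_small v0 voo (divr_gt0 gap (ltr0n R 2)).
pose K1 := maxn K.+1 K2.
have KK1 : (K < K1)%N by rewrite leq_maxl.
have dK1 : tail (ovk l r) K1 < c / 2 * (r ^+ n - d).
  have h : tail (ovk l r) K1 <= c / 2 * (r ^+ n - d) / 2.
    apply: HK2; [exact: ovk_dom | exact: leq_maxr].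
  lra.
(* The sum exceeds each of its terms, hence [r / e k] for every [k < K1]. *)
pose N1 := (\sum_(k < K1) (Num.truncn (r / e k)).+1).+1.
have N1R : 0 < N1%:R :> R by rewrite ltr0n.
have N1e k : (k < K1)%N -> r / N1%:R <= e k.
  move=> kK; rewrite ler_pdivrMr// mulrC -ler_pdivrMr//.
  apply: (le_trans (ltW (truncnS_gt _))); rewrite ler_nat.
  by rewrite /N1 (bigD1 (Ordinal kK))//= -addSn leqW// -addSn leq_addr.
(* One average serves two purposes: boxes [K <= k < K1] must miss the cell, and later ones must have
   density below [c / 2] in it, hence the weight [(c / 2)^-1]. *)
have [g1 Hg1] : exists g1 : {ffun 'I_n -> 'I_N1},
    \sum_(K <= k < K1) ovk (gpt l r g1) (r / N1%:R) k +
    (c / 2)^-1 * tail (ovk (gpt l r g1) (r / N1%:R)) K1 < (r / N1%:R) ^+ n.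
  apply: sum_lt_exists; rewrite cell_vol_sum// big_split/= -mulr_sumr tail_cells//.
  rewrite exchange_big/=.
  have -> : \sum_(K <= k < K1) \sum_(g : {ffun 'I_n -> 'I_N1}) ovk (gpt l r g) (r / N1%:R) k =
      \sum_(K <= k < K1) ovk l r k.
    by apply: eq_bigr => k _; rewrite -[RHS](congr1 (fun f => f k) (@ovk_cells N1 l r _)).
  have -> : \sum_(K <= k < K1) ovk l r k = d - tail (ovk l r) K1.
    by rewrite /d (tail_split v0 voo (ovk_dom _ r0) (ltnW KK1)) addrK.
  have t0 : 0 <= tail (ovk l r) K1 by apply: (tail_ge0 (v := v)); exact: ovk_dom.
  have : (c / 2)^-1 * tail (ovk l r) K1 < r ^+ n - d.
    by rewrite ltr_pdivrMl ?divr_gt0.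
  lra.
set l1 := gpt l r g1 in Hg1; set r1 := r / N1%:R in N1e Hg1.
have r10 : 0 < r1 by rewrite divr_gt0.
have l1c i : l i <= l1 i /\ l1 i + r1 <= l i + r by exact: gpt_cell.
have l1d i : delta <= l1 i by apply: (le_trans (ld i)); case: (l1c i).
have l1r i : l1 i + r1 <= 1 by apply: le_trans (lr i); case: (l1c i).
have ov10 k : 0 <= ovk l1 r1 k by rewrite ov_ge0// ltW.
have t10 : 0 <= tail (ovk l1 r1) K1 by apply: (tail_ge0 (v := v)); exact: ovk_dom.
have c2 : 0 < c / 2 by rewrite divr_gt0.
have avoid k x : (K <= k < K1)%N -> (forall i, l1 i <= x i <= l1 i + r1) ->
    ~ box (p k) (q k) x.
  move=> /andP[Kk kK] xl bx.
  have re := N1e _ kK.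
  have full : ovk l1 r1 k = r1 ^+ n.
    apply: ov_full => [|i|i]; first exact: ltW.
      by have /andP[a1 a2] := xl i; have /andP[b1 b2] := bx i; lra.
    by have /andP[a1 a2] := xl i; have /andP[b1 b2] := bx i; lra.
  have : ovk l1 r1 k <= \sum_(K <= k < K1) ovk l1 r1 k.
    rewrite (big_rem k) ?mem_index_iota ?Kk//= lerDl.
    by apply: sumr_ge0.
  have : 0 <= (c / 2)^-1 * tail (ovk l1 r1) K1 by rewrite mulr_ge0 ?invr_ge0 ?(ltW c2).
  rewrite full; lra.
have t1 : tail (ovk l1 r1) K1 < c * r1 ^+ n.
  have : (c / 2)^-1 * tail (ovk l1 r1) K1 < r1 ^+ n.
    have : 0 <= \sum_(K <= k < K1) ovk l1 r1 k by apply: sumr_ge0.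
    lra.
  rewrite ltr_pdivrMl//; have : 0 < c * r1 ^+ n by rewrite mulr_gt0 ?exprn_gt0.
  lra.
have [N2 N20 HN2] := density h0 r10 l1d l1r.
have N2R : 0 < N2%:R :> R by rewrite ltr0n.
have r20 : 0 < r1 / N2%:R by rewrite divr_gt0.
(* The cells inside slabs have total volume at least [c * r1 ^ n], more than the tail, so some of
   them has room left. *)
have [g2 g2s g2t] : exists2 g2 : {ffun 'I_n -> 'I_N2},
    `[< in_slab psi h0 (gpt l1 r1 g2) (r1 / N2%:R) >] &
    tail (ovk (gpt l1 r1 g2) (r1 / N2%:R)) K1 < (r1 / N2%:R) ^+ n.
  apply/exists_inP; apply: contraLR t1 => /exists_inPn no.
  rewrite -leNgt -(tail_cells l1 K1 N20 r10).
  set G := [pred g | _] in HN2.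
  apply: (@le_trans _ _ (\sum_(g : {ffun 'I_n -> 'I_N2} | g \in G) (r1 / N2%:R) ^+ n)).
    rewrite sumr_const -[leRHS]mulr_natl (expr_div_n r1 N2%:R) mulrCA [leLHS]mulrC.
    apply: ler_wpM2l; first by rewrite exprn_ge0// ltW.
    by rewrite -natrX ler_pdivlMr// ltr0n expn_gt0 N20.
  rewrite big_mkcond; apply: ler_sum => g _; case: ifP => [gG|_].
    by rewrite leNgt no.
  by apply: (tail_ge0 (v := v)); exact: ovk_dom.
have l2c i : l1 i <= gpt l1 r1 g2 i /\ gpt l1 r1 g2 i + r1 / N2%:R <= l1 i + r1.
  exact: gpt_cell.
exists (Cube (gpt l1 r1 g2) (r1 / N2%:R) K1).
  split => //= i; have [a1 a2] := l1c i; have [b1 b2] := l2c i; have := ld i; have := lr i; lra.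
split => //=.
- by move=> i; have [a1 a2] := l1c i; have [b1 b2] := l2c i; lra.
- by move=> i; have [a1 a2] := l1c i; have [b1 b2] := l2c i; lra.
- exact/asboolP.
- move=> k x kK xl; apply: avoid => // i.
  by have [b1 b2] := l2c i; have /andP[] := xl i; lra.
Qed.

(** Dependent choice: step [j] asks for height at least [j], so the heights are unbounded, and the
    indices increase strictly, so every box is passed, and avoided, at some step. The point is the
    supremum of the lower corners. *)
Lemma nested_point : tail (ovk (fun=> delta) (1 - delta)) 0 < (1 - delta) ^+ n ->
  exists x : 'I_n -> R,
  [/\ forall i, delta <= x i <= 1, forall k, ~ box (p k) (q k) x &
      forall h0, exists (a : 'I_n -> nat) b, (h0 <= height a)%N /\
        `|sdot a x - (b ^ 2)%:R| < psi (height a)%:R].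
Proof.
move=> start.
pose s0 := Cube (fun=> delta) (1 - delta) 0.
have a0 : admissible s0 by split => //= [|i]; have := delta1; lra.
pose T := {s | admissible s}.
have step (h0 : nat) (s : T) : {t : T | refines h0 (sval s) (sval t)}.
  apply: cid; have [t at_ st] := refine h0 (svalP s).
  by exists (exist _ t at_).
pose F := fix F j : T := if j is j'.+1 then sval (step j' (F j')) else exist _ s0 a0.
have FR j : refines j (sval (F j)) (sval (F j.+1)) by rewrite /=; case: (step _ _).
pose lj j := lo (sval (F j)); pose rj j := side (sval (F j)).
have rj0 j : 0 < rj j by have [] := svalP (F j).
have mono_l i a b : (a <= b)%N -> lj a i <= lj b i.
  move=> ab; rewrite -(subnKC ab); elim: (b - a)%N => [|k IH]; first by rewrite addn0.
  by rewrite addnS; apply: (le_trans IH); have [_ + _ _ _] := FR (a + k)%N; apply.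
have mono_u i a b : (a <= b)%N -> lj b i + rj b <= lj a i + rj a.
  move=> ab; rewrite -(subnKC ab); elim: (b - a)%N => [|k IH]; first by rewrite addn0.
  by rewrite addnS; apply: le_trans IH; have [_ _ + _ _] := FR (a + k)%N; apply.
have lu i a b : lj a i <= lj b i + rj b.
  have := mono_l i _ _ (leq_maxl a b); have := mono_u i _ _ (leq_maxr a b).
  by have := rj0 (maxn a b); lra.
pose x i := sup (range (fun j => lj j i)).
have hs i : has_sup (range (fun j => lj j i)).
  split; first by exists (lj 0%N i); exists 0%N.
  by exists (lj 0%N i + rj 0%N) => _ [a _ <-]; exact: lu.
have xj j i : lj j i <= x i <= lj j i + rj j.
  apply/andP; split.
    by apply: sup_upper_bound => //; exists j.
  apply: ge_sup; first by exists (lj 0%N i); exists 0%N.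
  by move=> _ [a _ <-]; exact: lu.
exists x; split.
- by move=> i; have := xj 0%N i; rewrite /lj /rj/=; have -> : delta + (1 - delta) = 1 by ring.
- have idxj j : (j <= idx (sval (F j)))%N.
    by elim: j => // j IH; apply: leq_ltn_trans IH _; have [] := FR j.
  move=> k.
  have [j /andP[j1 j2]] : exists j, (idx (sval (F j)) <= k < idx (sval (F j.+1)))%N.
    have [J HJ] : exists J, (k < idx (sval (F J)))%N by exists k.+1; exact: idxj.
    elim: J HJ => [|j IH] h; first by [].
    case: (leqP (idx (sval (F j))) k) => [h1|/IH//].
    by exists j; rewrite h1.
  have [_ _ _ _ H] := FR j; apply: (H k x); first by rewrite j1.
  by move=> i; exact: xj.
- move=> h0; have [_ _ _ [a [b [ha hb]]] _] := FR h0.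
  by exists a, b; split => //; apply: hb => i; exact: xj.
Qed.

End nested.

(** * Covering the slabs of a given height *)

Lemma term_le_sum (R : realType) (I : finType) (P : pred I) (F : I -> R) i :
  (forall j, 0 <= F j) -> P i -> F i <= \sum_(j | P j) F j.
Proof. by move=> F0 Pi; rewrite (bigD1 i)//= lerDl sumr_ge0. Qed.

Lemma grid_index (R : realType) N (x : R) : (0 < N)%N -> 0 <= x <= 1 ->
  exists t : 'I_N, t%:R / N%:R <= x <= t.+1%:R / N%:R.
Proof.
move=> N0 /andP[x0 x1]; have NR0 : 0 < N%:R :> R by rewrite ltr0n.
have Nx0 : 0 <= x * N%:R by rewrite mulr_ge0.
have /andP[h1 h2] := truncn_itv Nx0.
have [tN|Nt] := ltnP (Num.truncn (x * N%:R)) N.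
  by exists (Ordinal tN); rewrite ler_pdivrMr// ler_pdivlMr// h1 ltW.
(* Only [x = 1] gets here; it belongs to the last cell. *)
have tN : (N.-1 < N)%N by rewrite prednK.
exists (Ordinal tN) => /=; rewrite prednK// divff ?lt0r_neq0// x1 andbT.
rewrite ler_pdivrMr//; apply: le_trans h1; rewrite ler_nat.
by apply: leq_trans Nt; exact: leq_pred.
Qed.

Section height_cover.
Variables (R : realType) (m : nat) (psi : R -> R) (P : nat).
Local Notation n := m.+2.

(** [n] positions of a maximal entry, at most [(2 h) ^ m.+1] choices of the others, at most
    [(n + P).+1 * h] values of [b], and grid density at most [8 psi / h ^ 2] for each slab. *)
Definition kcover : R := (8 * n * 2 ^ m.+1 * (n + P).+1)%:R.

(* The boxes meeting the slabs of height [h] are cells of a fine grid, counted along a coordinate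
   in which [a] is maximal. *)
Lemma height_cover h : (0 < h)%N -> 0 < psi h%:R -> psi h%:R <= P%:R ->
  exists N (G : pred {ffun 'I_n -> 'I_N}),
  [/\ (0 < N)%N,
      #|G|%:R <= kcover * (h%:R ^+ m * psi h%:R) * (N ^ n)%:R &
      forall (x : 'I_n -> R) (a : 'I_n -> nat) b, (forall i, 0 <= x i <= 1) ->
        height a = h -> `|sdot a x - (b ^ 2)%:R| < psi h%:R ->
        exists2 g, G g & forall i, gpt (fun=> 0) 1 g i <= x i <= gpt (fun=> 0) 1 g i + N%:R^-1].
Proof.
move=> h0 psi0 psiP; set d := psi h%:R.
have hR0 : 0 < h%:R :> R by rewrite ltr0n.
have h20 : 0 < h%:R ^+ 2 :> R by rewrite exprn_gt0.
pose N := (Num.truncn (n%:R * h%:R ^+ 2 / d)).+1.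
have N0 : (0 < N)%N by [].
have NR0 : 0 < N%:R :> R by rewrite ltr0n.
have Nd : n%:R * h%:R ^+ 2 <= N%:R * d.
  by rewrite -ler_pdivrMr// ltW// truncnS_gt.
(* [b ^ 2 <= n h ^ 2 + P h ^ 2 <= ((n + P) h) ^ 2]. Below, the width is doubled to pass from a point
   to the corner of its cell. *)
pose B := ((n + P) * h).+1.
pose hitg (a : {ffun 'I_n -> 'I_h.+1}) (b : 'I_B) (g : {ffun 'I_n -> 'I_N}) : bool :=
  hit (2 * d) (sdot (fun i => a i : nat) (gpt (fun=> 0) 1 g)) b.
pose G : pred {ffun 'I_n -> 'I_N} := fun g =>
  [exists i, exists a : {ffun 'I_n -> 'I_h.+1}, exists b : 'I_B,
     (nat_of_ord (a i) == h) && hitg a b g].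
exists N, G; split=> //.
- have one : forall i (a : {ffun 'I_n -> 'I_h.+1}) b, nat_of_ord (a i) == h ->
      \sum_g (hitg a b g)%:R <= 8 * d / h%:R ^+ 2 * (N ^ n)%:R :> R.
    move=> i a b /eqP aih.
    have H := @sum_le_fibre R 'I_n 'I_N (fun g => (hitg a b g)%:R) i.
    rewrite !card_ord in H; apply: H => // g.
    pose L := 4 * d * N%:R / h%:R ^+ 2.
    have L1 : 1 <= L.
      rewrite ler_pdivlMr// mul1r.
      have : h%:R ^+ 2 <= n%:R * h%:R ^+ 2 :> R by rewrite ler_peMl ?(ltW h20)// ler1n.
      have : 0 < N%:R * d by rewrite mulr_gt0.
      by move: Nd; lra.
    apply: (@le_trans _ _ (L + 1)); last first.
      have -> : 8 * d / h%:R ^+ 2 * N%:R = L + L by rewrite /L; ring.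
      by rewrite lerD2l.
    apply: sum_card_diam; first lra.
    move=> s t /hitP[s1 s2] /hitP[t1 t2] _; rewrite ler_pdivlMr//.
    move: s1 s2 t1 t2; rewrite !sdot_upd aih !natrX mulr0 add0r.
    set S := \sum_(k | _) _ => s1 s2 t1 t2.
    have : h%:R ^+ 2 * (1 / N%:R * t%:R) - h%:R ^+ 2 * (1 / N%:R * s%:R) <= 4 * d by lra.
    have -> : h%:R ^+ 2 * (1 / N%:R * t%:R) - h%:R ^+ 2 * (1 / N%:R * s%:R) =
      (t%:R - s%:R) * h%:R ^+ 2 / N%:R :> R by ring.
    by rewrite ler_pdivrMr.
  have cardA i : \sum_(a : {ffun 'I_n -> 'I_h.+1}) (nat_of_ord (a i) == h)%:R
      <= h.+1%:R ^+ m.+1 :> R.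
    have H := @sum_le_fibre R 'I_n 'I_h.+1 (fun a => (nat_of_ord (a i) == h)%:R) i (h.+1%:R)^-1.
    rewrite !card_ord in H.
    have -> : h.+1%:R ^+ m.+1 = h.+1%:R^-1 * (h.+1 ^ n)%:R :> R.
      by rewrite natrX [in RHS]exprS mulKf ?pnatr_eq0.
    apply: H => // g; rewrite mulVf ?pnatr_eq0//.
    rewrite (bigD1 ord_max)//= updE eqxx big1 ?addr0// => t tmax.
    by rewrite updE; move: tmax; rewrite -val_eqE/= => /negbTE ->.
  pose c : R := 8 * d / h%:R ^+ 2 * (N ^ n)%:R.
  have c0 : 0 <= c by rewrite mulr_ge0// divr_ge0 ?(ltW h20)// mulr_ge0// ltW.
  have : #|G|%:R <= \sum_(i : 'I_n) \sum_(a : {ffun 'I_n -> 'I_h.+1} | nat_of_ord (a i) == h)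
      \sum_(b < B) \sum_g (hitg a b g)%:R :> R.
    rewrite -sum1_card natr_sum big_mkcond.
    apply: (@le_trans _ _ (\sum_g \sum_(i : 'I_n)
       \sum_(a : {ffun 'I_n -> 'I_h.+1} | nat_of_ord (a i) == h) \sum_(b < B) (hitg a b g)%:R)).
      apply: ler_sum => g _; case: ifP => [|_]; last first.
        by apply: sumr_ge0 => i _; apply: sumr_ge0 => a _; apply: sumr_ge0.
      move=> /existsP[i /existsP[a /existsP[b /andP[ai hb]]]].
      apply: (@le_trans _ _ (\sum_(b < B) (hitg a b g)%:R)).
        by rewrite (bigD1 b)//= hb lerDl sumr_ge0.
      apply: le_trans (@term_le_sum R _ xpredT _ i _ _) => //; last first.
        by move=> j; apply: sumr_ge0 => a' _; apply: sumr_ge0.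
      by apply: (@term_le_sum R _ _ (fun a => \sum_(b < B) (hitg a b g)%:R)) => // j;
        apply: sumr_ge0.
    rewrite exchange_big/= le_eqVlt; apply/orP; left; apply/eqP.
    apply: eq_bigr => i _; rewrite exchange_big/=; apply: eq_bigr => a _.
    by rewrite exchange_big.
  move/le_trans; apply.
  apply: (@le_trans _ _ (\sum_(i : 'I_n) h.+1%:R ^+ m.+1 * (B%:R * c))).
    apply: ler_sum => i _.
    apply: (@le_trans _ _ (\sum_(a : {ffun 'I_n -> 'I_h.+1})
        (nat_of_ord (a i) == h)%:R * (B%:R * c))).
      rewrite big_mkcond; apply: ler_sum => a _; case: ifP => [ai|_]; last by rewrite mul0r.
      rewrite mul1r mulr_natl -[X in _ *+ X]card_ord -sumr_const.
      by apply: ler_sum => b _; exact: one ai.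
    by rewrite -mulr_suml ler_wpM2r// mulr_ge0.
  rewrite sumr_const card_ord -[leLHS]mulr_natl.
  have hh : h.+1%:R ^+ m.+1 <= 2 ^+ m.+1 * h%:R ^+ m.+1 :> R.
    rewrite -exprMn lerXn2r ?nnegrE ?mulr_ge0//.
    by rewrite -natrM ler_nat mul2n -addnn -addn1 leq_add2l.
  have BB : B%:R <= (n + P).+1%:R * h%:R :> R.
    by rewrite -natrM ler_nat /B mulSn -add1n leq_add2r.
  apply: (@le_trans _ _ (n%:R * (2 ^+ m.+1 * h%:R ^+ m.+1 * ((n + P).+1%:R * h%:R * c)))).
    apply: ler_wpM2l => //; apply: ler_pM => //.
      by rewrite mulr_ge0.
    exact: ler_wpM2r.
  rewrite le_eqVlt; apply/orP; left; apply/eqP.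
  rewrite /c /kcover !natrM [(2 ^ m.+1)%:R]natrX [h%:R ^+ m.+1]exprS -/d.
  move: (2 ^+ m.+1 : R) (h%:R ^+ m : R) ((N ^ n)%:R : R) ((n + P).+1%:R : R) (n%:R : R).
  by move=> x y z t w; field; rewrite lt0r_neq0.
- move=> x a b x01 ha hb.
  have ah i : (a i <= h)%N by rewrite -ha; exact: leq_bigmax.
  have [i ai] : exists i, a i = h.
    have [i _ ai] := @eq_bigmax_cond _ xpredT a ltac:(by rewrite card_ord).
    by exists i; rewrite -ha /height ai.
  have [t tP] := choice (fun i => grid_index N0 (x01 i)).
  pose g : {ffun 'I_n -> 'I_N} := [ffun i => t i].
  have gx j : gpt (fun=> 0) 1 g j <= x j <= gpt (fun=> 0) 1 g j + N%:R^-1.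
    have := tP j; rewrite /gpt ffunE add0r -natr1 mulrDl !mul1r.
    by rewrite [_^-1 * _]mulrC.
  exists g => //; apply/existsP; exists i.
  pose a' : {ffun 'I_n -> 'I_h.+1} := [ffun i => inord (a i)].
  have aE j : nat_of_ord (a' j) = a j by rewrite ffunE inordK ?ltnS.
  apply/existsP; exists a'.
  have hN : n%:R * h%:R ^+ 2 * N%:R^-1 <= d by rewrite ler_pdivrMr// [leRHS]mulrC.
  have hR1 : 1 <= h%:R :> R by rewrite ler1n.
  have bB : (b < B)%N.
    rewrite ltnS -(ler_nat R) -(@ler_pXn2r _ 2%N) ?nnegrE//.
    have s1 : sdot a x <= n%:R * h%:R ^+ 2.
      rewrite mulr_natl -[X in _ *+ X]card_ord -sumr_const.
      apply: ler_sum => j _; have /andP[xj0 xj1] := x01 j.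
      apply: (@le_trans _ _ ((a j ^ 2)%:R)); first by rewrite ler_piMr.
      by rewrite natrX lerXn2r ?nnegrE// ler_nat.
    move: hb; rewrite natrX ltr_norml => /andP[hb1 _].
    have : b%:R ^+ 2 <= n%:R * h%:R ^+ 2 + P%:R * h%:R ^+ 2 :> R.
      have : P%:R <= P%:R * h%:R ^+ 2 :> R by rewrite ler_peMr// exprn_ege1.
      move: psiP hb1 s1; rewrite -/d; lra.
    move/le_trans; apply; rewrite -mulrDl -natrD natrM exprMn ler_wpM2r//.
    by rewrite expr2 -natrM ler_nat leq_pmulr.
  apply/existsP; exists (Ordinal bB).
  rewrite aE ai eqxx /hitg /hit/=.
  have -> : (fun i => a' i : nat) = a by apply/funext => j; rewrite aE.
  have := sdot_cell ah gx.
  have -> : sdot a (gpt (fun=> 0) 1 g) - (b ^ 2)%:R =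
     - (sdot a x - sdot a (gpt (fun=> 0) 1 g)) + (sdot a x - (b ^ 2)%:R) by ring.
  move=> c1; apply: (le_lt_trans (ler_normD _ _)); rewrite normrN.
  by move: hb; rewrite -/d; lra.
Qed.

End height_cover.

(** * Outer measure of W *)

Section outer.
Variables (R : realType) (n : nat).
Hypothesis n0 : (0 < n)%N.

Lemma outer_le_cover (A : set ('I_n -> R)) (S : nat -> seq ('I_n -> R)) (s : nat -> R) (e : R) :
  (forall h, 0 <= s h) ->
  (forall x, A x -> exists h j, (j < size (S h))%N /\
     forall i, nth (fun=> 0) (S h) j i <= x i <= nth (fun=> 0) (S h) j i + s h) ->
  (forall H, \sum_(h < H) (size (S h))%:R * s h ^+ n <= e) ->
  (lebesgue_outer A <= e%:E)%E.
Proof.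
move=> s0 AS Se.
pose lo (k : nat) : 'I_n -> R :=
  if (pickle_inv k : option (nat * nat)) is Some hj then nth (fun=> 0) (S hj.1) hj.2 else fun=> 0.
(* Codes of no pair, or of a pair beyond the end of its list, get a degenerate box, of volume 0
   since [0 < n]. *)
pose si (k : nat) : R :=
  if (pickle_inv k : option (nat * nat)) is Some hj then
    (if (hj.2 < size (S hj.1))%N then s hj.1 else 0) else 0.
have si0 k : 0 <= si k by rewrite /si; case: (pickle_inv k) => // hj; case: ifP.
have volE k : box_vol (lo k) (fun i => lo k i + si k) = si k ^+ n.
  rewrite /box_vol -[in RHS](card_ord n) -prodr_const; apply: eq_bigr => i _.
  by rewrite addrC addKr.
apply: (@le_trans _ _ (\sum_(0 <= k <oo) (box_vol (lo k) (fun i => lo k i + si k))%:E)%E).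
  apply: ereal_inf_lbound; exists lo, (fun k i => lo k i + si k); split => //.
    by move=> k i; rewrite lerDl.
  move=> x /AS[h [j [jS hx]]]; exists (pickle (h, j)) => // i.
  by rewrite /lo /si pickleK_inv/= jS; exact: hx.
apply: lime_le.
  by apply: is_cvg_nneseries => k _ _; rewrite lee_fin volE exprn_ge0.
apply: nearW => K; rewrite sumEFin lee_fin big_mkord.
under eq_bigr do rewrite volE.
(* [H] exceeds the first component of every pair coded below [K], so the first [K] non-degenerate
   boxes come from the lists [S h] with [h < H]. *)
pose H := (\max_(k < K) (if (pickle_inv k : option (nat * nat)) is Some hj then hj.1 else 0)).+1.
apply: le_trans (Se H).
apply: (@le_trans _ _ (\sum_(k < K) \sum_(h < H) \sum_(j < size (S h))
    (pickle (h : nat, j : nat) == k)%:R * s h ^+ n)).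
  apply: ler_sum => k _; have T0 (h : 'I_H) : 0 <= \sum_(j < size (S h))
      (pickle (h : nat, j : nat) == k)%:R * s h ^+ n.
    by apply: sumr_ge0 => j _; rewrite mulr_ge0 ?exprn_ge0.
  have zero : 0 ^+ n <= \sum_(h < H) \sum_(j < size (S h))
      (pickle (h : nat, j : nat) == k)%:R * s h ^+ n.
    by rewrite expr0n (gtn_eqF n0); apply: sumr_ge0 => h _.
  rewrite /si; case E : (pickle_inv k : option (nat * nat)) => [[h j]|]//=.
  case: ifP => // jS.
  have hH : (h < H)%N.
    have := @leq_bigmax _ (fun k : 'I_K =>
      if (pickle_inv k : option (nat * nat)) is Some hj then hj.1 else 0) k.
    by rewrite E /H ltnS.
  apply: le_trans (term_le_sum (P := xpredT) (i := Ordinal hH) T0 isT).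
  rewrite (bigD1 (Ordinal jS))//= ler_wpDr//.
    by apply: sumr_ge0 => j' _; rewrite mulr_ge0 ?exprn_ge0.
  have -> : pickle (h, j) = k by have := @pickle_invK (nat * nat)%type k; rewrite E.
  by rewrite eqxx mul1r.
rewrite exchange_big/=; apply: ler_sum => h _.
rewrite exchange_big/= mulr_natl -[X in _ *+ X]card_ord -sumr_const.
apply: ler_sum => j _; rewrite -mulr_suml ler_piMl ?exprn_ge0// -[leRHS]add0r.
apply: sum_card_diam => // k k' /eqP <- /eqP <- _.
by rewrite subrr.
Qed.

Lemma outer_ge0 (A : set ('I_n -> R)) : (0 <= lebesgue_outer A)%E.
Proof.
apply: le_ereal_inf_tmp => _ [a [b [ab _ ->]]].
apply: nneseries_ge0 => k _ _; rewrite lee_fin; apply: prodr_ge0 => i _.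
by rewrite subr_ge0.
Qed.

Lemma outer_unit_cube (A : set ('I_n -> R)) :
  (forall x, A x -> forall i, 0 <= x i <= 1) -> (lebesgue_outer A <= 1%:E)%E.
Proof.
move=> A01.
apply: (@outer_le_cover A (fun h => if h is 0 then [:: fun=> 0] else [::]) (fun=> 1)).
- by [].
- by move=> x /A01 x01; exists 0, 0; split => // i; rewrite /= add0r.
- move=> H; rewrite expr1n.
  under eq_bigr do rewrite mulr1.
  case: H => [|H]; first by rewrite big_ord0.
  by rewrite big_ord_recl/= big1 ?addr0.
Qed.

End outer.

Lemma bernoulli_ineq (R : realType) (d : R) k : 0 <= d <= 1 -> 1 - k%:R * d <= (1 - d) ^+ k.
Proof.
move=> /andP[d0 d1]; elim: k => [|k IH]; first by rewrite expr0 mul0r subr0.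
have d1' : 0 <= 1 - d by lra.
rewrite exprS; apply: le_trans (ler_wpM2l d1' IH).
rewrite -natr1; have : 0 <= k%:R * d * d by rewrite !mulr_ge0.
lra.
Qed.

Section measure_of_W.
Variables (R : realType) (m : nat) (psi : R -> R).
Hypothesis psi0 : forall h, 0 < h -> 0 < psi h.
Hypothesis psi_dec : forall x y, 0 < x -> x <= y -> psi y <= psi x.

Let height_gt0 (a : 'I_m.+2 -> nat) : a <> (fun=> 0%N) -> (0 < height a)%N.
Proof.
move=> a0; rewrite lt0n; apply/negP => /eqP h; apply: a0; apply/funext => i.
by apply/eqP; rewrite -leqn0 -h; exact: leq_bigmax.
Qed.

(** Below a given height there are finitely many [a], and for each the inequality bounds [b];
    infinitely many pairs therefore include arbitrarily large heights. *)
Lemma W_unbounded_height x h0 : @W R m.+2 psi x ->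
  exists (a : 'I_m.+2 -> nat) b, [/\ (h0 <= height a)%N, (0 < height a)%N &
    `|sdot a x - (b ^ 2)%:R| < psi (height a)%:R].
Proof.
case=> x01; set E := [set _ | _] => infE.
have [//|no] := pselect (exists (a : 'I_m.+2 -> nat) b, [/\ (h0 <= height a)%N, (0 < height a)%N &
    `|sdot a x - (b ^ 2)%:R| < psi (height a)%:R]).
exfalso; apply: infE.
pose B := (Num.truncn (m.+2%:R * h0%:R ^+ 2 + psi 1 : R)).+1.
pose f (u : {ffun 'I_m.+2 -> 'I_h0.+1} * 'I_B) : ('I_m.+2 -> nat) * nat :=
  ((fun i => u.1 i : nat), u.2 : nat).
apply: (@sub_finite_set _ _ (f @` setT)); last first.
  by apply: finite_image; exact: finite_finset.
move=> [a b] [/= a0 hab].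
have ha := height_gt0 a0.
have hh : (height a < h0)%N.
  by rewrite ltnNge; apply/negP => h; apply: no; exists a, b.
have ah i : (a i <= h0)%N by apply: leq_trans (ltnW hh); exact: leq_bigmax.
have bB : (b < B)%N.
  rewrite ltnS truncn_ge_nat; last first.
    by rewrite addr_ge0 ?mulr_ge0 ?exprn_ge0// ltW// psi0.
  apply: (@le_trans _ _ ((b ^ 2)%:R)).
    by rewrite ler_nat; case: (b) => // b'; rewrite leq_pmulr.
  have s1 : sdot a x <= m.+2%:R * h0%:R ^+ 2.
    rewrite mulr_natl -[X in _ *+ X]card_ord -sumr_const.
    apply: ler_sum => j _; have /andP[xj0 xj1] := x01 j.
    apply: (@le_trans _ _ ((a j ^ 2)%:R)); first by rewrite ler_piMr.
    by rewrite natrX lerXn2r ?nnegrE// ler_nat.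
  have p1 : psi (height a)%:R <= psi 1 by apply: psi_dec; rewrite ?ler1n.
  by move: hab; rewrite -/(sdot a x) ltr_norml => /andP[h1 _]; lra.
exists ([ffun i => inord (a i)], Ordinal bB) => //; rewrite /f/=; congr pair.
by apply/funext => i; rewrite ffunE inordK// ltnS.
Qed.

Lemma W_outer_zero :
  (\sum_(1 <= h <oo) ((h%:R ^+ m * psi h%:R)%:E) < +oo)%E ->
  lebesgue_outer (@W R m.+2 psi) = 0%E.
Proof.
move=> conv; apply/eqP; rewrite eq_le outer_ge0 andbT.
apply/lee_addgt0Pr => e e0; rewrite add0e.
pose P := (Num.truncn (psi 1)).+1.
have psiP h : (0 < h)%N -> psi h%:R <= P%:R.
  move=> h1; apply: (@le_trans _ _ (psi 1)); last by rewrite ltW// truncnS_gt.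
  by apply: psi_dec; rewrite ?ler1n.
have psih h : (0 < h)%N -> 0 < psi h%:R by move=> h1; rewrite psi0// ltr0n.
pose C := kcover R m P.
have C0 : 0 <= C by exact: ler0n.
pose u h : R := if (0 < h)%N then h%:R ^+ m * psi h%:R else 0.
have u0 h : 0 <= u h.
  by rewrite /u; case: ifP => // h1; rewrite mulr_ge0 ?exprn_ge0// ltW// psih.
have uoo : (\sum_(0 <= h <oo) (u h)%:E < +oo)%E.
  apply: le_lt_trans conv; rewrite [leRHS]eseries_cond [leRHS]eseries_mkcond.
  apply: lee_nneseries => h *; first by rewrite lee_fin.
  by rewrite /u/=; case: h.
have e1 : 0 < e / (C + 1) by rewrite divr_gt0// ltr_wpDl.
have [h1 tl] := tail_small u0 uoo e1.
pose h0 := h1.+1.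
have dom : dominated u u by move=> k; rewrite u0 lexx.
have NG h : {NG : {N : nat & pred {ffun 'I_m.+2 -> 'I_N}} | (0 < h)%N ->
  [/\ (0 < projT1 NG)%N,
      #|projT2 NG|%:R <= C * (h%:R ^+ m * psi h%:R) * ((projT1 NG) ^ m.+2)%:R &
      forall (x : 'I_m.+2 -> R) (a : 'I_m.+2 -> nat) b, (forall i, 0 <= x i <= 1) ->
        height a = h -> `|sdot a x - (b ^ 2)%:R| < psi h%:R ->
        exists2 g, projT2 NG g & forall i,
          gpt (fun=> 0) 1 g i <= x i <= gpt (fun=> 0) 1 g i + (projT1 NG)%:R^-1] }.
  (* Height 0 gets a dummy value; [S] is empty below the positive [h0]. *)
  apply: cid; case: (posnP h) => [->|h2]; first by exists (existT _ 0%N xpredT).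
  have [N [G H]] := height_cover m h2 (psih _ h2) (psiP _ h2).
  by exists (existT _ N G).
pose N h := projT1 (sval (NG h)).
pose G h : pred {ffun 'I_m.+2 -> 'I_(N h)} := projT2 (sval (NG h)).
have NGP h (h2 : (0 < h)%N) := svalP (NG h) h2.
pose S h : seq ('I_m.+2 -> R) :=
  if (h0 <= h)%N then [seq gpt (fun=> 0) 1 g | g <- enum (G h)] else [::].
apply: (@outer_le_cover R m.+2 _ _ S (fun h => (N h)%:R^-1)) => //.
- move=> x Wx; have [a [b [ha hb hx]]] := W_unbounded_height h0 Wx.
  have [N0 _ /(_ x a b)] := NGP _ hb; case: Wx => x01 _.
  move=> /(_ x01 erefl hx)[g Gg gx]; exists (height a), (index g (enum (G (height a)))).
  have gE : g \in enum (G (height a)) by rewrite mem_enum.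
  rewrite /S ha size_map index_mem; split => // i.
  by rewrite (nth_map g) ?index_mem// nth_index.
- move=> H.
  have term h : (size (S h))%:R * (N h)%:R^-1 ^+ m.+2 <= if (h0 <= h)%N then C * u h else 0.
    rewrite /S; case: ifP => [hh|_]; last by rewrite mul0r.
    have h2 : (0 < h)%N by exact: leq_trans hh.
    have [N0 cG _] := NGP _ h2.
    rewrite size_map -cardE exprVn ler_pdivrMr ?exprn_gt0 ?ltr0n// -natrX.
    by rewrite /u h2.
  apply: (@le_trans _ _ (\sum_(h < H) if (h0 <= h)%N then C * u h else 0)).
    by apply: ler_sum => h _; exact: term.
  rewrite -big_mkcond -(big_geq_mkord _ _ xpredT (fun h => C * u h))/= -mulr_sumr.
  have tl0 : \sum_(h0 <= h < H) u h <= e / (C + 1).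
    have [Hh|hH] := leqP h0 H; last by rewrite big_geq ?ltW// ltnW.
    apply: le_trans (tl u h0 dom (leqnSn _)).
    rewrite (tail_split u0 uoo dom Hh) lerDl; exact: tail_ge0 dom.
  apply: (le_trans (ler_wpM2l C0 tl0)); rewrite mulrCA ler_piMr ?(ltW e0)//.
  by rewrite ler_pdivrMr ?ltr_wpDl// mul1r lerDl.
Qed.

Lemma W_outer_one : psi x @[x --> +oo] --> 0 ->
  (\sum_(1 <= h <oo) ((h%:R ^+ m * psi h%:R)%:E) = +oo)%E ->
  lebesgue_outer (@W R m.+2 psi) = 1%E.
Proof.
move=> psi_cvg div; apply/eqP; rewrite eq_le; apply/andP; split.
  by apply: outer_unit_cube => // x [].
apply: le_ereal_inf_tmp => _ [a [b [ab cov ->]]].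
have vol0 k : 0 <= box_vol (a k) (b k).
  by apply: prodr_ge0 => i _; rewrite subr_ge0.
set s := (\sum_(0 <= k <oo) _)%E; rewrite leNgt; apply/negP => s1.
have sge0 : (0 <= s)%E by apply: nneseries_ge0 => k _ _; rewrite lee_fin.
have [t tE] : exists t : R, s = t%:E.
  have sf : s \is a fin_num by rewrite ge0_fin_numE// (lt_trans s1)// ltry.
  by exists (fine s); rewrite fineK.
rewrite tE lte_fin in s1; rewrite tE lee_fin in sge0.
(* The budget: starting at [delta] costs at most [m.+2 * delta = tau] by Bernoulli, and inflating
   box [k] adds volume at most [tau / 2 ^ k.+1], [tau] in all; [t + tau < 1 - tau] remains. *)
pose tau := (1 - t) / 4; have tau0 : 0 < tau by rewrite divr_gt0// subr_gt0.
pose delta := tau / m.+2%:R.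
have delta0 : 0 < delta by rewrite divr_gt0.
have delta1 : delta <= tau by rewrite ler_pdivrMr// ler_peMr ?(ltW tau0)// ler1n.
have tau1 : tau <= 4^-1 by rewrite /tau; lra.
have dl1 : delta < 1 by lra.
have [c c0 dens] := local_density psi0 psi_dec psi_cvg div delta0 (ltW dl1).
have infl k : exists e, 0 < e /\ box_vol (fun i => a k i - e) (fun i => b k i + e)
    <= box_vol (a k) (b k) + tau / (2 ^ k.+1)%:R.
  have t2 : 0 < tau / (2 ^ k.+1)%:R by rewrite divr_gt0// ltr0n expn_gt0.
  by have [e e0 h] := box_vol_inflate (a k) (b k) t2; exists e.
have [e eP] := choice infl.
pose v k := box_vol (a k) (b k) + tau / (2 ^ k.+1)%:R.
have v0 k : 0 <= v k by rewrite addr_ge0// divr_ge0// ltW.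
have vle : (\sum_(0 <= k <oo) (v k)%:E <= (t + tau)%:E)%E.
  rewrite EFinD -tE /s.
  have := @epsilon_trick R (fun k => (box_vol (a k) (b k))%:E) tau xpredT _ (ltW tau0).
  by apply => k; rewrite lee_fin.
have voo : (\sum_(0 <= k <oo) (v k)%:E < +oo)%E by apply: (le_lt_trans vle); rewrite ltry.
have e0 k : 0 < e k by case: (eP k).
have volE k : box_vol (fun i => a k i - e k) (fun i => b k i + e k) <= v k by case: (eP k).
have [|x [xd xb xs]] := nested_point c0 e0 dl1 ab voo dens volE.
  have dom : dominated v (fun k => ov (fun i => a k i - e k) (fun i => b k i + e k)
      (fun=> delta) (1 - delta)).
    move=> k; rewrite ov_ge0 ?subr_ge0 ?(ltW dl1)//=; apply: le_trans (volE k).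
    apply: ov_le => [|i]; first by rewrite subr_ge0 ltW.
    by have := ab k i; have := e0 k; lra.
  apply: (le_lt_trans (tail_le v0 voo 0 dom)).
  have : tail v 0 <= t + tau.
    by rewrite -lee_fin fineK// (tail_fin v0 voo)// => k; rewrite v0 lexx.
  have := @bernoulli_ineq R delta m.+2.
  rewrite mulrC divfK ?pnatr_eq0// => /(_ _) h h1.
  apply: (le_lt_trans h1); apply: lt_le_trans (h _); first by rewrite /tau; lra.
  by rewrite (ltW delta0) ltW.
have : W psi x.
  split; first by move=> i; have /andP[x1 x2] := xd i; rewrite x2 andbT; lra.
  move=> fin.
  (* Finitely many pairs would have finitely many heights, but there is a solution whose height
     exceeds the sum of them all. *)
  have /finite_seqP[q qE] := finite_image (fun ab => height ab.1) fin.
  have [a' [b' [ha hb]]] := xs (\sum_(h <- q) h).+1.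
  have ha0 : (0 < height a')%N by exact: leq_trans ha.
  have : height a' \in q.
    have : [set` q] (height a').
      rewrite -qE; exists (a', b') => //; split => // a0; move: ha0; rewrite /height.
      rewrite lt0n; apply/negP/negPn; rewrite -leqn0; apply/bigmax_leqP => i _.
      by rewrite [a' _](congr1 (fun f => f i) a0).
    by [].
  move=> hq; move: ha; rewrite ltnNge; apply/negP/negPn.
  by rewrite (big_rem _ hq)/= leq_addr.
by move=> /cov[k _ bx]; exact: xb bx.
Qed.

End measure_of_W.

Theorem theorem1 (R : realType) (n : nat) (psi : R -> R) :
  (2 <= n)%N ->
  (forall h, 0 < h -> 0 < psi h) ->
  ((forall x y, 0 < x -> x <= y -> psi y <= psi x) \/
   (forall x y, 0 < x -> x <= y -> psi x <= psi y)) ->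
  psi x @[x --> +oo] --> 0 ->
  ((\sum_(1 <= h <oo) ((h%:R ^+ (n - 2)%N * psi h%:R)%:E) < +oo)%E ->
     @lebesgue_outer R n (@W R n psi) = 0%E) /\
  ((\sum_(1 <= h <oo) ((h%:R ^+ (n - 2)%N * psi h%:R)%:E) = +oo)%E ->
     @lebesgue_outer R n (@W R n psi) = 1%E).
Proof.
case: n => [//|[//|m]] _ psi0 mono psi_cvg; rewrite !subSS subn0.
have psi_dec : forall x y, 0 < x -> x <= y -> psi y <= psi x.
  (* A nondecreasing [psi] stays above [psi 1 > 0] and cannot tend to 0. *)
  case: mono => // psi_inc; exfalso.
  have h0 : 0 < psi 1 / 2 by rewrite divr_gt0// psi0.
  have /cvgrPdist_le/(_ _ h0)[A [_ HA]] := psi_cvg.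
  pose y := Num.max (A + 1) 1.
  have Ay : A < y by rewrite lt_max ltrDl ltr01.
  have y1 : 1 <= y by rewrite le_max lexx orbT.
  have := HA _ Ay; rewrite /= sub0r normrN gtr0_norm ?psi0 ?(lt_le_trans ltr01)//.
  by have := psi_inc 1 y ltr01 y1; have := psi0 1 ltr01; lra.
split; first exact: W_outer_zero.
exact: W_outer_one.
Qed.
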